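(* Let $\mathbb G_m=\mathrm{Spec}\,A[y,y^{-1}]$ be the multiplicative group over $A$, and let $L$ be the fraction field of $A$. For each $r\ge1$, the $L$-vector space $\mathbf X^r_{pq}(\mathbb G_m)\otimes_AL$ has basis $$\{\phi_p^i\psi_p\;:\;0\le i\le r-1\}\cup\{\phi_p^i\delta_q^j\psi_q\;:\;i,j\ge 0,\ 0\le i+j\le r-1\}.$$ In particular, $\psi_p$ and $\psi_q$ generate the $L[\phi_p,\delta_q]$-module $\mathbf X^\infty_{pq}(\mathbb G_m)\otimes L$.
   Context: Fix a prime $p\neq 2$. Let $C_p(X,Y)=\frac{X^p+Y^p-(X+Y)^p}{p}\in\mathbb{Z}[X,Y]$. For a ring $S$ and an $S$-algebra $S'$, a $p$-derivation $\delta_p:S\to S'$ is a map with $\delta_p(1)=0$, $\delta_p(x+y)=\delta_p x+\delta_p y+C_p(x,y)$, $\delta_p(xy)=x^p\delta_p y+y^p\delta_p x+p\,\delta_p x\,\delta_p y$; then $\phi_p(x)=x^p+p\,\delta_p x$ is a ring homomorphism. Given such $\delta_p$, a $\delta_p$-derivation $\delta_q:S\to S'$ is a derivation such that $\delta_q\delta_p x=p\,\delta_p\delta_q x+(\delta_q x)^p-x^{p-1}\delta_q x$ for all $x$. A $\{\delta_p,\delta_q\}$-ring is a ring $A$ with a $p$-derivation $\delta_p:A\to A$ and a $\delta_p$-derivation $\delta_q:A\to A$. Throughout $A$ is a fixed $\{\delta_p,\delta_q\}$-ring which is a $p$-adically complete Noetherian integral domain of characteristic zero. A $\{\delta_p,\delta_q\}$-prolongation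 sequence $S^*$ is a sequence of rings $S^n$ ($n\ge0$) with ring homomorphisms $\varphi:S^n\to S^{n+1}$ (making $S^{n+1}$ an $S^n$-algebra), $p$-derivations $\delta_p:S^n\to S^{n+1}$ and $\delta_p$-derivations $\delta_q:S^n\to S^{n+1}$ commuting with $\varphi$. Morphisms are sequences of ring homomorphisms commuting with $\varphi,\delta_p,\delta_q$. $A$ gives the constant sequence $A^n=A$, $\varphi=\mathrm{id}$; a sequence over $A$ is one with a morphism from $A^*$. For a smooth commutative group scheme $G$ over $A$, a $\{\delta_p,\delta_q\}$-character of order $r$ of $G$ is a rule $\psi$ attaching to each prolongation sequence $S^*$ over $A$ consisting of $p$-adically complete rings a group homomorphism $\psi:G(S^0)\to\mathbb{G}_a(S^r)=S^r$, functorially in $S^*$. These form an $A$-module $\mathbf{X}^r_{pq}(G)$; composing with $\varphi:S^r\to S^{r+1}$ gives maps $\mathbf{X}^r_{pq}(G)\to\mathbf{X}^{r+1}_{pq}(G)$, and $\mathbf{X}^\infty_{pq}(G)$ is the direct limit. Composition with $\phi_p,\delta_q:S^r\to S^{r+1}$ defines $\phi_p\psi,\delta_q\psi$. For $B=A$ or $L$, $B[\phi_p,\delta_q]$ is the ring generated by $B$ and symbols $\phi_p,\delta_q$ subject to $\delta_q\phi_p=p\,\phi_p\delta_q$, $\delta_q b-b\delta_q=\delta_q(b)$, $\phi_p b=\phi_p(b)\phi_p$. The order one characters of $\mathbb G_m$ are: $\psi_p(u)=\frac1p\log\frac{\phi_p(u)}{u^p}:=\sum_{n\ge1}(-1)^{n-1}\frac{p^{n-1}}{n}\left(\frac{\delta_pu}{u^p}\right)^n$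 and $\psi_q(u)=\frac{\delta_qu}{u}$, for $u\in\mathbb G_m(S^0)=(S^0)^\times$. *)

(* Defs.v *)
From HB Require Import structures.
From mathcomp Require Import all_boot all_order all_algebra.
From mathcomp Require Import boolp classical_sets.
From mathcomp Require Import ring.

Set Implicit Arguments.
Unset Strict Implicit.
Unset Printing Implicit Defensive.

Import GRing.Theory.
Local Open Scope ring_scope.
Local Open Scope quotient_scope.

(* Rings are [comPzRingType]s, so the zero ring is allowed. *)

Section PDerivations.

Variable p : nat.

(* (X^p + Y^p - (X+Y)^p)/p, expanded by the binomial formula so that its
   coefficients are visibly integers; see [Cp_mulp]. *)
Definition Cp (R : comPzRingType) (x y : R) : R :=
  - \sum_(1 <= i < p) ('C(p, i) %/ p)%:R * (x ^+ (p - i) * y ^+ i).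

Lemma Cp_mulp (R : comPzRingType) (x y : R) : prime p ->
  p%:R * Cp x y = x ^+ p + y ^+ p - (x + y) ^+ p.
Proof.
move=> pr_p; have p0 := prime_gt0 pr_p.
rewrite exprDn -(big_mkord xpredT (fun i => x ^+ (p - i) * y ^+ i *+ 'C(p, i))).
rewrite big_nat_recr //= big_ltn // subn0 bin0 binn subnn !expr0 !mulr1n.
have -> : \sum_(1 <= i < p) x ^+ (p - i) * y ^+ i *+ 'C(p, i) = - (p%:R * Cp x y).
  rewrite /Cp mulrN opprK mulr_sumr; apply: eq_big_nat => i /andP[i0 ip].
  have /divnK {1}<- : (p %| 'C(p, i))%N by rewrite prime_dvd_bin ?i0.
  by rewrite -[LHS]mulr_natl natrM; ring.
by ring.
Qed.

Definition is_pder (S S' : comPzRingType) (f : {rmorphism S -> S'})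
    (dp : S -> S') : Prop :=
  [/\ dp 1 = 0,
      forall x y, dp (x + y) = dp x + dp y + Cp (f x) (f y)
    & forall x y, dp (x * y) =
        f x ^+ p * dp y + f y ^+ p * dp x + p%:R * (dp x * dp y)].

Definition is_der (S S' : comPzRingType) (f : {rmorphism S -> S'})
    (d : S -> S') : Prop :=
  (forall x y, d (x + y) = d x + d y) /\
  (forall x y, d (x * y) = f x * d y + f y * d x).

(* The compatibility between the two operators lives in the second of two
   successive algebras S -> S' -> S''. *)
Definition is_dpder (S S' S'' : comPzRingType)
    (f : {rmorphism S -> S'}) (f' : {rmorphism S' -> S''})
    (dp : S -> S') (dp' : S' -> S'') (dq : S -> S') (dq' : S' -> S'') : Prop :=
  is_der f dq /\
  (forall x, dq' (dp x) =
     p%:R * dp' (dq x) + f' (dq x) ^+ p - f' (f x) ^+ p.-1 * f' (dq x)).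

Definition frob (S S' : comPzRingType) (f : {rmorphism S -> S'})
    (dp : S -> S') (x : S) : S' := f x ^+ p + p%:R * dp x.

Record dpq_ring (A : comPzRingType) := DpqRing {
  rdp : A -> A;
  rdq : A -> A;
  rdp_pder : is_pder idfun rdp;
  rdq_dpder : is_dpder idfun idfun rdp rdp rdq rdq
}.

Record pro_seq := ProSeq {
  ps_ring :> nat -> comPzRingType;
  ps_emb : forall n, {rmorphism ps_ring n -> ps_ring n.+1};
  ps_dp : forall n, ps_ring n -> ps_ring n.+1;
  ps_dq : forall n, ps_ring n -> ps_ring n.+1;
  ps_pder : forall n, is_pder (ps_emb n) (@ps_dp n);
  ps_dpder : forall n, is_dpder (ps_emb n) (ps_emb n.+1)
    (@ps_dp n) (@ps_dp n.+1) (@ps_dq n) (@ps_dq n.+1);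
  ps_dp_emb : forall n x, ps_dp (ps_emb n x) = ps_emb n.+1 (ps_dp x);
  ps_dq_emb : forall n x, ps_dq (ps_emb n x) = ps_emb n.+1 (ps_dq x)
}.

Definition ps_frob (S : pro_seq) n : S n -> S n.+1 :=
  frob (ps_emb S n) (@ps_dp S n).

Record ps_hom (S T : pro_seq) := PsHom {
  ps_map :> forall n, {rmorphism S n -> T n};
  ps_map_emb : forall n x, ps_map n.+1 (ps_emb S n x) = ps_emb T n (ps_map n x);
  ps_map_dp : forall n x, ps_map n.+1 (@ps_dp S n x) = ps_dp (ps_map n x);
  ps_map_dq : forall n x, ps_map n.+1 (@ps_dq S n x) = ps_dq (ps_map n x)
}.

Definition const_seq (A : comPzRingType) (D : dpq_ring A) : pro_seq :=
  @ProSeq (fun=> A) (fun=> idfun) (fun=> rdp D) (fun=> rdq D)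
    (fun=> rdp_pder D) (fun=> rdq_dpder D) (fun _ _ => erefl) (fun _ _ => erefl).

(* S -> lim S/p^n is injective and surjective. *)
Definition padic_complete (S : comPzRingType) : Prop :=
  (forall x : S, (forall n, exists y, x = p%:R ^+ n * y) -> x = 0) /\
  (forall s : nat -> S,
     (forall n, exists y, s n.+1 - s n = p%:R ^+ n * y) ->
     exists l, forall n, exists y, l - s n = p%:R ^+ n * y).

Definition padic_cvg (S : comPzRingType) (s : nat -> S) (l : S) : Prop :=
  forall k, exists N, forall n, (N <= n)%N -> exists y, s n - l = p%:R ^+ k * y.

Record cseq (A : comPzRingType) (D : dpq_ring A) := CSeq {
  cs_seq :> pro_seq;
  cs_str : ps_hom (const_seq D) cs_seq;
  cs_complete : forall n, padic_complete (cs_seq n)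
}.

End PDerivations.

Arguments ps_dp {p} S n x : rename.
Arguments ps_dq {p} S n x : rename.
Arguments ps_emb {p} S n : rename.
Arguments ps_frob {p} S n x : rename.
Arguments cs_str {p A D} S : rename.
Arguments pro_seq p : clear implicits.

Definition noetherian (A : comPzRingType) : Prop :=
  forall I : set A,
    I 0 -> (forall x y, I x -> I y -> I (x + y)) ->
    (forall a x, I x -> I (a * x)) ->
    exists (n : nat) (g : 'I_n -> A),
      forall x, I x <-> exists c : 'I_n -> A, x = \sum_i c i * g i.

Section FrobTheory.

Variables (p : nat) (S S' : comPzRingType) (f : {rmorphism S -> S'}).
Variables (dp : S -> S') (Hdp : is_pder p f dp).

Lemma frobD : prime p -> forall x y,
  frob p f dp (x + y) = frob p f dp x + frob p f dp y.
Proof.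
case: Hdp => _ dpD _ pr_p x y.
by rewrite /frob dpD !mulrDr Cp_mulp // rmorphD /=; ring.
Qed.

Lemma frobM x y : frob p f dp (x * y) = frob p f dp x * frob p f dp y.
Proof.
case: Hdp => _ _ dpM.
by rewrite /frob dpM rmorphM exprMn; ring.
Qed.

End FrobTheory.

Section ProSeqTheory.

Variables (p : nat) (pr_p : prime p) (S : pro_seq p) (n : nat).
Implicit Types x y : S n.

Lemma ps_frobD x y : ps_frob S n (x + y) = ps_frob S n x + ps_frob S n y.
Proof. exact: (frobD (ps_pder S n) pr_p). Qed.

Lemma ps_frobM x y : ps_frob S n (x * y) = ps_frob S n x * ps_frob S n y.
Proof. exact: (frobM (ps_pder S n)). Qed.

Lemma ps_dqD x y : ps_dq S n (x + y) = ps_dq S n x + ps_dq S n y.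
Proof. by have [[->]] := ps_dpder S n. Qed.

Lemma ps_dqM x y : ps_dq S n (x * y) =
  ps_emb S n x * ps_dq S n y + ps_emb S n y * ps_dq S n x.
Proof. by have [[_ ->]] := ps_dpder S n. Qed.

Lemma ps_dq_frob x : ps_dq S n.+1 (ps_frob S n x) =
  p%:R * ps_frob S n.+1 (ps_dq S n x).
Proof.
have [[dqD dqM] _] := ps_dpder S n.+1; have [_ dqdp] := ps_dpder S n.
have dq1 : ps_dq S n.+1 1 = 0.
  have := dqM 1 1; rewrite !mulr1 rmorph1 !mul1r.
  by move/(congr1 (fun z => z - ps_dq S n.+1 1)); rewrite subrr addrK.
have dqX (z : S n.+1) k : ps_dq S n.+1 (z ^+ k) =
    k%:R * ps_emb S n.+1 z ^+ k.-1 * ps_dq S n.+1 z.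
  elim: k => [|[|k] IHk]; first by rewrite expr0 dq1 !mul0r.
    by rewrite expr1 expr0 !mul1r.
  by rewrite exprS dqM IHk /= rmorphXn !exprS -[k.+2]addn1 natrD; ring.
have dqn k : ps_dq S n.+1 k%:R = 0.
  by elim: k => [|k IHk]; [have := dqX 0 1%N; rewrite expr1 expr0 mul1r;
    have := dqD 0 0; rewrite addr0 => /(congr1 (fun z => z - ps_dq S n.+1 0));
    rewrite subrr addrK | rewrite -natr1 dqD IHk dq1 addr0].
rewrite /ps_frob /frob dqD dqX dqM dqn rmorph_nat dqdp ps_dq_emb.
by ring.
Qed.

Lemma ps_map_frob (T : pro_seq p) (f : ps_hom S T) x :
  f n.+1 (ps_frob S n x) = ps_frob T n (f n x).
Proof.
by rewrite /ps_frob /frob rmorphD rmorphM rmorphXn rmorph_nat /=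
  ps_map_emb ps_map_dp.
Qed.

End ProSeqTheory.

(* Modules are not [lmodType]s here: a character is a family indexed by a
   class of [comPzRingType]s, and MathComp constrains the carrier of an
   [lmodType] to a universe too small to contain it. *)
Record lmodule (R : pzRingType) := LModule {
  lm_car :> Type;
  lm_zero : lm_car;
  lm_add : lm_car -> lm_car -> lm_car;
  lm_opp : lm_car -> lm_car;
  lm_scale : R -> lm_car -> lm_car;
  lm_addA : associative lm_add;
  lm_addC : commutative lm_add;
  lm_add0 : left_id lm_zero lm_add;
  lm_addN : left_inverse lm_zero lm_opp lm_add;
  lm_scaleA : forall a b x, lm_scale a (lm_scale b x) = lm_scale (a * b) x;
  lm_scale1 : left_id 1 lm_scale;
  lm_scaleDr : right_distributive lm_scale lm_add;
  lm_scaleDl : forall x, {morph lm_scale^~ x : a b / a + b >-> lm_add a b}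
}.

Arguments lm_zero {R M} : rename.
Arguments lm_add {R M} x y : rename.
Arguments lm_opp {R M} x : rename.
Arguments lm_scale {R M} a x : rename.

HB.instance Definition _ (R : pzRingType) (M : lmodule R) :=
  Monoid.isComLaw.Build M lm_zero (@lm_add R M)
    (@lm_addA R M) (@lm_addC R M) (@lm_add0 R M).

Declare Scope lmodule_scope.
Delimit Scope lmodule_scope with LM.
Notation "x + y" := (lm_add x y) : lmodule_scope.
Notation "a *: x" := (lm_scale a x) : lmodule_scope.
Notation "\sum_ ( i : I ) F" := (\big[lm_add/lm_zero]_(i : I) F%LM)
  : lmodule_scope.

Definition is_basis (K : fieldType) (V : lmodule K) (I : finType)
    (e : I -> V) : Prop :=
  (forall v, exists c : I -> K, v = (\sum_(i : I) c i *: e i)%LM) /\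
  (forall c : I -> K, (\sum_(i : I) c i *: e i)%LM = lm_zero ->
     forall i, c i = 0).

Section LModuleTheory.

Variables (R : pzRingType) (M : lmodule R).
Implicit Types x y z : M.

Lemma lm_addr0 x : (x + lm_zero)%LM = x.
Proof. by rewrite lm_addC lm_add0. Qed.

Lemma lm_addI x y z : (x + y)%LM = (x + z)%LM -> y = z.
Proof.
by move=> /(congr1 (lm_add (lm_opp x))); rewrite !lm_addA lm_addN !lm_add0.
Qed.

Lemma lm_scale0 x : (0 *: x)%LM = lm_zero.
Proof.
apply: (@lm_addI (0 *: x)%LM).
by rewrite -lm_scaleDl addr0 lm_addr0.
Qed.

Lemma lm_scaler0 a : (a *: lm_zero)%LM = lm_zero :> M.
Proof.
apply: (@lm_addI (a *: lm_zero)%LM).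
by rewrite -lm_scaleDr !lm_addr0.
Qed.

End LModuleTheory.

(* The R-module with generators G and relations [Rel], as formal
   combinations modulo the congruence generated by the relations. *)
Section Presentation.

Variables (R : comPzRingType) (G : Type).

Definition fcomb := seq (R * G).

Variable Rel : fcomb -> fcomb -> Prop.

Definition fscale (a : R) (s : fcomb) : fcomb := [seq (a * x.1, x.2) | x <- s].

Inductive pres_eq : fcomb -> fcomb -> Prop :=
| PresRefl s : pres_eq s s
| PresSym s t : pres_eq s t -> pres_eq t s
| PresTrans s t u : pres_eq s t -> pres_eq t u -> pres_eq s u
| PresCat s s' t t' : pres_eq s s' -> pres_eq t t' ->
    pres_eq (s ++ t) (s' ++ t')
| PresComm s t : pres_eq (s ++ t) (t ++ s)
| PresAdd a b g : pres_eq [:: (a + b, g)] [:: (a, g); (b, g)]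
| PresZero g : pres_eq [:: (0, g)] [::]
| PresRel a s t : Rel s t -> pres_eq (fscale a s) (fscale a t).

(* The set of equivalence classes; [{eq_quot _}] is out of reach for the same
   universe reason as above. *)
Definition pres_quot := {C : fcomb -> Prop | exists s, C = pres_eq s}.

Definition pres_class (s : fcomb) : pres_quot :=
  exist _ (pres_eq s) (ex_intro _ s erefl).

Definition pres_repr (x : pres_quot) : fcomb := projT1 (cid (proj2_sig x)).

Lemma pres_classP s t : pres_class s = pres_class t <-> pres_eq s t.
Proof.
split=> [/(congr1 (fun C => proj1_sig C t)) /= ->|st]; first exact: PresRefl.
apply: eq_exist; apply: funext => u; apply: propext.
by split=> [|tu]; [apply: PresTrans (PresSym st)|apply: PresTrans tu].
Qed.

Lemma pres_reprK x : pres_class (pres_repr x) = x.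
Proof.
case: x => C CP; apply: eq_exist; rewrite /pres_repr /=.
by case: (cid CP) => s /= ->.
Qed.

Lemma pres_ind (P : pres_quot -> Prop) :
  (forall s, P (pres_class s)) -> forall x, P x.
Proof. by move=> Ps x; rewrite -(pres_reprK x). Qed.

Lemma pres_repr_eq s : pres_eq (pres_repr (pres_class s)) s.
Proof. by apply/pres_classP/pres_reprK. Qed.

Lemma fscale_nil a : fscale a [::] = [::].
Proof. by []. Qed.

Lemma fscale_cons a b g s : fscale a ((b, g) :: s) = (a * b, g) :: fscale a s.
Proof. by []. Qed.

Lemma fscaleM a b s : fscale a (fscale b s) = fscale (a * b) s.
Proof. by rewrite /fscale -map_comp; apply: eq_map => x /=; rewrite mulrA. Qed.

Lemma fscale_eq a s t : pres_eq s t -> pres_eq (fscale a s) (fscale a t).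
Proof.
elim=> {s t} [s|s t _|s t u _ st _|s s' t t' _ ss' _|s t|b c g|g|b s t st].
- exact: PresRefl.
- exact: PresSym.
- exact: PresTrans.
- by rewrite /fscale !map_cat; apply: PresCat.
- by rewrite /fscale !map_cat; apply: PresComm.
- by rewrite /= mulrDr; apply: PresAdd.
- by rewrite /= mulr0; apply: PresZero.
- by rewrite !fscaleM; apply: PresRel.
Qed.

Lemma fscaleD a b s : pres_eq (fscale (a + b) s) (fscale a s ++ fscale b s).
Proof.
elim: s => [|[c g] s IHs] /=; first exact: PresRefl.
rewrite mulrDl; apply: (PresTrans (PresCat (PresAdd _ _ _) IHs)) => /=.
apply: (@PresCat [:: (a * c, g)] _ _ _ (PresRefl _)).
have := PresCat (PresComm [:: (b * c, g)] (fscale a s)) (PresRefl (fscale b s)).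
by rewrite -[(fscale a s ++ _) ++ _]catA.
Qed.

Lemma fscale0 s : pres_eq (fscale 0 s) [::].
Proof.
elim: s => [|[c g] s IHs] /=; first exact: PresRefl.
by rewrite mul0r -cat1s; apply: (PresCat (PresZero _) IHs).
Qed.

Lemma fscale1 s : fscale 1 s = s.
Proof. by rewrite /fscale -[RHS]map_id; apply: eq_map => -[a g] /=; rewrite mul1r. Qed.

Definition pres_add (x y : pres_quot) := pres_class (pres_repr x ++ pres_repr y).
Definition pres_scale a (x : pres_quot) := pres_class (fscale a (pres_repr x)).

Lemma pres_addE s t :
  pres_add (pres_class s) (pres_class t) = pres_class (s ++ t).
Proof. by apply/pres_classP/PresCat; apply: pres_repr_eq. Qed.

Lemma pres_scaleE a s : pres_scale a (pres_class s) = pres_class (fscale a s).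
Proof. exact/pres_classP/fscale_eq/pres_repr_eq. Qed.

Program Definition pres_mod : lmodule R :=
  @LModule R pres_quot (pres_class [::]) pres_add (pres_scale (-1)) pres_scale
    _ _ _ _ _ _ _ _.
Next Obligation.
elim/pres_ind=> s; elim/pres_ind=> t; elim/pres_ind=> u.
by rewrite !pres_addE catA.
Qed.
Next Obligation.
elim/pres_ind=> s; elim/pres_ind=> t.
by rewrite !pres_addE; apply/pres_classP/PresComm.
Qed.
Next Obligation. by elim/pres_ind=> s; rewrite pres_addE. Qed.
Next Obligation.
elim/pres_ind=> s; rewrite pres_scaleE pres_addE; apply/pres_classP.
rewrite -{2}[s]fscale1; apply: PresTrans (fscale0 s).
by rewrite -(addNr 1); apply/PresSym/fscaleD.
Qed.
Next Obligation.
by elim/pres_ind: x => s; rewrite !pres_scaleE fscaleM.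
Qed.
Next Obligation. by elim/pres_ind=> s; rewrite pres_scaleE fscale1. Qed.
Next Obligation.
move=> a; elim/pres_ind=> s; elim/pres_ind=> t.
by rewrite !(pres_addE, pres_scaleE) /fscale map_cat.
Qed.
Next Obligation.
elim/pres_ind: x => s a b; rewrite !(pres_addE, pres_scaleE).
exact/pres_classP/fscaleD.
Qed.

Definition pres_gen (g : G) : pres_mod := pres_class [:: (1, g)].

Lemma pres_cons a g s :
  pres_class ((a, g) :: s) = (a *: pres_gen g + (pres_class s : pres_mod))%LM.
Proof. by rewrite /= pres_scaleE pres_addE /= mulr1. Qed.

Lemma pres_rel s t : Rel s t -> pres_class s = pres_class t.
Proof.
by move=> st; apply/pres_classP; rewrite -[s]fscale1 -[t]fscale1; apply: PresRel.
Qed.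

Section Lift.

Variables (R' : pzRingType) (N : lmodule R') (f : R -> G -> N).

Definition flift (s : fcomb) : N := \big[lm_add/lm_zero]_(x <- s) f x.1 x.2.

Definition pres_lift (x : pres_mod) : N := flift (pres_repr x).

Lemma flift_nil : flift [::] = lm_zero.
Proof. by rewrite /flift big_nil. Qed.

Lemma flift_cons a g s : flift ((a, g) :: s) = (f a g + flift s)%LM.
Proof. by rewrite /flift big_cons. Qed.

Hypothesis fD : forall a b g, f (a + b) g = (f a g + f b g)%LM.
Hypothesis fRel : forall a s t, Rel s t ->
  flift (fscale a s) = flift (fscale a t).

Lemma flift_eq s t : pres_eq s t -> flift s = flift t.
Proof.
have f0 g : f 0 g = lm_zero.
  by apply: (@lm_addI _ _ (f 0 g)); rewrite -fD addr0 lm_addr0.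
elim=> {s t} [s|s t _|s t u _ st _|s s' t t' _ ss' _|s t|b c g|g|b s t st] //.
- by rewrite st.
- by rewrite /flift !big_cat /= => tt'; rewrite [X in lm_add X]ss' tt'.
- by rewrite /flift !big_cat /= lm_addC.
- by rewrite /flift !big_cons !big_nil /= fD !lm_addr0.
- by rewrite /flift big_cons !big_nil /= f0 lm_addr0.
- exact: fRel.
Qed.

Lemma pres_liftE s : pres_lift (pres_class s) = flift s.
Proof. exact/flift_eq/pres_repr_eq. Qed.

Lemma pres_liftD x y : pres_lift (x + y)%LM = (pres_lift x + pres_lift y)%LM.
Proof.
elim/pres_ind: x => s; elim/pres_ind: y => t.
by rewrite /= pres_addE !pres_liftE /flift big_cat.
Qed.

Lemma pres_lift_gen a g : pres_lift (a *: pres_gen g)%LM = f a g.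
Proof.
by rewrite /= pres_scaleE pres_liftE /flift big_cons big_nil /= mulr1 lm_addr0.
Qed.

End Lift.

(* Additive maps agreeing on the a *: g agree. *)
Lemma pres_add_ext (R' : pzRingType) (N : lmodule R') (u v : pres_mod -> N) :
  (forall x y, u (x + y)%LM = (u x + u y)%LM) ->
  (forall x y, v (x + y)%LM = (v x + v y)%LM) ->
  (forall a g, u (a *: pres_gen g)%LM = v (a *: pres_gen g)%LM) ->
  u =1 v.
Proof.
move=> uD vD uv; have add0 (w : pres_mod -> N) : (forall x y, w (x + y)%LM = (w x + w y)%LM) ->
    w lm_zero = lm_zero :> N.
  by move=> wD; apply: (@lm_addI _ _ (w lm_zero)); rewrite -wD !lm_addr0.
elim/pres_ind; elim=> [|[a g] s IHs]; first by rewrite (add0 u) ?(add0 v).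
by rewrite pres_cons uD vD uv IHs.
Qed.

End Presentation.

Arguments pres_mod : simpl never.

Section Units.

Variable S : comPzRingType.

Definition units := {u : S | `[< exists v, u * v = 1 >]}.

Lemma units_mulP (u v : units) : `[< exists w, val u * val v * w = 1 >].
Proof.
case: u v => [u /asboolP[u' uu']] [v /asboolP[v' vv']] /=; apply/asboolP.
by exists (u' * v'); rewrite mulrACA uu' vv' mulr1.
Qed.

Definition units_mul (u v : units) : units :=
  exist _ (val u * val v) (units_mulP u v).

(* Equal to 0 if x is not a unit. *)
Definition rinv (x : S) : S := xget 0 [set y | x * y = 1].

Lemma rinvP x y : x * y = 1 -> rinv x = y.
Proof.
move=> xy; have : x * rinv x = 1 by apply: (xgetPex 0 (P := [set y | x * y = 1])); exists y.
by move=> /(congr1 (fun z => y * z)); rewrite mulrA [y * x]mulrC xy mul1r mulr1.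
Qed.

End Units.

Lemma units_mapP (S T : comPzRingType) (f : {rmorphism S -> T}) (u : units S) :
  `[< exists w, f (val u) * w = 1 >].
Proof.
case: u => [u /asboolP[u' uu']] /=; apply/asboolP.
by exists (f u'); rewrite -rmorphM uu' rmorph1.
Qed.

Definition units_map (S T : comPzRingType) (f : {rmorphism S -> T})
    (u : units S) : units T := exist _ (f (val u)) (units_mapP f u).

Lemma tagged_existT (I : Type) (T : I -> Type) i (x : T i) : tagged (existT T i x) = x.
Proof. by []. Qed.

Section Characters.

Variables (p : nat) (A : comPzRingType) (D : dpq_ring p A).

(* {delta_p, delta_q}-characters of order r of the multiplicative group. *)
Record gm_char (r : nat) := GmChar {
  ch_fun :> forall S : cseq D, units (S 0) -> S r;
  ch_hom : forall (S : cseq D) (u v : units (S 0)),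
    ch_fun (units_mul u v) = ch_fun u + ch_fun v;
  ch_nat : forall (S T : cseq D) (f : ps_hom S T),
    (forall n a, f n (cs_str S n a) = cs_str T n a) ->
    forall u : units (S 0), f r (ch_fun u) = ch_fun (units_map (f 0) u)
}.

Lemma gm_charP r (x y : gm_char r) :
  (forall (S : cseq D) (u : units (S 0)), x S u = y S u) -> x = y.
Proof.
case: x y => [x xh xn] [y yh yn] /= xy.
have {xy} xy : x = y by apply: functional_extensionality_dep => S; apply: funext.
by subst y; congr GmChar; apply: Prop_irrelevance.
Qed.

Program Definition char_zero r : gm_char r := @GmChar r (fun S _ => 0) _ _.
Next Obligation. by rewrite addr0. Qed.
Next Obligation. by rewrite rmorph0. Qed.

Program Definition char_add r (x y : gm_char r) : gm_char r :=
  @GmChar r (fun S u => x S u + y S u) _ _.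
Next Obligation. by rewrite !ch_hom addrACA. Qed.
Next Obligation. by rewrite rmorphD !(ch_nat _ H). Qed.

Program Definition char_opp r (x : gm_char r) : gm_char r :=
  @GmChar r (fun S u => - x S u) _ _.
Next Obligation. by rewrite !ch_hom opprD. Qed.
Next Obligation. by rewrite rmorphN !(ch_nat _ H). Qed.

Program Definition char_scale r (a : A) (x : gm_char r) : gm_char r :=
  @GmChar r (fun S u => cs_str S r a * x S u) _ _.
Next Obligation. by rewrite !ch_hom mulrDr. Qed.
Next Obligation. by rewrite rmorphM !(ch_nat _ H) /= H. Qed.

Program Definition char_mod (r : nat) : lmodule A :=
  @LModule A (gm_char r) (char_zero r) (@char_add r) (@char_opp r)
    (@char_scale r) _ _ _ _ _ _ _ _.
Next Obligation. by move=> x y z; apply: gm_charP => S u /=; rewrite addrA. Qed.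
Next Obligation. by move=> x y; apply: gm_charP => S u /=; rewrite addrC. Qed.
Next Obligation. by move=> x; apply: gm_charP => S u /=; rewrite add0r. Qed.
Next Obligation. by move=> x; apply: gm_charP => S u /=; rewrite addNr. Qed.
Next Obligation. by apply: gm_charP => S u /=; rewrite rmorphM mulrA. Qed.
Next Obligation. by move=> x; apply: gm_charP => S u /=; rewrite rmorph1 mul1r. Qed.
Next Obligation. by move=> a x y; apply: gm_charP => S u /=; rewrite mulrDr. Qed.
Next Obligation. by move=> a b; apply: gm_charP => S u /=; rewrite rmorphD mulrDl. Qed.

Program Definition char_emb r (x : char_mod r) : char_mod r.+1 :=
  @GmChar r.+1 (fun S u => ps_emb S r (x S u)) _ _.
Next Obligation. by rewrite ch_hom rmorphD. Qed.
Next Obligation. by rewrite ps_map_emb (ch_nat _ H). Qed.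

Program Definition char_dq r (x : char_mod r) : char_mod r.+1 :=
  @GmChar r.+1 (fun S u => ps_dq S r (x S u)) _ _.
Next Obligation. by rewrite ch_hom ps_dqD. Qed.
Next Obligation. by rewrite ps_map_dq (ch_nat _ H). Qed.

Fixpoint iter_emb k r (x : char_mod r) : char_mod (k + r) :=
  if k is k'.+1 then char_emb (iter_emb k' x) else x.

Fixpoint iter_dq j r (x : char_mod r) : char_mod (j + r) :=
  if j is j'.+1 then char_dq (iter_dq j' x) else x.

Definition char_cast r s (e : r = s) (x : char_mod r) : char_mod s :=
  eq_rect r (fun n => char_mod n : Type) x s e.

(* The iterated X^r -> X^{r+1} from X^s to X^r, for s <= r. *)
Definition char_incl s r (le_sr : (s <= r)%N) (x : char_mod s) : char_mod r :=
  char_cast (subnK le_sr) (iter_emb (r - s) x).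

Inductive colim_rel :
  fcomb A {r & char_mod r} -> fcomb A {r & char_mod r} -> Prop :=
| ColimAdd r (x y : char_mod r) : colim_rel
    [:: (1, existT _ r (x + y)%LM)]
    [:: (1, existT _ r x); (1, existT _ r y)]
| ColimScale r a (x : char_mod r) : colim_rel
    [:: (1, existT _ r (a *: x)%LM)] [:: (a, existT _ r x)]
| ColimEmb r (x : char_mod r) : colim_rel
    [:: (1, existT _ r x)] [:: (1, existT _ r.+1 (char_emb x))].

(* The direct limit, as the quotient of the direct sum of the X^r. *)
Definition char_colim : lmodule A := pres_mod colim_rel.

Definition to_colim r (x : char_mod r) : char_colim :=
  pres_gen colim_rel (existT _ r x).

Lemma to_colimD r (x y : char_mod r) :
  to_colim (x + y)%LM = (to_colim x + to_colim y)%LM.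
Proof.
rewrite /to_colim {1}/pres_gen (pres_rel (ColimAdd x y)).
by rewrite !pres_cons !lm_scale1 lm_addr0.
Qed.

Lemma to_colimZ r a (x : char_mod r) :
  to_colim (a *: x)%LM = (a *: to_colim x)%LM.
Proof.
rewrite /to_colim {1}/pres_gen (pres_rel (ColimScale a x)).
by rewrite pres_cons lm_addr0.
Qed.

Lemma to_colim_emb r (x : char_mod r) : to_colim (char_emb x) = to_colim x.
Proof. by rewrite /to_colim /pres_gen -(pres_rel (ColimEmb x)). Qed.

Hypothesis pr_p : prime p.

Program Definition char_frob r (x : char_mod r) : char_mod r.+1 :=
  @GmChar r.+1 (fun S u => ps_frob S r (x S u)) _ _.
Next Obligation. by rewrite ch_hom ps_frobD. Qed.
Next Obligation. by rewrite ps_map_frob (ch_nat _ H). Qed.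

Fixpoint iter_frob i r (x : char_mod r) : char_mod (i + r) :=
  if i is i'.+1 then char_frob (iter_frob i' x) else x.

Definition rfrob : A -> A := frob p idfun (rdp D).

Lemma char_frobD r (x y : char_mod r) :
  char_frob (x + y)%LM = (char_frob x + char_frob y)%LM.
Proof. by apply: gm_charP => S u /=; rewrite ps_frobD. Qed.

Lemma char_frobZ r a (x : char_mod r) :
  char_frob (a *: x)%LM = (rfrob a *: char_frob x)%LM.
Proof.
apply: gm_charP => S u /=; rewrite ps_frobM; congr (_ * _).
by rewrite -(ps_map_frob (cs_str S)).
Qed.

Lemma char_dqD r (x y : char_mod r) :
  char_dq (x + y)%LM = (char_dq x + char_dq y)%LM.
Proof. by apply: gm_charP => S u /=; rewrite ps_dqD. Qed.

Lemma char_dqZ r a (x : char_mod r) :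
  char_dq (a *: x)%LM = (a *: char_dq x + rdq D a *: char_emb x)%LM.
Proof.
apply: gm_charP => S u /=; rewrite ps_dqM -(ps_map_emb (cs_str S)) /=.
by rewrite -(ps_map_dq (cs_str S)) [ps_emb _ _ _ * _]mulrC.
Qed.

Lemma char_emb_frob r (x : char_mod r) :
  char_emb (char_frob x) = char_frob (char_emb x).
Proof.
apply: gm_charP => S u /=; rewrite /ps_frob /frob rmorphD rmorphM rmorph_nat.
by rewrite rmorphXn ps_dp_emb.
Qed.

Lemma char_emb_dq r (x : char_mod r) :
  char_emb (char_dq x) = char_dq (char_emb x).
Proof. by apply: gm_charP => S u /=; rewrite ps_dq_emb. Qed.

Lemma char_dq_frob r (x : char_mod r) :
  char_dq (char_frob x) = (p%:R *: char_frob (char_dq x))%LM.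
Proof. by apply: gm_charP => S u /=; rewrite ps_dq_frob // rmorph_nat. Qed.

Lemma rfrobD a b : rfrob (a + b) = rfrob a + rfrob b.
Proof. exact: (frobD (rdp_pder D)). Qed.

Lemma rfrobM a b : rfrob (a * b) = rfrob a * rfrob b.
Proof. exact: (frobM (rdp_pder D)). Qed.

Lemma rfrob1 : rfrob 1 = 1.
Proof.
by have [dp1 _ _] := rdp_pder D; rewrite /rfrob /frob dp1 mulr0 addr0 expr1n.
Qed.

Lemma rdqD a b : rdq D (a + b) = rdq D a + rdq D b.
Proof. by have [[-> _] _] := rdq_dpder D. Qed.

Lemma rdqM a b : rdq D (a * b) = a * rdq D b + b * rdq D a.
Proof. by have [[_ ->] _] := rdq_dpder D. Qed.

Lemma rdq1 : rdq D 1 = 0.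
Proof.
have := rdqM 1 1; rewrite !mulr1 !mul1r.
by move=> /(congr1 (fun z => z - rdq D 1)); rewrite subrr addrK.
Qed.

Lemma rdq_rfrob a : rdq D (rfrob a) = p%:R * rfrob (rdq D a).
Proof. exact: (ps_dq_frob (S := const_seq D) (n := 0%N) a). Qed.

Definition colim_frob_gen a (g : {r & char_mod r}) : char_colim :=
  (rfrob a *: to_colim (char_frob (tagged g)))%LM.
Definition colim_frob : char_colim -> char_colim := pres_lift colim_frob_gen.

Definition colim_dq_gen a (g : {r & char_mod r}) : char_colim :=
  (a *: to_colim (char_dq (tagged g)) + rdq D a *: to_colim (tagged g))%LM.
Definition colim_dq : char_colim -> char_colim := pres_lift colim_dq_gen.

Lemma colim_frob_genD a b g : colim_frob_gen (a + b) g =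
  (colim_frob_gen a g + colim_frob_gen b g)%LM.
Proof. by rewrite /colim_frob_gen rfrobD lm_scaleDl. Qed.

Lemma colim_frob_genR a s t : colim_rel s t ->
  flift colim_frob_gen (fscale a s) = flift colim_frob_gen (fscale a t).
Proof.
case=> [r x y|r b x|r x];
  rewrite !(fscale_cons, fscale_nil, flift_cons, flift_nil) !lm_addr0 !mulr1;
  rewrite /colim_frob_gen !tagged_existT.
- by rewrite char_frobD to_colimD lm_scaleDr.
- by rewrite char_frobZ to_colimZ lm_scaleA rfrobM.
- by rewrite -char_emb_frob to_colim_emb.
Qed.

Lemma colim_dq_genD a b g : colim_dq_gen (a + b) g =
  (colim_dq_gen a g + colim_dq_gen b g)%LM.
Proof.
rewrite /colim_dq_gen rdqD !lm_scaleDl -!lm_addA; congr (_ + _)%LM.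
by rewrite !lm_addA; congr (_ + _)%LM; rewrite lm_addC.
Qed.

Lemma colim_dq_genR a s t : colim_rel s t ->
  flift colim_dq_gen (fscale a s) = flift colim_dq_gen (fscale a t).
Proof.
case=> [r x y|r b x|r x];
  rewrite !(fscale_cons, fscale_nil, flift_cons, flift_nil) !lm_addr0 !mulr1;
  rewrite /colim_dq_gen !tagged_existT.
- rewrite char_dqD !to_colimD !lm_scaleDr -!lm_addA; congr (_ + _)%LM.
  by rewrite !lm_addA; congr (_ + _)%LM; rewrite lm_addC.
- rewrite char_dqZ to_colimD !to_colimZ !lm_scaleDr !lm_scaleA to_colim_emb.
  by rewrite rdqM lm_scaleDl -!lm_addA [b * _]mulrC.
- by rewrite -char_emb_dq !to_colim_emb.
Qed.

Lemma colim_frob_E a r (x : char_mod r) :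
  colim_frob (a *: to_colim x)%LM = (rfrob a *: to_colim (char_frob x))%LM.
Proof. exact: pres_lift_gen colim_frob_genD colim_frob_genR _ _. Qed.

Lemma colim_frobD x y :
  colim_frob (x + y)%LM = (colim_frob x + colim_frob y)%LM.
Proof. exact: pres_liftD colim_frob_genD colim_frob_genR _ _. Qed.

Lemma colim_dq_E a r (x : char_mod r) : colim_dq (a *: to_colim x)%LM =
  (a *: to_colim (char_dq x) + rdq D a *: to_colim x)%LM.
Proof. exact: pres_lift_gen colim_dq_genD colim_dq_genR _ _. Qed.

Lemma colim_dqD x y : colim_dq (x + y)%LM = (colim_dq x + colim_dq y)%LM.
Proof. exact: pres_liftD colim_dq_genD colim_dq_genR _ _. Qed.

Lemma colim_frobZ a x : colim_frob (a *: x)%LM = (rfrob a *: colim_frob x)%LM.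
Proof.
apply: (pres_add_ext (Rel := colim_rel) (u := fun x => colim_frob (a *: x)%LM)
  (v := fun x => (rfrob a *: colim_frob x)%LM)) => [u v|u v|c [r u]].
- by rewrite lm_scaleDr colim_frobD.
- by rewrite colim_frobD lm_scaleDr.
- by rewrite -/(to_colim u) lm_scaleA !colim_frob_E lm_scaleA rfrobM.
Qed.

Lemma colim_dqZ a x :
  colim_dq (a *: x)%LM = (a *: colim_dq x + rdq D a *: x)%LM.
Proof.
have ACA (b c d e : char_colim) : (b + c + (d + e) = b + d + (c + e))%LM.
  rewrite -!lm_addA; congr (_ + _)%LM.
  by rewrite !lm_addA; congr (_ + _)%LM; rewrite lm_addC.
apply: (pres_add_ext (Rel := colim_rel) (u := fun x => colim_dq (a *: x)%LM)
  (v := fun x => (a *: colim_dq x + rdq D a *: x)%LM)) => [u v|u v|c [r u]].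
- by rewrite lm_scaleDr colim_dqD.
- by rewrite colim_dqD !lm_scaleDr ACA.
- rewrite -/(to_colim u) lm_scaleA !colim_dq_E lm_scaleDr !lm_scaleA rdqM.
  by rewrite lm_scaleDl lm_addA [c * _]mulrC.
Qed.

Lemma colim_dq_frob x :
  colim_dq (colim_frob x) = (p%:R *: colim_frob (colim_dq x))%LM.
Proof.
apply: (pres_add_ext (Rel := colim_rel) (u := fun x => colim_dq (colim_frob x))
  (v := fun x => (p%:R *: colim_frob (colim_dq x))%LM)) => [u v|u v|c [r u]].
- by rewrite colim_frobD colim_dqD.
- by rewrite colim_dqD colim_frobD lm_scaleDr.
- rewrite -/(to_colim u) colim_frob_E !colim_dq_E colim_frobD !colim_frob_E.
  by rewrite char_dq_frob to_colimZ rdq_rfrob lm_scaleDr !lm_scaleA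
    [_ * p%:R]mulrC.
Qed.

End Characters.

(* B[phi, delta], as noncommutative expressions modulo the congruence generated
   by the ring axioms, the ring structure of B and the commutation relations. *)
Section SkewRing.

Variables (B : comPzRingType) (p : nat) (phi del : B -> B).

Inductive sk_term : Type :=
| SkC of B | SkPhi | SkDel
| SkAdd of sk_term & sk_term | SkOpp of sk_term | SkMul of sk_term & sk_term.

HB.instance Definition _ := gen_eqMixin sk_term.
HB.instance Definition _ := gen_choiceMixin sk_term.

Inductive sk_eq : sk_term -> sk_term -> Prop :=
| SkRefl s : sk_eq s s
| SkSym s t : sk_eq s t -> sk_eq t s
| SkTrans s t u : sk_eq s t -> sk_eq t u -> sk_eq s u
| SkAddCong s s' t t' : sk_eq s s' -> sk_eq t t' ->
    sk_eq (SkAdd s t) (SkAdd s' t')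
| SkOppCong s s' : sk_eq s s' -> sk_eq (SkOpp s) (SkOpp s')
| SkMulCong s s' t t' : sk_eq s s' -> sk_eq t t' ->
    sk_eq (SkMul s t) (SkMul s' t')
| SkAddA s t u : sk_eq (SkAdd s (SkAdd t u)) (SkAdd (SkAdd s t) u)
| SkAddC s t : sk_eq (SkAdd s t) (SkAdd t s)
| SkAdd0 s : sk_eq (SkAdd (SkC 0) s) s
| SkAddN s : sk_eq (SkAdd (SkOpp s) s) (SkC 0)
| SkMulA s t u : sk_eq (SkMul s (SkMul t u)) (SkMul (SkMul s t) u)
| SkMul1l s : sk_eq (SkMul (SkC 1) s) s
| SkMul1r s : sk_eq (SkMul s (SkC 1)) s
| SkMulDl s t u : sk_eq (SkMul (SkAdd s t) u) (SkAdd (SkMul s u) (SkMul t u))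
| SkMulDr s t u : sk_eq (SkMul u (SkAdd s t)) (SkAdd (SkMul u s) (SkMul u t))
| SkCD a b : sk_eq (SkC (a + b)) (SkAdd (SkC a) (SkC b))
| SkCM a b : sk_eq (SkC (a * b)) (SkMul (SkC a) (SkC b))
| SkDelPhi : sk_eq (SkMul SkDel SkPhi) (SkMul (SkC p%:R) (SkMul SkPhi SkDel))
| SkDelC b : sk_eq (SkAdd (SkMul SkDel (SkC b)) (SkOpp (SkMul (SkC b) SkDel)))
    (SkC (del b))
| SkPhiC b : sk_eq (SkMul SkPhi (SkC b)) (SkMul (SkC (phi b)) SkPhi).

Lemma sk_equiv : equiv_class_of (fun s t : sk_term => `[< sk_eq s t >]).
Proof.
split=> [s|s t|s t u]; first exact/asboolP/SkRefl.
  by apply/asboolP/asboolP; apply: SkSym.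
by move=> /asboolP st /asboolP tu; apply/asboolP/(SkTrans st tu).
Qed.

Canonical sk_equiv_rel := EquivRelPack sk_equiv.

Definition skew_ring := {eq_quot sk_equiv_rel}.
HB.instance Definition _ := Choice.on skew_ring.

Definition sk_class (s : sk_term) : skew_ring := \pi_{eq_quot sk_equiv_rel} s.

Lemma sk_classP s t : sk_class s = sk_class t <-> sk_eq s t.
Proof. by split=> [/eqquotP/asboolP|st] //; apply/eqquotP/asboolP. Qed.

Lemma sk_ind (P : skew_ring -> Prop) :
  (forall s, P (sk_class s)) -> forall x, P x.
Proof. by move=> Ps; elim/quotW. Qed.

Lemma sk_repr s : sk_eq (repr (sk_class s)) s.
Proof. by apply/sk_classP; rewrite /sk_class reprK. Qed.

Definition sk_add (x y : skew_ring) := sk_class (SkAdd (repr x) (repr y)).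
Definition sk_opp (x : skew_ring) := sk_class (SkOpp (repr x)).
Definition sk_mul (x y : skew_ring) := sk_class (SkMul (repr x) (repr y)).

Lemma sk_addE s t : sk_add (sk_class s) (sk_class t) = sk_class (SkAdd s t).
Proof. by apply/sk_classP/SkAddCong; apply: sk_repr. Qed.

Lemma sk_oppE s : sk_opp (sk_class s) = sk_class (SkOpp s).
Proof. exact/sk_classP/SkOppCong/sk_repr. Qed.

Lemma sk_mulE s t : sk_mul (sk_class s) (sk_class t) = sk_class (SkMul s t).
Proof. by apply/sk_classP/SkMulCong; apply: sk_repr. Qed.

Let skE := (sk_addE, sk_oppE, sk_mulE).

Lemma sk_addA : associative sk_add.
Proof.
elim/sk_ind=> s; elim/sk_ind=> t; elim/sk_ind=> u.
by rewrite !skE; apply/sk_classP/SkAddA.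
Qed.

Lemma sk_addC : commutative sk_add.
Proof.
by elim/sk_ind=> s; elim/sk_ind=> t; rewrite !skE; apply/sk_classP/SkAddC.
Qed.

Lemma sk_add0 : left_id (sk_class (SkC 0)) sk_add.
Proof. by elim/sk_ind=> s; rewrite !skE; apply/sk_classP/SkAdd0. Qed.

Lemma sk_addN : left_inverse (sk_class (SkC 0)) sk_opp sk_add.
Proof. by elim/sk_ind=> s; rewrite !skE; apply/sk_classP/SkAddN. Qed.

HB.instance Definition _ :=
  GRing.isZmodule.Build skew_ring sk_addA sk_addC sk_add0 sk_addN.

Lemma sk_mulA : associative sk_mul.
Proof.
elim/sk_ind=> s; elim/sk_ind=> t; elim/sk_ind=> u.
by rewrite !skE; apply/sk_classP/SkMulA.
Qed.

Lemma sk_mul1 : left_id (sk_class (SkC 1)) sk_mul.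
Proof. by elim/sk_ind=> s; rewrite !skE; apply/sk_classP/SkMul1l. Qed.

Lemma sk_mulr1 : right_id (sk_class (SkC 1)) sk_mul.
Proof. by elim/sk_ind=> s; rewrite !skE; apply/sk_classP/SkMul1r. Qed.

Lemma sk_mulDl : left_distributive sk_mul sk_add.
Proof.
elim/sk_ind=> s; elim/sk_ind=> t; elim/sk_ind=> u.
by rewrite !skE; apply/sk_classP/SkMulDl.
Qed.

Lemma sk_mulDr : right_distributive sk_mul sk_add.
Proof.
elim/sk_ind=> s; elim/sk_ind=> t; elim/sk_ind=> u.
by rewrite !skE; apply/sk_classP/SkMulDr.
Qed.

HB.instance Definition _ := GRing.Zmodule_isPzRing.Build skew_ring
  sk_mulA sk_mul1 sk_mulr1 sk_mulDl sk_mulDr.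

Section SkewModule.

Variables (M : lmodule B) (F Q : M -> M).
Hypothesis FD : forall x y, F (x + y)%LM = (F x + F y)%LM.
Hypothesis FZ : forall b x, F (b *: x)%LM = (phi b *: F x)%LM.
Hypothesis QD : forall x y, Q (x + y)%LM = (Q x + Q y)%LM.
Hypothesis QZ : forall b x, Q (b *: x)%LM = (b *: Q x + del b *: x)%LM.
Hypothesis QF : forall x, Q (F x) = (p%:R *: F (Q x))%LM.

Fixpoint sk_eval (t : sk_term) (x : M) : M :=
  match t with
  | SkC b => (b *: x)%LM
  | SkPhi => F x
  | SkDel => Q x
  | SkAdd s t => (sk_eval s x + sk_eval t x)%LM
  | SkOpp s => lm_opp (sk_eval s x)
  | SkMul s t => sk_eval s (sk_eval t x)
  end.

Lemma sk_evalD t x y : sk_eval t (x + y)%LM = (sk_eval t x + sk_eval t y)%LM.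
Proof.
have ACA (a b c d : M) : (a + b + (c + d) = a + c + (b + d))%LM.
  rewrite -!lm_addA; congr (_ + _)%LM.
  by rewrite !lm_addA; congr (_ + _)%LM; rewrite lm_addC.
have subxx (a : M) : (a + lm_opp a)%LM = lm_zero by rewrite lm_addC lm_addN.
elim: t x y => [b|||s IHs t IHt|s IHs|s IHs t IHt] x y //=.
- exact: lm_scaleDr.
- by rewrite IHs IHt ACA.
- apply: (@lm_addI _ _ (sk_eval s x + sk_eval s y)%LM).
  by rewrite IHs ACA !subxx lm_add0.
- by rewrite IHt IHs.
Qed.

Lemma sk_eval_eq s t : sk_eq s t -> sk_eval s =1 sk_eval t.
Proof.
elim=> {s t} /=.
- by [].
- by move=> s t _ st x; rewrite st.
- by move=> s t u _ st _ tu x; rewrite st.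
- by move=> s s' t t' _ ss' _ tt' x; rewrite ss' tt'.
- by move=> s s' _ ss' x; rewrite ss'.
- by move=> s s' t t' _ ss' _ tt' x; rewrite ss' tt'.
- by move=> s t u x; rewrite lm_addA.
- by move=> s t x; rewrite lm_addC.
- by move=> s x; rewrite lm_scale0 lm_add0.
- by move=> s x; rewrite lm_scale0 lm_addN.
- by [].
- by move=> s x; rewrite lm_scale1.
- by move=> s x; rewrite lm_scale1.
- by [].
- by move=> s t u x; rewrite sk_evalD.
- by move=> a b x; rewrite lm_scaleDl.
- by move=> a b x; rewrite lm_scaleA.
- exact: QF.
- move=> b x; rewrite QZ -lm_addA [(del b *: x + _)%LM]lm_addC lm_addA.
  by rewrite [X in (X + _)%LM]lm_addC lm_addN lm_add0.
- exact: FZ.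
Qed.

Definition sk_act (P : skew_ring) (x : M) : M := sk_eval (repr P) x.

Lemma sk_actE s x : sk_act (sk_class s) x = sk_eval s x.
Proof. exact/sk_eval_eq/sk_repr. Qed.

Lemma sk_actA P P' x : sk_act P (sk_act P' x) = sk_act (P * P') x.
Proof.
elim/sk_ind: P => s; elim/sk_ind: P' => t.
by rewrite -[_ * _]/(sk_mul _ _) sk_mulE !sk_actE.
Qed.

Lemma sk_act1 : left_id 1 sk_act.
Proof.
by move=> x; rewrite -[1]/(sk_class (SkC 1)) sk_actE /= lm_scale1.
Qed.

Lemma sk_actDr : right_distributive sk_act lm_add.
Proof. by move=> P x y; apply: sk_evalD. Qed.

Lemma sk_actDl x : {morph sk_act^~ x : P P' / P + P' >-> lm_add P P'}.
Proof.
move=> P P'; elim/sk_ind: P => s; elim/sk_ind: P' => t.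
by rewrite -[_ + _]/(sk_add _ _) sk_addE !sk_actE.
Qed.

Definition skew_mod : lmodule skew_ring :=
  LModule (@lm_addA _ M) (@lm_addC _ M) (@lm_add0 _ M) (@lm_addN _ M)
    sk_actA sk_act1 sk_actDr sk_actDl.

End SkewModule.

End SkewRing.

(* The base change of an A-module M along f, the element b (x) m being
   [b *: tens f m]. *)
Section BaseChange.

Variables (A B : comPzRingType) (f : {rmorphism A -> B}) (M : lmodule A).

Inductive tens_rel : fcomb B M -> fcomb B M -> Prop :=
| TensAdd (x y : M) : tens_rel [:: (1, (x + y)%LM)] [:: (1, x); (1, y)]
| TensScale a (x : M) : tens_rel [:: (1, (a *: x)%LM)] [:: (f a, x)].

Definition base_change : lmodule B := pres_mod tens_rel.

Definition tens (x : M) : base_change := pres_gen tens_rel x.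

Lemma tensD x y : tens (x + y)%LM = (tens x + tens y)%LM.
Proof.
rewrite /tens {1}/pres_gen (pres_rel (TensAdd x y)).
by rewrite !pres_cons !lm_scale1 lm_addr0.
Qed.

Lemma tensZ a x : tens (a *: x)%LM = (f a *: tens x)%LM.
Proof.
rewrite /tens {1}/pres_gen (pres_rel (TensScale a x)).
by rewrite pres_cons lm_addr0.
Qed.

Variables (p : nat) (phi del : A -> A) (phiB : {rmorphism B -> B}).
Variables (delB : B -> B) (delBP : is_der idfun delB).
Hypothesis phiB_ext : forall a, phiB (f a) = f (phi a).
Hypothesis delB_ext : forall a, delB (f a) = f (del a).
Hypothesis phi_del : forall b, delB (phiB b) = p%:R * phiB (delB b).

Variables (F Q : M -> M).
Hypothesis FD : forall x y, F (x + y)%LM = (F x + F y)%LM.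
Hypothesis FZ : forall a x, F (a *: x)%LM = (phi a *: F x)%LM.
Hypothesis QD : forall x y, Q (x + y)%LM = (Q x + Q y)%LM.
Hypothesis QZ : forall a x, Q (a *: x)%LM = (a *: Q x + del a *: x)%LM.
Hypothesis QF : forall x, Q (F x) = (p%:R *: F (Q x))%LM.

(* phi (b (x) m) = phi b (x) phi m,
   delta (b (x) m) = b (x) delta m + delta b (x) m. *)
Definition tens_F_gen b (x : M) : base_change := (phiB b *: tens (F x))%LM.
Definition tens_Q_gen b (x : M) : base_change :=
  (b *: tens (Q x) + delB b *: tens x)%LM.

Definition tens_F : base_change -> base_change := pres_lift tens_F_gen.
Definition tens_Q : base_change -> base_change := pres_lift tens_Q_gen.

Let delBD a b : delB (a + b) = delB a + delB b. Proof. by case: delBP. Qed.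
Let delBM a b : delB (a * b) = a * delB b + b * delB a.
Proof. by case: delBP. Qed.

Let ACA (N : lmodule B) (a b c d : N) :
  (a + b + (c + d) = a + c + (b + d))%LM.
Proof.
rewrite -!lm_addA; congr (_ + _)%LM.
by rewrite !lm_addA; congr (_ + _)%LM; rewrite lm_addC.
Qed.

Let F_genD a b x :
  tens_F_gen (a + b) x = (tens_F_gen a x + tens_F_gen b x)%LM.
Proof. by rewrite /tens_F_gen rmorphD lm_scaleDl. Qed.

Let Q_genD a b x :
  tens_Q_gen (a + b) x = (tens_Q_gen a x + tens_Q_gen b x)%LM.
Proof. by rewrite /tens_Q_gen delBD !lm_scaleDl ACA. Qed.

Let F_genR b s t : tens_rel s t ->
  flift tens_F_gen (fscale b s) = flift tens_F_gen (fscale b t).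
Proof.
case=> [x y|a x];
  rewrite !(fscale_cons, fscale_nil, flift_cons, flift_nil) !lm_addr0 !mulr1;
  rewrite /tens_F_gen.
- by rewrite FD tensD lm_scaleDr.
- by rewrite FZ tensZ lm_scaleA rmorphM phiB_ext.
Qed.

Let Q_genR b s t : tens_rel s t ->
  flift tens_Q_gen (fscale b s) = flift tens_Q_gen (fscale b t).
Proof.
case=> [x y|a x];
  rewrite !(fscale_cons, fscale_nil, flift_cons, flift_nil) !lm_addr0 !mulr1;
  rewrite /tens_Q_gen.
- by rewrite QD !tensD !lm_scaleDr ACA.
- rewrite QZ tensD !tensZ !lm_scaleDr !lm_scaleA delBM lm_scaleDl -!lm_addA.
  by rewrite delB_ext [f a * _]mulrC.
Qed.

Lemma tens_F_E b x : tens_F (b *: tens x)%LM = (phiB b *: tens (F x))%LM.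
Proof. exact: pres_lift_gen F_genD F_genR _ _. Qed.

Lemma tens_FD x y : tens_F (x + y)%LM = (tens_F x + tens_F y)%LM.
Proof. exact: pres_liftD F_genD F_genR _ _. Qed.

Lemma tens_Q_E b x :
  tens_Q (b *: tens x)%LM = (b *: tens (Q x) + delB b *: tens x)%LM.
Proof. exact: pres_lift_gen Q_genD Q_genR _ _. Qed.

Lemma tens_QD x y : tens_Q (x + y)%LM = (tens_Q x + tens_Q y)%LM.
Proof. exact: pres_liftD Q_genD Q_genR _ _. Qed.

Lemma tens_FZ b x : tens_F (b *: x)%LM = (phiB b *: tens_F x)%LM.
Proof.
apply: (pres_add_ext (Rel := tens_rel) (u := fun x => tens_F (b *: x)%LM)
  (v := fun x => (phiB b *: tens_F x)%LM)) => [u v|u v|c u].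
- by rewrite lm_scaleDr tens_FD.
- by rewrite tens_FD lm_scaleDr.
- by rewrite lm_scaleA !tens_F_E lm_scaleA rmorphM.
Qed.

Lemma tens_QZ b x : tens_Q (b *: x)%LM = (b *: tens_Q x + delB b *: x)%LM.
Proof.
apply: (pres_add_ext (Rel := tens_rel) (u := fun x => tens_Q (b *: x)%LM)
  (v := fun x => (b *: tens_Q x + delB b *: x)%LM)) => [u v|u v|c u].
- by rewrite lm_scaleDr tens_QD.
- by rewrite tens_QD !lm_scaleDr ACA.
- rewrite lm_scaleA !tens_Q_E lm_scaleDr !lm_scaleA delBM lm_scaleDl lm_addA.
  by rewrite [c * _]mulrC.
Qed.

Lemma tens_QF x : tens_Q (tens_F x) = (p%:R *: tens_F (tens_Q x))%LM.
Proof.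
apply: (pres_add_ext (Rel := tens_rel) (u := fun x => tens_Q (tens_F x))
  (v := fun x => (p%:R *: tens_F (tens_Q x))%LM)) => [u v|u v|c u].
- by rewrite tens_FD tens_QD.
- by rewrite tens_QD tens_FD lm_scaleDr.
- rewrite tens_F_E !tens_Q_E tens_FD !tens_F_E QF tensZ phi_del rmorph_nat.
  by rewrite lm_scaleDr !lm_scaleA [_ * p%:R]mulrC.
Qed.

Definition base_change_skew : lmodule (skew_ring p phiB delB) :=
  skew_mod tens_FD tens_FZ tens_QD tens_QZ tens_QF.

End BaseChange.

Section Fractions.

Variables (p : nat) (A : idomainType) (D : dpq_ring p A).
Local Notation L := {fraction A}.
Local Notation "x %:F" := (@FracField.tofrac _ x).

(* The extensions of phi_p and delta_q to the fraction field; there is at most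
   one such pair. *)
Record frac_ext := FracExt {
  fe_frob : {rmorphism L -> L};
  fe_dq : L -> L;
  fe_frobE : forall a : A, fe_frob a%:F = (rfrob D a)%:F;
  fe_dq_der : is_der idfun fe_dq;
  fe_dqE : forall a : A, fe_dq a%:F = (rdq D a)%:F
}.

Variable E : frac_ext.

Lemma fe_dq_frob x : fe_dq E (fe_frob E x) = p%:R * fe_frob E (fe_dq E x).
Proof.
have [a [b b0 ->]] : exists a : A, exists2 b : A, b != 0 & x = a%:F / b%:F.
  elim/quotW: x => r; exists \n_r; exists \d_r; first exact: denom_ratioP.
  apply: (canRL (mulfK _)); first by rewrite tofrac_eq0 denom_ratioP.
  rewrite -[LHS]/(FracField.mul _ _) !piE; apply/eqmodP => /=.
  rewrite FracField.equivfE !numden_Ratio ?oner_eq0 ?mulr1 ?denom_ratioP //.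
  by rewrite mulrC.
have [dqD dqM] := fe_dq_der E.
set q := fe_dq E; set f := fe_frob E.
have qf (c : A) : q (f c%:F) = p%:R * f (q c%:F).
  by rewrite /q /f fe_frobE !fe_dqE fe_frobE rdq_rfrob tofracM rmorph_nat.
have fb0 : f b%:F != 0 by rewrite fmorph_eq0 tofrac_eq0.
set y := _ / _; have yb : y * b%:F = a%:F by rewrite divfK ?tofrac_eq0.
have := qf a; rewrite -yb rmorphM /q !dqM /= -/q qf rmorphD !rmorphM mulrDr.
rewrite mulrCA => /addrI; rewrite mulrCA => /(mulfI fb0) //.
Qed.

End Fractions.

Section MultiplicativeGroup.

Variables (p : nat) (A : idomainType) (D : dpq_ring p A) (pr_p : prime p).

(* (-1)^(n-1) p^(n-1) / n for 0 < n.  Writing n = p^v m with m prime to p, this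
   is (-1)^(n-1) p^(n-1-v) / m, where v <= n-1 and m is invertible in any
   p-adically complete ring. *)
Definition log_coef (S : comPzRingType) (n : nat) : S :=
  (-1) ^+ n.-1 * ((p ^ (n.-1 - logn p n))%:R * rinv (n`_p^')%:R).

Definition psi_p_partial (S : cseq D) (u : units (S 0)) (n : nat) : S 1 :=
  \sum_(1 <= k < n.+1) log_coef (S 1) k *
    (ps_dp S 0 (val u) * rinv (ps_emb S 0 (val u) ^+ p)) ^+ k.

Definition is_psi_p (x : char_mod D 1) : Prop :=
  forall (S : cseq D) (u : units (S 0)), padic_cvg p (psi_p_partial u) (x S u).

Definition is_psi_q (x : char_mod D 1) : Prop :=
  forall (S : cseq D) (u : units (S 0)),
    x S u = ps_dq S 0 (val u) * rinv (ps_emb S 0 (val u)).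

Definition charL (r : nat) : lmodule {fraction A} :=
  base_change (@FracField.tofrac A) (char_mod D r).

Definition colimL : lmodule {fraction A} :=
  base_change (@FracField.tofrac A) (char_colim D).

Lemma ord_add1 r (i : 'I_r) : (i + 1 <= r)%N.
Proof. by rewrite addn1. Qed.

(* The pairs (i, j) with i + j <= r - 1, for 0 < r. *)
Definition pq_index (r : nat) : finType :=
  {ij : 'I_r * 'I_r | (ij.1 + ij.2 < r)%N}.

Lemma pq_index_add1 r (ij : pq_index r) :
  ((val ij).1 + ((val ij).2 + 1) <= r)%N.
Proof. by case: ij => ij /=; rewrite addnA addn1. Qed.

Definition char_family (psi_p psi_q : char_mod D 1) (r : nat)
    (k : 'I_r + pq_index r) : charL r :=
  match k with
  | inl i => tens _ (char_incl (ord_add1 i) (iter_frob pr_p i psi_p))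
  | inr ij => tens _ (char_incl (pq_index_add1 ij)
      (iter_frob pr_p (val ij).1 (iter_dq (val ij).2 psi_q)))
  end.

(* [colimL] as a module over L[phi_p, delta_q]. *)
Definition colimL_skew (E : frac_ext D) :
    lmodule (skew_ring p (fe_frob E) (fe_dq E)) :=
  base_change_skew (fe_dq_der E) (fe_frobE E) (fe_dqE E) (fe_dq_frob E)
    (colim_frobD pr_p) (colim_frobZ pr_p) (@colim_dqD p A D)
    (@colim_dqZ p A D) (colim_dq_frob pr_p).

Definition colimL_gen (E : frac_ext D) (x : char_mod D 1) : colimL_skew E :=
  (tens _ (to_colim x) : colimL).

End MultiplicativeGroup.

(* Main.v *)
(* A character is tested against the square-zero prolongation sequence with fibre generated by
   eps_ij = (phi / p)^i dq^j eps (i + j <= n) over A: mu_ij(psi) is the eps_ij-coordinate of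
   psi (1 + eps_00).  These functionals take the values
     mu (phi^i psi_p) = p^i (eps_(i+1, 0) - eps_(i, 0)),
     mu (phi^i dq^j psi_q) = p^i eps_(i, j+1),
   whence linear independence, and for psi of order r an A-combination of the family agrees with
   p^r psi in all coordinates other than (0, 0).  So it is enough that a character psi with
   mu_ij(psi) = 0 for (i, j) <> (0, 0) vanishes.
     Let y = 1 + x be the universal unit, and deform it to 1 + t x with phi t = t^p, dq t = 0; then
   dp^i dq^j x becomes t^(p^i) dp^i dq^j x, and f = psi y is a power series in t.  The derivation
   t d/dt defines a morphism to dual numbers, so t f' = mu_00(psi) t x / (1 + t x).  The
   coefficient of t^N shows that N divides mu_00(psi) for all N, so mu_00(psi) = 0, f is constant,
   and f = 0 at t = 0.  The p-adically completed jet spaces of G_m are realized inside rings of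
   power series, and a point u of S is reached through the graph of the specialization of y to u.
     The operators extend to the fraction field because phi is injective on the Noetherian
   domain A. *)

From HB Require Import structures.
Require Import Defs.
From mathcomp Require Import all_boot all_order all_algebra.
From mathcomp Require Import boolp classical_sets.
From mathcomp Require Import fingroup perm finmap.
From mathcomp.multinomials Require Import monalg.
From mathcomp Require Import ring zify.

Set Implicit Arguments.
Unset Strict Implicit.
Unset Printing Implicit Defensive.

Import GRing.Theory.
Local Open Scope ring_scope.

(** * p-adic topology *)

(** The rings of a prolongation sequence may have p-torsion or be zero, so there dp is not
    determined by phi; only the auxiliary rings built over A are free of p-torsion. On a square-zero
    fibre p-th powers vanish, so a lift of Frobenius is divisible by p there, while phi / p stays a
    free additive choice. This is the origin of the factors p^i and p^r, which are invertible only
    over L. The main obstacle is completeness. Power series in t over the jet polynomials are not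
    p-adically complete, since a limit may involve infinitely many monomials. The parameter t
    repairs this: dp^i dq^j x has weight p^i >= 1, so finitely many monomials can occur in the
    coefficient of t^N, and inverting 1 + t x preserves the bound. The same t supplies the
    derivation t d/dt, whose rule E phi = p phi E is that of dual numbers with phi eps = p eps, and
    the contraction to t = 0. A point u of S does not directly define an evaluation on the completed
    ring. The closure of its graph in the product with S does as well: its projection to power
    series is injective, so a character vanishing at y vanishes at u. *)

Section PMultiples.

Variables (p : nat) (S : comPzRingType).
Implicit Types x y z : S.

Definition pmul (k : nat) x : Prop := exists y, x = p%:R ^+ k * y.

Lemma pmul_mul k x : pmul k (p%:R ^+ k * x).
Proof. by exists x. Qed.

Lemma pmulz k : pmul k (0 : S).
Proof. by exists 0; rewrite mulr0. Qed.

Lemma pmul0 x : pmul 0 x.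
Proof. by exists x; rewrite expr0 mul1r. Qed.

Lemma pmulD k x y : pmul k x -> pmul k y -> pmul k (x + y).
Proof. by move=> [a ->] [b ->]; exists (a + b); rewrite mulrDr. Qed.

Lemma pmulN k x : pmul k x -> pmul k (- x).
Proof. by move=> [a ->]; exists (- a); rewrite mulrN. Qed.

Lemma pmulB k x y : pmul k x -> pmul k y -> pmul k (x - y).
Proof. by move=> kx ky; apply: pmulD => //; apply: pmulN. Qed.

Lemma pmulMl k x y : pmul k y -> pmul k (x * y).
Proof. by move=> [a ->]; exists (x * a); rewrite mulrCA. Qed.

Lemma pmulMr k x y : pmul k x -> pmul k (x * y).
Proof. by rewrite mulrC; apply: pmulMl. Qed.

Lemma pmulM k l x y : pmul k x -> pmul l y -> pmul (k + l) (x * y).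
Proof. by move=> [a ->] [b ->]; exists (a * b); rewrite exprD mulrACA. Qed.

Lemma pmulW k l x : (l <= k)%N -> pmul k x -> pmul l x.
Proof.
by move=> /subnK <- [a ->]; exists (p%:R ^+ (k - l) * a); rewrite addnC exprD mulrA.
Qed.

Lemma pmul_sum k (I : Type) (r : seq I) (P : pred I) (F : I -> S) :
  (forall i, P i -> pmul k (F i)) -> pmul k (\sum_(i <- r | P i) F i).
Proof. by move=> kF; elim/big_rec: _ => [|i x Pi]; [apply: pmulz|apply: pmulD; apply: kF]. Qed.

Lemma pmulX k x n : (0 < n)%N -> pmul k x -> pmul k (x ^+ n).
Proof. by case: n => // n _ kx; rewrite exprS; apply: pmulMr. Qed.

Lemma pmul_subX k x y n : pmul k (x - y) -> pmul k (x ^+ n - y ^+ n).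
Proof. by move=> xy; rewrite subrXX; apply: pmulMr. Qed.

End PMultiples.

Lemma pmul_rmorph p (S T : comPzRingType) (f : {rmorphism S -> T}) k x :
  pmul p k x -> pmul p k (f x).
Proof. by move=> [y ->]; exists (f y); rewrite rmorphM rmorphXn rmorph_nat. Qed.

Section Complete.

Variables (p : nat) (S : comPzRingType) (Sc : padic_complete p S).
Implicit Types x y z : S.

Lemma padic_sep x : (forall k, pmul p k x) -> x = 0.
Proof. by case: Sc => + _; apply. Qed.

Lemma padic_eq x y : (forall k, pmul p k (x - y)) -> x = y.
Proof. by move=> xy; apply/eqP; rewrite -subr_eq0; apply/eqP/padic_sep. Qed.

Lemma padic_lim (s : nat -> S) : (forall n, pmul p n (s n.+1 - s n)) ->
  exists l, forall n, pmul p n (l - s n).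
Proof. by case: Sc => _; apply. Qed.

Lemma padic_cvg_unique (s : nat -> S) (l l' : S) :
  padic_cvg p s l -> padic_cvg p s l' -> l = l'.
Proof.
move=> sl sl'; apply: padic_eq => k.
have [N HN] := sl k; have [N' HN'] := sl' k.
have -> : l - l' = (s (maxn N N') - l') - (s (maxn N N') - l) by ring.
by apply: pmulB; [apply: HN'; lia|apply: HN; lia].
Qed.

(** The inverse is the p-adic limit of the geometric series. *)
Lemma unit_1p x : exists y, (1 + p%:R * x) * y = 1.
Proof.
pose s n : S := \sum_(i < n) (- (p%:R * x)) ^+ i.
have sP n : (1 + p%:R * x) * s n = 1 - (- (p%:R * x)) ^+ n.
  rewrite /s; elim: n => [|n IHn]; first by rewrite big_ord0 mulr0 expr0 subrr.
  by rewrite big_ord_recr mulrDr IHn exprS; ring.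
have pX n : pmul p n ((- (p%:R * x)) ^+ n).
  by exists ((- x) ^+ n); rewrite -mulrN exprMn.
have [n|l Hl] := @padic_lim s; first by rewrite /s big_ord_recr /= [X in X - _]addrC addrK.
exists l; apply: padic_eq => n.
have -> : (1 + p%:R * x) * l - 1 = (1 + p%:R * x) * (l - s n) - (- (p%:R * x)) ^+ n.
  by rewrite mulrBr sP; ring.
by apply: pmulB; [apply: pmulMl|].
Qed.

Lemma unit_pmul x y u : x * u = 1 -> pmul p 1 (y - x) -> exists v, y * v = 1.
Proof.
move=> xu [z yx]; have [v Hv] := unit_1p (u * z).
exists (u * v); rewrite -Hv -[y](subrK x) yx expr1.
have -> : (p%:R * z + x) * (u * v) = (p%:R * (u * z) + x * u) * v by ring.
by rewrite xu addrC.
Qed.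

Lemma unit_coprime m : (0 < m)%N -> coprime m p -> exists v : S, m%:R * v = 1.
Proof.
move=> m0 mp; case: (egcdnP p m0) => a b e _.
have [y Hy] := unit_1p b%:R.
exists (a%:R * y); rewrite mulrA -[RHS]Hy; congr (_ * _).
rewrite -[LHS]natrM mulnC e (eqP mp). by rewrite natrD addrC natrM [_%:R * _]mulrC.
Qed.

End Complete.

(** * Derivations, p-derivations and subrings *)

Lemma rmorph_Cp p (S T : comPzRingType) (f : {rmorphism S -> T}) x y :
  f (Cp p x y) = Cp p (f x) (f y).
Proof.
rewrite /Cp rmorphN rmorph_sum; congr (- _); apply: eq_bigr => i _.
by rewrite !rmorphM !rmorphXn rmorph_nat.
Qed.

Section DerivationTheory.

Variables (S S' : comPzRingType) (f : {rmorphism S -> S'}).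

Lemma is_der_add0 (d : S -> S') : (forall x y, d (x + y) = d x + d y) -> d 0 = 0.
Proof. by move=> dD; apply: (addrI (d 0)); rewrite -dD !addr0. Qed.

Variables (d : S -> S') (dP : is_der f d).

Lemma der0 : d 0 = 0.
Proof. by apply: is_der_add0; case: dP. Qed.

Lemma derN x : d (- x) = - d x.
Proof. by apply: (addrI (d x)); have [<- _] := dP; rewrite !subrr der0. Qed.

Lemma derB x y : d (x - y) = d x - d y.
Proof. by have [-> _] := dP; rewrite derN. Qed.

Lemma der1 : d 1 = 0.
Proof.
have [_ /(_ 1 1)] := dP; rewrite rmorph1 !mul1r => e.
by apply: (addrI (d 1)); rewrite -e addr0.
Qed.

Lemma der_nat n : d n%:R = 0.
Proof. by elim: n => [|n IHn]; rewrite ?der0 // -natr1 (proj1 dP) IHn der1 addr0. Qed.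

Lemma derX x n : d (x ^+ n) = n%:R * (f x ^+ n.-1 * d x).
Proof.
elim: n => [|[|n] IHn]; rewrite ?expr0 ?der1 ?mul0r ?expr1 ?mul1r //.
by rewrite exprS (proj2 dP) IHn rmorphXn /= -[n.+2]addn1 natrD !exprS; ring.
Qed.

Lemma der_pmul p k x : pmul p k x -> pmul p k (d x).
Proof.
move=> [y ->]; rewrite (proj2 dP) rmorphXn rmorph_nat -!natrX der_nat natrX.
by exists (d y); rewrite mulr0 addr0.
Qed.

End DerivationTheory.

Section PDerivationTheory.

Variables (p : nat) (pr_p : prime p).
Variables (S S' : comPzRingType) (f : {rmorphism S -> S'}).
Variables (dp : S -> S') (dpP : is_pder p f dp).

Let p_gt0 : (0 < p)%N := prime_gt0 pr_p.

Lemma Cp_pmul k (x y : S') : pmul p k y -> pmul p k (Cp p x y).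
Proof.
move=> ky; apply: pmulN; rewrite big_seq_cond.
apply: pmul_sum => i; rewrite mem_index_iota => /andP[/andP[i0 _] _].
by do 2!apply: pmulMl; apply: pmulX.
Qed.

Lemma frob1 : frob p f dp 1 = 1.
Proof. by have [dp1 _ _] := dpP; rewrite /frob dp1 rmorph1 expr1n mulr0 addr0. Qed.

Lemma frob_zmod : zmod_morphism (frob p f dp).
Proof.
move=> x y; apply: (addIr (frob p f dp y)).
by rewrite -(frobD dpP pr_p) !subrK.
Qed.

Lemma frob_monoid : monoid_morphism (frob p f dp).
Proof. by split=> [|x y]; [apply: frob1|apply: (frobM dpP)]. Qed.

Definition frob_rmorphism : {rmorphism S -> S'} :=
  HB.pack (frob p f dp) (GRing.isZmodMorphism.Build S S' (frob p f dp) frob_zmod)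
    (GRing.isMonoidMorphism.Build S S' (frob p f dp) frob_monoid).

Lemma pderM_frob x y : dp (x * y) = frob p f dp x * dp y + f y ^+ p * dp x.
Proof. by have [_ _ ->] := dpP; rewrite /frob; ring. Qed.

(** This is the p-adic continuity of dp. One factor p is lost because dp p need not be divisible by
    p; this is why [approx_dp] starts from precision k+1. *)
Lemma pder_pmul k x : pmul p k.+1 x -> pmul p k (dp x).
Proof.
have [_ _ dpM] := dpP; move=> [y ->]; elim: k y => [|k IHk] y; first exact: pmul0.
have p2 := prime_gt1 pr_p.
rewrite exprS -mulrA dpM rmorph_nat -addrA; apply: pmulD.
  apply: (@pmulW _ _ (p + k)); first lia.
  by apply: pmulM; [exists 1; rewrite mulr1|apply: IHk].
apply: pmulD.
  apply: pmulMr; apply: (@pmulW _ _ k.+1) => //; apply: pmulX => //.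
  by apply: pmul_rmorph; exists y.
by rewrite -add1n; apply: pmulM; [exists 1; rewrite expr1 mulr1|apply: pmulMl; apply: IHk].
Qed.

Lemma pder_congr k x y : pmul p k.+1 (x - y) -> pmul p k (dp x - dp y).
Proof.
move=> xy; have [_ dpD _] := dpP; have {1}-> : x = y + (x - y) by ring.
have -> : dp (y + (x - y)) - dp y = dp (x - y) + Cp p (f y) (f (x - y)) by rewrite dpD; ring.
apply: pmulD; first exact: pder_pmul.
by apply: (@pmulW _ _ k.+1) => //; apply/Cp_pmul/pmul_rmorph.
Qed.

(** Keeps phi w among the denominators: if w is y0^a modulo p, then phi w is y0^(a p) modulo p. *)
Lemma pder_frob_congr x y : pmul p 1 (x - y) -> pmul p 1 (frob p f dp x - f y ^+ p).
Proof.
move=> xy; rewrite /frob addrAC; apply: pmulD; last by exists (dp x); rewrite expr1.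
by apply: pmul_subX; rewrite -rmorphB; apply: pmul_rmorph.
Qed.

End PDerivationTheory.

(* The ring structure lives on an alias carrying the predicate, so that unification finds it. *)
Record subring (R : comPzRingType) := Subring {
  sr_in :> R -> Prop;
  sr_in1 : sr_in 1;
  sr_inB : forall x y, sr_in x -> sr_in y -> sr_in (x - y);
  sr_inM : forall x y, sr_in x -> sr_in y -> sr_in (x * y)
}.

Section SubringTheory.

Variables (R : comPzRingType) (V : subring R).

Lemma sr_in0 : V 0.
Proof. by rewrite -(subrr 1); apply: sr_inB; apply: sr_in1. Qed.

Lemma sr_inN x : V x -> V (- x).
Proof. by rewrite -sub0r; apply: sr_inB; apply: sr_in0. Qed.

Lemma sr_inD x y : V x -> V y -> V (x + y).
Proof. by move=> Vx Vy; rewrite -[y]opprK; apply: sr_inB => //; apply: sr_inN. Qed.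

Lemma sr_inX x n : V x -> V (x ^+ n).
Proof.
by move=> Vx; elim: n => [|n IHn]; [apply: sr_in1|rewrite exprS; apply: sr_inM].
Qed.

Lemma sr_in_nat n : V n%:R.
Proof.
elim: n => [|n IHn]; first exact: sr_in0.
by rewrite -natr1; apply: sr_inD => //; apply: sr_in1.
Qed.

Lemma sr_in_sum (I : Type) (r : seq I) (P : pred I) (F : I -> R) :
  (forall i, P i -> V (F i)) -> V (\sum_(i <- r | P i) F i).
Proof.
by move=> VF; elim/big_rec: _ => [|i x Pi]; [apply: sr_in0|apply: sr_inD; apply: VF].
Qed.

Definition sub_car := {x : R | `[< V x >]}.
HB.instance Definition _ := Choice.on sub_car.

Definition sub_mk x (Vx : V x) : sub_car := exist _ x (asboolT Vx).
Lemma sub_valP (x : sub_car) : V (val x). Proof. by case: x => x /= /asboolP. Qed.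

Definition sub_add (x y : sub_car) := sub_mk (sr_inD (sub_valP x) (sub_valP y)).
Definition sub_mul (x y : sub_car) := sub_mk (sr_inM (sub_valP x) (sub_valP y)).
Definition sub_opp (x : sub_car) := sub_mk (sr_inN (sub_valP x)).

Lemma sub_addA : associative sub_add.
Proof. by move=> x y z; apply: val_inj; rewrite /= addrA. Qed.
Lemma sub_addC : commutative sub_add.
Proof. by move=> x y; apply: val_inj; rewrite /= addrC. Qed.
Lemma sub_add0 : left_id (sub_mk sr_in0) sub_add.
Proof. by move=> x; apply: val_inj; rewrite /= add0r. Qed.
Lemma sub_addN : left_inverse (sub_mk sr_in0) sub_opp sub_add.
Proof. by move=> x; apply: val_inj; rewrite /= addNr. Qed.
HB.instance Definition _ :=
  GRing.isZmodule.Build sub_car sub_addA sub_addC sub_add0 sub_addN.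

Lemma sub_mulA : associative sub_mul.
Proof. by move=> x y z; apply: val_inj; rewrite /= mulrA. Qed.
Lemma sub_mulC : commutative sub_mul.
Proof. by move=> x y; apply: val_inj; rewrite /= mulrC. Qed.
Lemma sub_mul1 : left_id (sub_mk (sr_in1 V)) sub_mul.
Proof. by move=> x; apply: val_inj; rewrite /= mul1r. Qed.
Lemma sub_mulDl : left_distributive sub_mul sub_add.
Proof. by move=> x y z; apply: val_inj; rewrite /= mulrDl. Qed.
HB.instance Definition _ :=
  GRing.Zmodule_isComPzRing.Build sub_car sub_mulA sub_mulC sub_mul1 sub_mulDl.

Definition sub_val (x : sub_car) : R := val x.
Lemma sub_val_zmod : zmod_morphism sub_val. Proof. by []. Qed.
Lemma sub_val_monoid : monoid_morphism sub_val. Proof. by []. Qed.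
HB.instance Definition _ := GRing.isZmodMorphism.Build sub_car R sub_val sub_val_zmod.
HB.instance Definition _ := GRing.isMonoidMorphism.Build sub_car R sub_val sub_val_monoid.

Lemma sub_val_inj : injective sub_val. Proof. exact: val_inj. Qed.

Variables (T : comPzRingType) (f : {rmorphism T -> R}) (fV : forall x, V (f x)).

Definition sub_lift (x : T) : sub_car := sub_mk (fV x).
Lemma sub_lift_zmod : zmod_morphism sub_lift.
Proof. by move=> x y; apply: val_inj; rewrite /= rmorphB. Qed.
Lemma sub_lift_monoid : monoid_morphism sub_lift.
Proof. by split=> [|x y]; apply: val_inj; rewrite /= ?rmorph1 ?rmorphM. Qed.
HB.instance Definition _ := GRing.isZmodMorphism.Build T sub_car sub_lift sub_lift_zmod.
HB.instance Definition _ := GRing.isMonoidMorphism.Build T sub_car sub_lift sub_lift_monoid.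

End SubringTheory.

(** * Prolongation sequences cut out inside a given one *)

Record subseq (p : nat) (B : pro_seq p) := Subseq {
  ss_sub :> forall n, subring (B n);
  ss_emb : forall n x, ss_sub n x -> ss_sub n.+1 (ps_emb B n x);
  ss_dp : forall n x, ss_sub n x -> ss_sub n.+1 (ps_dp B n x);
  ss_dq : forall n x, ss_sub n x -> ss_sub n.+1 (ps_dq B n x)
}.

Section SubseqTheory.

Variables (p : nat) (B : pro_seq p) (V : subseq B).

Let R n : comPzRingType := sub_car (V n).
Let emb_val n : {rmorphism R n -> B n.+1} := ps_emb B n \o @sub_val _ (V n).
Definition ss_emb_sub n : {rmorphism R n -> R n.+1} :=
  sub_lift (f := emb_val n) (fun x => ss_emb (sub_valP x)).
Definition ss_dp_sub n (x : R n) : R n.+1 := sub_mk (ss_dp (sub_valP x)).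
Definition ss_dq_sub n (x : R n) : R n.+1 := sub_mk (ss_dq (sub_valP x)).

Lemma ss_pder n : is_pder p (ss_emb_sub n) (@ss_dp_sub n).
Proof.
have [dp1 dpD dpM] := ps_pder B n.
split=> [|x y|x y]; apply: sub_val_inj; first exact: dp1.
  by rewrite !rmorphD /= rmorph_Cp; apply: dpD.
by rewrite !(rmorphD, rmorphM, rmorphXn, rmorph_nat) /=; apply: dpM.
Qed.

Lemma ss_dpder n : is_dpder p (ss_emb_sub n) (ss_emb_sub n.+1)
  (@ss_dp_sub n) (@ss_dp_sub n.+1) (@ss_dq_sub n) (@ss_dq_sub n.+1).
Proof.
have [[dqD dqM] dqdp] := ps_dpder B n.
split=> [|x]; [split=> x y|]; apply: sub_val_inj; first exact: dqD.
  by rewrite !(rmorphD, rmorphM) /=; apply: dqM.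
by rewrite !(rmorphB, rmorphD, rmorphM, rmorphXn, rmorph_nat) /=; apply: dqdp.
Qed.

Definition sub_seq : pro_seq p.
Proof.
refine (@ProSeq p R ss_emb_sub ss_dp_sub ss_dq_sub ss_pder ss_dpder _ _).
  by move=> n x; apply: val_inj; apply: ps_dp_emb.
by move=> n x; apply: val_inj; apply: ps_dq_emb.
Defined.

Definition sub_incl : ps_hom sub_seq B :=
  @PsHom p sub_seq B (fun n => @sub_val _ (V n)) (fun _ _ => erefl)
    (fun _ _ => erefl) (fun _ _ => erefl).

Variables (T : pro_seq p) (f : ps_hom T B) (fV : forall n x, V n (f n x)).

Definition sub_fact : ps_hom T sub_seq.
Proof.
refine (@PsHom p T sub_seq (fun n => sub_lift (@fV n) : {rmorphism T n -> R n}) _ _ _).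
- by move=> n x; apply: val_inj; apply: ps_map_emb.
- by move=> n x; apply: val_inj; apply: ps_map_dp.
- by move=> n x; apply: val_inj; apply: ps_map_dq.
Defined.

End SubseqTheory.

(** * Completions of rings of fractions *)

(* [P] with the subrings [Pn n] plays the role of the ring of polynomials in the dp^i dq^j y0;
   a point of the closure is p-adically a limit of fractions ev h / ev w, where w is a power
   of y0 modulo p, so that the quotient rule for [dp] has a denominator of the same kind. *)
Section FractionClosure.

Variables (p : nat) (pr_p : prime p) (P : comPzRingType) (D : dpq_ring p P).
Variable Pn : nat -> subring P.
Hypothesis Pn_emb : forall n x, Pn n x -> Pn n.+1 x.
Hypothesis Pn_dp : forall n x, Pn n x -> Pn n.+1 (rdp D x).
Hypothesis Pn_dq : forall n x, Pn n x -> Pn n.+1 (rdq D x).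
Variables (y0 : P) (Py0 : forall n, Pn n y0).

Definition denom n w : Prop := Pn n w /\ exists a, pmul p 1 (w - y0 ^+ a).

Lemma denom1 n : denom n 1.
Proof. by split; [apply: sr_in1|exists 0%N; rewrite expr0 subrr; apply: pmulz]. Qed.

Lemma denomM n w w' : denom n w -> denom n w' -> denom n (w * w').
Proof.
move=> [Pw [a wa]] [Pw' [b wb]]; split; first exact: sr_inM.
exists (a + b)%N; have -> : w * w' - y0 ^+ (a + b) = (w - y0 ^+ a) * w' + y0 ^+ a * (w' - y0 ^+ b).
  by rewrite exprD; ring.
by apply: pmulD; [apply: pmulMr|apply: pmulMl].
Qed.

Lemma denomX n w k : denom n w -> denom n (w ^+ k).
Proof.
by move=> dw; elim: k => [|k IHk]; [apply: denom1|rewrite exprS; apply: denomM].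
Qed.

Lemma denom_emb n w : denom n w -> denom n.+1 w.
Proof. by move=> [Pw wa]; split=> //; apply: Pn_emb. Qed.

Lemma Pn_frob n w : Pn n w -> Pn n.+1 (rfrob D w).
Proof.
move=> Pw; rewrite /rfrob /frob; apply: sr_inD; first by apply/sr_inX/Pn_emb.
by apply: sr_inM; [apply: sr_in_nat|apply: Pn_dp].
Qed.

Lemma denom_frob n w : denom n w -> denom n.+1 (rfrob D w).
Proof.
move=> [Pw [a wa]]; split; first exact: Pn_frob.
exists (a * p)%N; rewrite exprM.
exact: (pder_frob_congr idfun (rdp D) wa).
Qed.

Variables (B : pro_seq p) (ev : forall n, {rmorphism P -> B n}).
Hypothesis ev_emb : forall n x, Pn n x -> ev n.+1 x = ps_emb B n (ev n x).
Hypothesis ev_dp : forall n x, Pn n x -> ev n.+1 (rdp D x) = ps_dp B n (ev n x).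
Hypothesis ev_dq : forall n x, Pn n x -> ev n.+1 (rdq D x) = ps_dq B n (ev n x).

(** The fraction h / w is written with its denominator cleared, so that closure under each operation
    reduces to an identity between polynomials; the fraction may change with the precision k. *)
Definition approx n (b : B n) : Prop := forall k, exists w h,
  [/\ denom n w, Pn n h & pmul p k (ev n w * b - ev n h)].

Lemma approx_ev n h : Pn n h -> approx (ev n h).
Proof.
move=> Ph k; exists 1, h; split=> //; first exact: denom1.
by rewrite rmorph1 mul1r subrr; apply: pmulz.
Qed.

Lemma approx1 n : @approx n 1.
Proof. by rewrite -(rmorph1 (ev n)); apply/approx_ev/sr_in1. Qed.

Lemma approxB n (b b' : B n) : approx b -> approx b' -> approx (b - b').
Proof.
move=> Ab Ab' k; have [w [h [dw Ph e]]] := Ab k; have [w' [h' [dw' Ph' e']]] := Ab' k.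
have [Pw _] := dw; have [Pw' _] := dw'.
exists (w * w'), (h * w' - h' * w); split; first exact: denomM.
  by apply: sr_inB; apply: sr_inM.
rewrite rmorphB !rmorphM.
set W := ev n w; set W' := ev n w'.
have -> : W * W' * (b - b') - (ev n h * W' - ev n h' * W) =
  W' * (W * b - ev n h) - W * (W' * b' - ev n h') by ring.
by apply: pmulB; apply: pmulMl.
Qed.

Lemma approxM n (b b' : B n) : approx b -> approx b' -> approx (b * b').
Proof.
move=> Ab Ab' k; have [w [h [dw Ph e]]] := Ab k; have [w' [h' [dw' Ph' e']]] := Ab' k.
have [Pw _] := dw; have [Pw' _] := dw'.
exists (w * w'), (h * h'); split; [exact: denomM|exact: sr_inM|].
rewrite !rmorphM; set W := ev n w; set W' := ev n w'.
have -> : W * W' * (b * b') - ev n h * ev n h' =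
  W' * b' * (W * b - ev n h) + ev n h * (W' * b' - ev n h') by ring.
by apply: pmulD; apply: pmulMl.
Qed.

Lemma approx_emb n (b : B n) : approx b -> approx (ps_emb B n b).
Proof.
move=> Ab k; have [w [h [dw Ph e]]] := Ab k; have [Pw _] := dw.
exists w, h; split; [exact: denom_emb|exact: Pn_emb|].
by rewrite !ev_emb // -rmorphM -rmorphB; apply: pmul_rmorph.
Qed.

(** The quotient rule is dp (h / w) = (w^p dp h - h^p dp w) / (w^p phi w). *)
Lemma approx_dp n (b : B n) : approx b -> approx (ps_dp B n b).
Proof.
move=> Ab k; have [w [h [dw Ph e]]] := Ab k.+1; have [Pw _] := dw.
exists (w ^+ p * rfrob D w), (w ^+ p * rdp D h - rdp D w * h ^+ p); split.
- by apply: denomM; [apply/denomX/denom_emb|apply: denom_frob].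
- by apply: sr_inB; apply: sr_inM; [apply/sr_inX/Pn_emb|apply: Pn_dp|apply: Pn_dp|
    apply/sr_inX/Pn_emb].
have BP := ps_pder B n.
rewrite /rfrob /frob rmorphB !(rmorphM, rmorphD, rmorphXn, rmorph_nat) /= !ev_dp // !ev_emb //.
have dpe := pder_congr pr_p BP e.
have Xe : pmul p k ((ps_emb B n (ev n w * b)) ^+ p - (ps_emb B n (ev n h)) ^+ p).
  by apply: pmul_subX; rewrite -rmorphB; apply: pmul_rmorph; apply: pmulW e.
move: dpe Xe; rewrite (pderM_frob BP) /frob rmorphM exprMn.
set W := ps_emb B n (ev n w); set b' := ps_emb B n b; set H := ps_emb B n (ev n h).
set dw' := ps_dp B n (ev n w); set dh := ps_dp B n (ev n h); set db := ps_dp B n b => e1 e2.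
have -> : W ^+ p * (W ^+ p + p%:R * dw') * db - (W ^+ p * dh - dw' * H ^+ p) =
  W ^+ p * ((W ^+ p + p%:R * dw') * db + b' ^+ p * dw' - dh) -
  dw' * (W ^+ p * b' ^+ p - H ^+ p) by ring.
by apply: pmulB; apply: pmulMl.
Qed.

Lemma approx_dq n (b : B n) : approx b -> approx (ps_dq B n b).
Proof.
move=> Ab k; have [w [h [dw Ph e]]] := Ab k; have [Pw _] := dw.
exists (w * w), (w * rdq D h - rdq D w * h); split.
- by apply: denomM; apply: denom_emb.
- by apply: sr_inB; apply: sr_inM; [apply: Pn_emb|apply: Pn_dq|apply: Pn_dq|apply: Pn_emb].
have [BP _] := ps_dpder B n.
rewrite rmorphB !rmorphM !ev_dq // !ev_emb //.
have dqe := der_pmul BP e.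
have Xe : pmul p k (ps_emb B n (ev n w * b) - ps_emb B n (ev n h)).
  by rewrite -rmorphB; apply: pmul_rmorph.
move: dqe Xe; rewrite (derB BP) ps_dqM rmorphM.
set W := ps_emb B n (ev n w); set b' := ps_emb B n b; set H := ps_emb B n (ev n h).
set dw' := ps_dq B n (ev n w); set dh := ps_dq B n (ev n h); set db := ps_dq B n b => e1 e2.
have -> : W * W * db - (W * dh - dw' * H) =
  W * (W * db + b' * dw' - dh) - dw' * (W * b' - H) by ring.
by apply: pmulB; apply: pmulMl.
Qed.

Definition approx_subring n : subring (B n) :=
  Subring (approx1 n) (@approxB n) (@approxM n).

Definition approx_subseq : subseq B :=
  @Subseq p B approx_subring approx_emb approx_dp approx_dq.

Lemma approx_inv n (b : B n) : ev n y0 * b = 1 -> approx b.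
Proof.
move=> yb k; exists y0, 1; split; [split=> //|exact: sr_in1|].
  by exists 1%N; rewrite expr1 subrr; apply: pmulz.
by rewrite yb rmorph1 subrr; apply: pmulz.
Qed.

Hypothesis B_sep : forall n (x : B n), (forall k, pmul p k x) -> x = 0.
Hypothesis B_lim : forall n (s : nat -> B n), (forall i, approx (s i)) ->
  exists l, forall m, pmul p m (l - \sum_(i < m) p%:R ^+ i * s i).

Lemma approx_closed n (l : B n) (s : nat -> B n) :
  (forall m, approx (s m)) -> (forall m, pmul p m (l - s m)) -> approx l.
Proof.
move=> As sl k; have [w [h [dw Ph e]]] := As k k; exists w, h; split=> //.
have -> : ev n w * l - ev n h = ev n w * (l - s k) + (ev n w * s k - ev n h) by ring.
by apply: pmulD => //; apply: pmulMl.
Qed.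

Lemma approx_pX n m (x : B n) : approx x -> approx (p%:R ^+ m * x).
Proof. by move=> Ax; apply: approxM => //; apply/(@sr_inX _ (approx_subring n))/sr_in_nat. Qed.

(** A limit in B is not enough: the quotients of l - s m by p^m must be approximable too, so a limit
    is taken for every tail of the series and not only for the whole. *)
Lemma approx_complete n : padic_complete p (sub_seq approx_subseq n).
Proof.
split=> [x xk|s sP].
  apply: sub_val_inj; rewrite rmorph0; apply: B_sep => k.
  by have [y ->] := xk k; apply: pmul_rmorph; exists y.
have {sP} /boolp.choice[y yP] : forall i, exists y, s i.+1 - s i = p%:R ^+ i * y by [].
have {}yP i : sub_val (s i.+1) = sub_val (s i) + p%:R ^+ i * sub_val (y i).
  by rewrite -[s i.+1](subrK (s i)) yP addrC rmorphD rmorphM rmorphXn rmorph_nat.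
have Ay m i : approx (sub_val (y (m + i)%N)) := sub_valP (y (m + i)%N).
have /boolp.choice[l lP] : forall m, exists l,
    forall k, pmul p k (l - \sum_(i < k) p%:R ^+ i * sub_val (y (m + i)%N)).
  by move=> m; apply: (B_lim (s := fun i => sub_val (y (m + i)%N))); apply: Ay.
have Al m : approx (l m).
  apply: (@approx_closed _ _ (fun k => \sum_(i < k) p%:R ^+ i * sub_val (y (m + i)%N))) => // k.
  apply: (@sr_in_sum _ (approx_subring n)) => i _; exact: approx_pX.
have sE m : sub_val (s m) = sub_val (s 0%N) + \sum_(i < m) p%:R ^+ i * sub_val (y i).
  elim: m => [|m IHm]; first by rewrite big_ord0 addr0.
  by rewrite yP IHm big_ord_recr addrA.
(* The quotient by p^m of the remainder after m terms is the tail limit [l m]. *)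
have lE m : l 0%N = \sum_(i < m) p%:R ^+ i * sub_val (y i) + p%:R ^+ m * l m.
  apply/eqP; rewrite -subr_eq0; apply/eqP/B_sep => k.
  have -> : l 0%N - (\sum_(i < m) p%:R ^+ i * sub_val (y i) + p%:R ^+ m * l m) =
      (l 0%N - \sum_(i < m + k) p%:R ^+ i * sub_val (y i)) -
      p%:R ^+ m * (l m - \sum_(i < k) p%:R ^+ i * sub_val (y (m + i)%N)).
    rewrite big_split_ord /= mulrBr mulr_sumr.
    under [X in _ - (_ - X)]eq_bigr do rewrite mulrA -exprD.
    by ring.
  apply: pmulB; last exact/pmulMl/lP.
  by apply: (@pmulW _ _ (m + k)); [lia|apply: lP].
exists (s 0%N + (sub_mk (V := approx_subring n) (Al 0%N) : sub_seq approx_subseq n)) => m.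
exists (sub_mk (V := approx_subring n) (Al m) : sub_seq approx_subseq n).
apply: sub_val_inj; rewrite rmorphB rmorphD rmorphM rmorphXn rmorph_nat.
change (sub_val (s 0%N) + l 0%N - sub_val (s m) = p%:R ^+ m * l m).
by rewrite (lE m) (sE m); ring.
Qed.

End FractionClosure.

(** * Square-zero prolongations *)

Record sqz (R : comPzRingType) (I : Type) := Sqz { sq1 : R; sq2 : I -> R }.

Section SquareZero.

Variables (R : comPzRingType) (I : Type).
Local Notation T := (sqz R I).
Implicit Types x y z : T.

Lemma sqzP x y : sq1 x = sq1 y -> (forall i, sq2 x i = sq2 y i) -> x = y.
Proof. by case: x y => [a m] [b n] /= -> mn; congr Sqz; apply: funext. Qed.

HB.instance Definition _ := gen_eqMixin T.
HB.instance Definition _ := gen_choiceMixin T.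

Definition sqz_add x y : T := Sqz (sq1 x + sq1 y) (fun i => sq2 x i + sq2 y i).
Definition sqz_opp x : T := Sqz (- sq1 x) (fun i => - sq2 x i).
Definition sqz_mul x y : T :=
  Sqz (sq1 x * sq1 y) (fun i => sq1 x * sq2 y i + sq1 y * sq2 x i).
Definition sqz_const a : T := Sqz a (fun=> 0).

Lemma sqz_addA : associative sqz_add.
Proof. by move=> x y z; apply: sqzP => [|i] /=; rewrite addrA. Qed.
Lemma sqz_addC : commutative sqz_add.
Proof. by move=> x y; apply: sqzP => [|i] /=; rewrite addrC. Qed.
Lemma sqz_add0 : left_id (sqz_const 0) sqz_add.
Proof. by move=> x; apply: sqzP => [|i] /=; rewrite add0r. Qed.
Lemma sqz_addN : left_inverse (sqz_const 0) sqz_opp sqz_add.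
Proof. by move=> x; apply: sqzP => [|i] /=; rewrite addNr. Qed.
HB.instance Definition _ := GRing.isZmodule.Build T sqz_addA sqz_addC sqz_add0 sqz_addN.

Lemma sqz_mulA : associative sqz_mul.
Proof. by move=> x y z; apply: sqzP => [|i] /=; ring. Qed.
Lemma sqz_mulC : commutative sqz_mul.
Proof. by move=> x y; apply: sqzP => [|i] /=; ring. Qed.
Lemma sqz_mul1 : left_id (sqz_const 1) sqz_mul.
Proof. by move=> x; apply: sqzP => [|i] /=; ring. Qed.
Lemma sqz_mulDl : left_distributive sqz_mul sqz_add.
Proof. by move=> x y z; apply: sqzP => [|i] /=; ring. Qed.
HB.instance Definition _ :=
  GRing.Zmodule_isComPzRing.Build T sqz_mulA sqz_mulC sqz_mul1 sqz_mulDl.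

Lemma sq1_zmod : zmod_morphism (@sq1 R I). Proof. by []. Qed.
Lemma sq1_monoid : monoid_morphism (@sq1 R I). Proof. by []. Qed.
HB.instance Definition _ := GRing.isZmodMorphism.Build T R (@sq1 R I) sq1_zmod.
HB.instance Definition _ := GRing.isMonoidMorphism.Build T R (@sq1 R I) sq1_monoid.

Lemma sqz_const_zmod : zmod_morphism sqz_const.
Proof. by move=> x y; apply: sqzP => [|i] //=; rewrite subrr. Qed.
Lemma sqz_const_monoid : monoid_morphism sqz_const.
Proof. by split=> // x y; apply: sqzP => [|i] //=; ring. Qed.
HB.instance Definition _ := GRing.isZmodMorphism.Build R T sqz_const sqz_const_zmod.
HB.instance Definition _ := GRing.isMonoidMorphism.Build R T sqz_const sqz_const_monoid.

Lemma sq2D x y i : sq2 (x + y) i = sq2 x i + sq2 y i. Proof. by []. Qed.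
Lemma sq2N x i : sq2 (- x) i = - sq2 x i. Proof. by []. Qed.
Lemma sq2B x y i : sq2 (x - y) i = sq2 x i - sq2 y i. Proof. by []. Qed.
Lemma sq2M x y i : sq2 (x * y) i = sq1 x * sq2 y i + sq1 y * sq2 x i.
Proof. by []. Qed.
Lemma sq2_nat n i : sq2 (n%:R : T) i = 0.
Proof. by elim: n => [|n IHn] //; rewrite -natr1 sq2D IHn add0r. Qed.

Lemma sq2X x n i : sq2 (x ^+ n) i = n%:R * (sq1 x ^+ n.-1 * sq2 x i).
Proof.
elim: n => [|[|n] IHn]; rewrite ?expr0 ?mul0r ?expr1 ?mul1r //.
by rewrite exprS sq2M IHn rmorphXn -[n.+2%:R]natr1 /= !exprS; ring.
Qed.

Lemma sq2_natM n x i : sq2 (n%:R * x) i = n%:R * sq2 x i.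
Proof. by rewrite sq2M sq2_nat rmorph_nat mulr0 addr0. Qed.

Lemma sq2_natXM n k x i : sq2 (n%:R ^+ k * x) i = n%:R ^+ k * sq2 x i.
Proof. by rewrite -!natrX sq2_natM. Qed.

Lemma sq2_sum (J : Type) (r : seq J) (P : pred J) (F : J -> T) i :
  sq2 (\sum_(j <- r | P j) F j) i = \sum_(j <- r | P j) sq2 (F j) i.
Proof. by elim/big_rec2: _ => // j x y _ <-. Qed.

(** The differential of Cp, with partial derivatives X^(p-1) - (X+Y)^(p-1) and its mirror image. As
    R may have p-torsion, p cannot be divided out of the differential of X^p + Y^p - (X+Y)^p; the
    binomial coefficients are compared one by one instead. *)
Lemma sq2_Cp p x y i : prime p -> sq2 (Cp p x y) i =
  sq1 x ^+ p.-1 * sq2 x i + sq1 y ^+ p.-1 * sq2 y i -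
  (sq1 x + sq1 y) ^+ p.-1 * (sq2 x i + sq2 y i).
Proof.
case: p => // q pr_p; rewrite [q.+1.-1]/=.
set a := sq1 x; set b := sq1 y; set m := sq2 x i; set n := sq2 y i.
have binD : (a + b) ^+ q = \sum_(0 <= k < q.+1) 'C(q, k)%:R * (a ^+ (q - k) * b ^+ k).
  by rewrite exprDn big_mkord; apply: eq_bigr => k _; rewrite mulr_natl.
have binl : \sum_(1 <= k < q.+1) 'C(q, k)%:R * (a ^+ (q - k) * b ^+ k) =
    (a + b) ^+ q - a ^+ q.
  by rewrite binD [in RHS]big_ltn // bin0 subn0 expr0 mulr1 mul1r addrC addrA addNr add0r.
have binr : \sum_(1 <= k < q.+1) 'C(q, k.-1)%:R * (a ^+ (q.+1 - k) * b ^+ k.-1) =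
    (a + b) ^+ q - b ^+ q.
  apply: (addIr (b ^+ q)); rewrite subrK binD [in RHS]big_nat_recr //= binn subnn expr0 !mul1r.
  by rewrite big_add1.
have binp k : (1 <= k < q.+1)%N ->
    (('C(q.+1, k) %/ q.+1) * k = 'C(q, k.-1) /\
     ('C(q.+1, k) %/ q.+1) * (q.+1 - k) = 'C(q, k))%N.
  case: k => // k kq.
  have pC : (q.+1 %| 'C(q.+1, k.+1))%N by rewrite prime_dvd_bin.
  split; apply/eqP; rewrite -(@eqn_pmul2l q.+1) //; apply/eqP.
    by rewrite mulnA [(q.+1 * _)%N]mulnC divnK // mul_bin_diag mulnC.
  by rewrite mulnA [(q.+1 * _)%N]mulnC divnK // mulnC mul_bin_down.
rewrite /Cp [LHS]sq2N sq2_sum.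
rewrite (eq_big_nat _ _ (F2 := fun k =>
    ('C(q, k.-1)%:R * (a ^+ (q.+1 - k) * b ^+ k.-1)) * n +
    ('C(q, k)%:R * (a ^+ (q - k) * b ^+ k)) * m)).
  by rewrite big_split -!mulr_suml binl binr /=; ring.
move=> k kq; have [e1 e2] := binp k kq.
rewrite sq2_natM sq2M !sq2X !rmorphXn -/a -/b -/m -/n -e1 -e2 !natrM.
have -> : (q - k = (q.+1 - k).-1)%N by lia.
by rewrite /=; ring.
Qed.

Lemma sqz_complete p : padic_complete p R -> padic_complete p T.
Proof.
move=> Rc; split=> [x xk|s sP].
  apply: sqzP => [|i]; apply: (padic_sep Rc) => k; have [y ->] := xk k.
    by exists (sq1 y); rewrite rmorphM rmorphXn rmorph_nat.
  by exists (sq2 y i); rewrite sq2_natXM.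
have [l lP] : exists l, forall n, pmul p n (l - sq1 (s n)).
  apply: (padic_lim Rc) => n; have [y yP] := sP n; exists (sq1 y).
  by rewrite -rmorphB yP rmorphM rmorphXn rmorph_nat.
have /boolp.choice[m mP] : forall i, exists m, forall n, pmul p n (m - sq2 (s n) i).
  move=> i; apply: (padic_lim Rc) => n; have [y yP] := sP n; exists (sq2 y i).
  by rewrite -sq2B yP sq2_natXM.
exists (Sqz l m) => n; have [a aP] := lP n.
have /boolp.choice[b bP] := fun i => mP i n.
exists (Sqz a b); apply: sqzP => [|i].
  by rewrite rmorphB rmorphM rmorphXn rmorph_nat.
by rewrite sq2_natXM sq2B /= bP.
Qed.

End SquareZero.

Section Additive.

Variables (R R' : comPzRingType) (I J : Type) (g : (I -> R) -> J -> R').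
Hypothesis gD : forall m n, g (fun i => m i + n i) = (fun j => g m j + g n j).

Lemma pointwise_sub m n : g (fun i => m i - n i) = (fun j => g m j - g n j).
Proof.
have -> : g m = g (fun i => (m i - n i) + n i).
  by congr g; apply: funext => i; rewrite subrK.
by rewrite (gD (fun i => m i - n i) n); apply: funext => j /=; rewrite addrK.
Qed.

Lemma pointwise0 : g (fun=> 0) = fun=> 0.
Proof.
have := pointwise_sub (fun=> 0) (fun=> 0); under [X in g X = _]funext do rewrite subrr.
by move=> ->; apply: funext => j; rewrite subrr.
Qed.

End Additive.

(* A square-zero thickening of S by free modules on which phi acts as [p * sd_F];
   the general formula dp (a, m) = (dp a, F m - a^(p-1) m) is forced when p is regular. *)
Record sq_data (p : nat) (S : pro_seq p) := SqData {
  sd_I : nat -> Type;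
  sd_e : forall n, (sd_I n -> S n) -> sd_I n.+1 -> S n.+1;
  sd_F : forall n, (sd_I n -> S n) -> sd_I n.+1 -> S n.+1;
  sd_Q : forall n, (sd_I n -> S n) -> sd_I n.+1 -> S n.+1;
  sd_eD : forall n m m', @sd_e n (fun i => m i + m' i) = (fun i => sd_e m i + sd_e m' i);
  sd_FD : forall n m m', @sd_F n (fun i => m i + m' i) = (fun i => sd_F m i + sd_F m' i);
  sd_QD : forall n m m', @sd_Q n (fun i => m i + m' i) = (fun i => sd_Q m i + sd_Q m' i);
  sd_eZ : forall n a m, @sd_e n (fun i => a * m i) = (fun i => ps_emb S n a * sd_e m i);
  sd_FZ : forall n a m, @sd_F n (fun i => a * m i) = (fun i => ps_frob S n a * sd_F m i);
  sd_QZ : forall n a m, @sd_Q n (fun i => a * m i) =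
    (fun i => ps_emb S n a * sd_Q m i + ps_dq S n a * sd_e m i);
  sd_eF : forall n m, @sd_F n.+1 (@sd_e n m) = sd_e (sd_F m);
  sd_eQ : forall n m, @sd_Q n.+1 (@sd_e n m) = sd_e (sd_Q m);
  sd_QF : forall n m, @sd_Q n.+1 (@sd_F n m) = (fun i => p%:R * sd_F (sd_Q m) i)
}.

Section SquareZeroSequence.

Variables (p : nat) (pr_p : prime p) (S : pro_seq p) (E : sq_data S).

Let R n : comPzRingType := sqz (S n) (sd_I E n).

Definition sz_emb n (x : R n) : R n.+1 := Sqz (ps_emb S n (sq1 x)) (sd_e (sq2 x)).
Definition sz_dp n (x : R n) : R n.+1 :=
  Sqz (ps_dp S n (sq1 x))
    (fun i => sd_F (sq2 x) i - ps_emb S n (sq1 x) ^+ p.-1 * sd_e (sq2 x) i).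
Definition sz_dq n (x : R n) : R n.+1 := Sqz (ps_dq S n (sq1 x)) (sd_Q (sq2 x)).

Lemma sz_emb_zmod n : zmod_morphism (@sz_emb n).
Proof.
move=> x y; apply: sqzP => [|i] /=; first exact: rmorphB.
exact: (congr1 (@^~ i) (pointwise_sub (@sd_eD _ _ E n) (sq2 x) (sq2 y))).
Qed.

Lemma sz_emb_monoid n : monoid_morphism (@sz_emb n).
Proof.
split=> [|x y]; apply: sqzP => [|i] /=; rewrite ?rmorph1 ?rmorphM //.
  by rewrite (pointwise0 (@sd_eD _ _ E n)).
by rewrite sd_eD !sd_eZ.
Qed.
HB.instance Definition _ n := GRing.isZmodMorphism.Build (R n) (R n.+1) (@sz_emb n) (@sz_emb_zmod n).
HB.instance Definition _ n := GRing.isMonoidMorphism.Build (R n) (R n.+1) (@sz_emb n) (@sz_emb_monoid n).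

Lemma sz_pder n : is_pder p (@sz_emb n : {rmorphism R n -> R n.+1}) (@sz_dp n).
Proof.
have [dp1 dpD dpM] := ps_pder S n.
have fE a : ps_frob S n a = ps_emb S n a ^+ p + p%:R * ps_dp S n a by [].
have Xp (a : S n.+1) : a ^+ p = a * a ^+ p.-1 by rewrite -exprS prednK ?prime_gt0.
split=> [|x y|x y]; apply: sqzP => [|i]; first exact: dp1.
- by rewrite /= (pointwise0 (@sd_FD _ _ E n)) (pointwise0 (@sd_eD _ _ E n)) mulr0 subrr.
- by rewrite !rmorphD rmorph_Cp; apply: dpD.
- by rewrite !sq2D sq2_Cp //= sd_FD sd_eD rmorphD; ring.
- by rewrite !(rmorphD, rmorphM, rmorphXn, rmorph_nat); apply: dpM.
- rewrite !sq2D !sq2M sq2_nat !sq2X !rmorphXn !rmorph_nat /=.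
  rewrite sd_FD !sd_FZ sd_eD !sd_eZ !fE rmorphM exprMn.
  by rewrite !(Xp (ps_emb _ _ _)); ring.
Qed.

Lemma sz_dpder n : is_dpder p (@sz_emb n : {rmorphism R n -> R n.+1})
  (@sz_emb n.+1 : {rmorphism R n.+1 -> R n.+2})
  (@sz_dp n) (@sz_dp n.+1) (@sz_dq n) (@sz_dq n.+1).
Proof.
have [[dqD dqM] dqdp] := ps_dpder S n.
have [dqP _] := ps_dpder S n.+1.
split=> [|x]; first split=> x y; apply: sqzP => [|i].
- exact: dqD.
- by rewrite sq2D /= sd_QD.
- by rewrite !(rmorphD, rmorphM); apply: dqM.
- by rewrite sq2D !sq2M /= sd_QD !sd_QZ; ring.
- by rewrite !(rmorphB, rmorphD, rmorphM, rmorphXn, rmorph_nat); apply: dqdp.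
rewrite sq2B sq2D sq2_natM sq2M !sq2X !rmorphXn /=.
rewrite (pointwise_sub (@sd_QD _ _ E n.+1)) sd_QZ sd_QF (derX dqP) sd_eQ -ps_dq_emb.
have -> : (p%:R : S n.+2) = p.-1%:R + 1 by rewrite natr1 prednK ?prime_gt0.
rewrite [ps_emb S n.+1 (_ ^+ _)]rmorphXn.
ring.
Qed.

Definition sz_seq : pro_seq p.
Proof.
refine (@ProSeq p R (fun n => @sz_emb n) sz_dp sz_dq sz_pder sz_dpder _ _).
- move=> n x; apply: sqzP => [|i] /=; first exact: ps_dp_emb.
  by rewrite sd_eF (pointwise_sub (@sd_eD _ _ E n.+1)) sd_eZ rmorphXn.
- by move=> n x; apply: sqzP => [|i] /=; [apply: ps_dq_emb|rewrite sd_eQ].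
Defined.

Lemma sq2_frob n (x : sz_seq n) i : sq2 (ps_frob sz_seq n x) i = p%:R * sd_F (sq2 x) i.
Proof. by rewrite [LHS]sq2D sq2_natM sq2X /=; ring. Qed.

Definition sz_const : ps_hom S sz_seq.
Proof.
refine (@PsHom p S sz_seq (fun n => @sqz_const _ _) _ _ _) => n x; apply: sqzP => // i /=.
- by rewrite (pointwise0 (@sd_eD _ _ E n)).
- by rewrite (pointwise0 (@sd_eD _ _ E n)) (pointwise0 (@sd_FD _ _ E n)) mulr0 subrr.
- by rewrite (pointwise0 (@sd_QD _ _ E n)).
Defined.

End SquareZeroSequence.

Definition ps_comp p (S T U : pro_seq p) (g : ps_hom T U) (f : ps_hom S T) : ps_hom S U.
Proof.
refine (@PsHom p S U (fun n => (g n \o f n)%FUN) _ _ _) => n x /=.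
- by rewrite !ps_map_emb.
- by rewrite !ps_map_dp.
- by rewrite !ps_map_dq.
Defined.

Definition sz_cseq p (pr_p : prime p) (A : comPzRingType) (D : dpq_ring p A)
    (S : cseq D) (E : sq_data S) : cseq D :=
  @CSeq p A D (sz_seq pr_p E) (ps_comp (sz_const pr_p E) (cs_str S))
    (fun n => sqz_complete (sd_I E n) (cs_complete S n)).

Section ProSeqExtra.

Variables (p : nat) (pr_p : prime p) (S : pro_seq p) (n : nat).

Lemma ps_frob_emb (x : S n) : ps_frob S n.+1 (ps_emb S n x) = ps_emb S n.+1 (ps_frob S n x).
Proof. by rewrite /ps_frob /frob rmorphD rmorphM rmorph_nat rmorphXn ps_dp_emb. Qed.

Lemma ps_frob_nat k : ps_frob S n k%:R = k%:R.
Proof. exact: (rmorph_nat (frob_rmorphism pr_p (ps_pder S n))). Qed.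

Lemma ps_frob0 : ps_frob S n 0 = 0.
Proof. exact: (rmorph0 (frob_rmorphism pr_p (ps_pder S n))). Qed.

Lemma ps_frob_natXM k j (x : S n) : ps_frob S n (k%:R ^+ j * x) = k%:R ^+ j * ps_frob S n x.
Proof. by rewrite ps_frobM -natrX ps_frob_nat natrX. Qed.

Lemma ps_dq0 : ps_dq S n 0 = 0.
Proof. by have [dqP _] := ps_dpder S n; exact: (der0 dqP). Qed.

End ProSeqExtra.

Section DualNumbers.

Variables (p : nat) (pr_p : prime p) (S : pro_seq p).

(* S[eps] with phi eps = p eps and dq eps = 0. *)
Definition dual_data : sq_data S.
Proof.
refine (@SqData p S (fun=> unit) (fun n m i => ps_emb S n (m i))
  (fun n m i => ps_frob S n (m i)) (fun n m i => ps_dq S n (m i)) _ _ _ _ _ _ _ _ _)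
  => n; [move=> m m'|move=> m m'|move=> m m'|move=> a m|move=> a m|move=> a m|
         move=> m|move=> m|move=> m]; apply: funext => i.
- exact: rmorphD.
- exact: ps_frobD.
- exact: ps_dqD.
- exact: rmorphM.
- exact: ps_frobM.
- by rewrite ps_dqM [ps_emb _ _ (m i) * _]mulrC.
- exact: ps_frob_emb.
- exact: ps_dq_emb.
- exact: ps_dq_frob.
Defined.

End DualNumbers.

(** * The test object and the functionals it defines on characters *)

Section TestObject.

Variables (p : nat) (pr_p : prime p) (A : comPzRingType) (D : dpq_ring p A).

Definition jet_index (n : nat) : Type := {ij : nat * nat | (ij.1 + ij.2 <= n)%N}.

Definition jet_mk n (f : nat -> nat -> A) (k : jet_index n) : A := f (val k).1 (val k).2.
(** Extension by zero outside i + j <= n, so that the formulas for e, F and Q hold for all i and j,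
    whatever the order n. *)
Definition jet_at n (m : jet_index n -> A) i j : A :=
  if insub (i, j) is Some k then m k else 0.

Lemma jet_atE n (m : jet_index n -> A) (k : jet_index n) :
  jet_at m (val k).1 (val k).2 = m k.
Proof. by rewrite /jet_at -surjective_pairing valK. Qed.

Lemma jet_at_out n (m : jet_index n -> A) i j : (n < i + j)%N -> jet_at m i j = 0.
Proof. by move=> nij; rewrite /jet_at insubF //= leqNgt nij. Qed.

Lemma jet_at_mk n f i j : jet_at (@jet_mk n f) i j = if (i + j <= n)%N then f i j else 0.
Proof.
case: leqP => [ij|/jet_at_out //]; rewrite /jet_at /jet_mk.
by case: insubP => [k _ ->|] //=; rewrite ij.
Qed.

Lemma jet_ext n (m m' : jet_index n -> A) : jet_at m =2 jet_at m' -> m = m'.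
Proof. by move=> mm'; apply: funext => k; rewrite -!jet_atE. Qed.

Lemma jet_atD n (m m' : jet_index n -> A) i j :
  jet_at (fun k => m k + m' k) i j = jet_at m i j + jet_at m' i j.
Proof. by rewrite /jet_at; case: insub => // ; rewrite addr0. Qed.

Lemma jet_atB n (m m' : jet_index n -> A) i j :
  jet_at (fun k => m k - m' k) i j = jet_at m i j - jet_at m' i j.
Proof. by rewrite /jet_at; case: insub => // ; rewrite subr0. Qed.

Lemma jet_atZ n a (m : jet_index n -> A) i j :
  jet_at (fun k => a * m k) i j = a * jet_at m i j.
Proof. by rewrite /jet_at; case: insub => // ; rewrite mulr0. Qed.

Definition jet_e n (m : jet_index n -> A) : jet_index n.+1 -> A := jet_mk (jet_at m).
Definition jet_F n (m : jet_index n -> A) : jet_index n.+1 -> A :=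
  jet_mk (fun i j => if i is i'.+1 then rfrob D (jet_at m i' j) else 0).
Definition jet_Q n (m : jet_index n -> A) : jet_index n.+1 -> A :=
  jet_mk (fun i j => rdq D (jet_at m i j) +
    p%:R ^+ i * (if j is j'.+1 then jet_at m i j' else 0)).

Let rfrob0 : rfrob D 0 = 0 := ps_frob0 pr_p (const_seq D) 0.
Let rdq0 : rdq D 0 = 0 := ps_dq0 (const_seq D) 0.

Lemma jet_at_e n (m : jet_index n -> A) i j : jet_at (jet_e m) i j = jet_at m i j.
Proof. by rewrite jet_at_mk; case: leqP => // nij; rewrite jet_at_out // ltnW. Qed.

Lemma jet_at_F n (m : jet_index n -> A) i j :
  jet_at (jet_F m) i j = if i is i'.+1 then rfrob D (jet_at m i' j) else 0.
Proof.
rewrite jet_at_mk; case: leqP => // nij; case: i nij => // i nij.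
by rewrite jet_at_out ?rfrob0.
Qed.

Lemma jet_at_Q n (m : jet_index n -> A) i j : jet_at (jet_Q m) i j =
  rdq D (jet_at m i j) + p%:R ^+ i * (if j is j'.+1 then jet_at m i j' else 0).
Proof.
rewrite jet_at_mk; case: leqP => // nij; rewrite jet_at_out; last lia.
by rewrite rdq0; case: j nij => [|j] nij; rewrite ?jet_at_out ?mulr0 ?addr0 //; lia.
Qed.

Let rfrobMX a b j : rfrob D (a%:R ^+ j * b) = a%:R ^+ j * rfrob D b :=
  ps_frob_natXM pr_p (S := const_seq D) (n := 0) a j b.
(* A (+) sum_(i + j <= n) A eps_ij with phi eps_ij = p eps_(i+1, j) and
   dq eps_ij = p^i eps_(i, j+1). *)
Definition jet_data : sq_data (const_seq D).
Proof.
refine (@SqData p (const_seq D) jet_index jet_e jet_F jet_Q _ _ _ _ _ _ _ _ _) => n;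
  [move=> m m'|move=> m m'|move=> m m'|move=> a m|move=> a m|move=> a m|
         move=> m|move=> m|move=> m]; apply: jet_ext => i j;
  rewrite ?(jet_atD, jet_atZ, jet_at_e, jet_at_F, jet_at_Q) //=.
- by case: i => [|i]; rewrite ?addr0 // jet_atD rfrobD.
- by rewrite rdqD; case: j => [|j]; rewrite ?jet_atD; ring.
- by case: i => [|i]; rewrite ?mulr0 // jet_atZ; apply: rfrobM.
- by rewrite rdqM; case: j => [|j]; rewrite ?jet_atZ; ring.
- by case: i => [|i] //; rewrite jet_at_e.
- by case: j => [|j] //; rewrite jet_at_e.
- case: i => [|i]; first by rewrite rdq0; case: j => [|j]; rewrite ?jet_at_F; ring.
  rewrite jet_at_Q rfrobD // rfrobMX rdq_rfrob //.
  by case: j => [|j]; rewrite ?jet_at_F ?rfrob0 exprS; ring.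
Defined.

Hypothesis A_complete : padic_complete p A.

Definition const_cseq : cseq D :=
  @CSeq p A D (const_seq D) (@PsHom p (const_seq D) (const_seq D) (fun=> idfun)
    (fun _ _ => erefl) (fun _ _ => erefl) (fun _ _ => erefl)) (fun=> A_complete).

Definition jet_cseq : cseq D := @sz_cseq p pr_p A D const_cseq jet_data.

Definition jet_one_val : sqz A (jet_index 0) := Sqz 1 (jet_mk (fun _ _ => 1)).
Lemma jet_oneP : `[< exists v, (jet_one_val : jet_cseq 0) * v = 1 >].
Proof.
apply/asboolP; exists (Sqz 1 (fun k => - jet_mk (fun _ _ => 1) k) : sqz A (jet_index 0)).
apply: sqzP => [|i]; first exact: mulr1.
by rewrite sq2M /= !mul1r addNr.
Qed.
Definition jet_one : units (jet_cseq 0) := exist _ jet_one_val jet_oneP.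

(* The eps_ij-coordinate of x (1 + eps_00). *)
Definition mu r (x : char_mod D r) i j : A := jet_at (sq2 (x jet_cseq jet_one)) i j.

Lemma mu_add r (x y : char_mod D r) i j : mu (x + y)%LM i j = mu x i j + mu y i j.
Proof. by rewrite /mu -jet_atD. Qed.

Lemma mu_scale r a (x : char_mod D r) i j : mu (a *: x)%LM i j = a * mu x i j.
Proof.
rewrite /mu -jet_atZ; congr (jet_at _ i j); apply: funext => k.
rewrite -[LHS]/(sq2 (sqz_const (jet_index r) a * x jet_cseq jet_one) k).
by rewrite sq2M /= mulr0 addr0.
Qed.

Lemma mu_emb r (x : char_mod D r) i j : mu (char_emb x) i j = mu x i j.
Proof. exact: jet_at_e. Qed.

Lemma mu_dq r (x : char_mod D r) i j : mu (char_dq x) i j =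
  rdq D (mu x i j) + p%:R ^+ i * (if j is j'.+1 then mu x i j' else 0).
Proof. exact: jet_at_Q. Qed.

Lemma mu_frob r (x : char_mod D r) i j :
  mu (char_frob pr_p x) i j = p%:R * (if i is i'.+1 then rfrob D (mu x i' j) else 0).
Proof.
rewrite -(jet_at_F (sq2 (x jet_cseq jet_one))) -jet_atZ /mu; congr (jet_at _ i j).
apply: funext => k; exact: (@sq2_frob p pr_p (const_seq D) jet_data r (x jet_cseq jet_one) k).
Qed.

Lemma mu_out r (x : char_mod D r) i j : (r < i + j)%N -> mu x i j = 0.
Proof. exact: jet_at_out. Qed.

End TestObject.

(** * Tangent vectors at 1 as morphisms out of the test object *)

Section JetMap.

Variables (p : nat) (pr_p : prime p) (A : comPzRingType) (D : dpq_ring p A).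
Hypothesis A_complete : padic_complete p A.
Variables (S : cseq D) (b : S 0).

(* For [i + j <= n] this is phi^i dq^j b, carried to S n; the junk values for larger [i + j]
   spare casts between the types S (i + j) and S n. *)
Fixpoint jet_coord n : nat -> nat -> S n :=
  match n with
  | 0 => fun i j => if (i == 0)%N && (j == 0)%N then b else 0
  | n'.+1 => fun i j => match i, j with
      | i'.+1, _ => ps_frob S n' (jet_coord n' i' j)
      | 0, j'.+1 => ps_dq S n' (jet_coord n' 0 j')
      | 0, 0 => ps_emb S n' (jet_coord n' 0 0)
      end
  end.

Arguments jet_coord : simpl never.

Lemma jet_coordF n i j : jet_coord n.+1 i.+1 j = ps_frob S n (jet_coord n i j).
Proof. by []. Qed.

Lemma jet_coordQ n j : jet_coord n.+1 0 j.+1 = ps_dq S n (jet_coord n 0 j).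
Proof. by []. Qed.

Lemma jet_coord_emb n i j : (i + j <= n)%N ->
  jet_coord n.+1 i j = ps_emb S n (jet_coord n i j).
Proof.
elim: n i j => [|n IHn] [|i] [|j] // ij.
- by rewrite !jet_coordQ -ps_dq_emb IHn.
- by rewrite !jet_coordF -ps_frob_emb -IHn.
- by rewrite !jet_coordF -ps_frob_emb -IHn.
Qed.

(** Moving dq past phi^i costs p^i, which matches dq eps_ij = p^i eps_(i, j+1). *)
Lemma jet_coord_dq n i j : (i + j <= n)%N ->
  ps_dq S n (jet_coord n i j) = p%:R ^+ i * jet_coord n.+1 i j.+1.
Proof.
elim: i n j => [|i IHi] [|n] j // ij; rewrite ?expr0 ?mul1r //.
by rewrite !jet_coordF ps_dq_frob // IHi // ps_frob_natXM // exprS mulrA.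
Qed.

(** The two bounds are free because phi shifts i and dq shifts j; [jet_sum_wide] discards the excess
    terms, which are zero. *)
Definition jet_sum N M n (m : jet_index n -> A) : S n :=
  \sum_(0 <= i < N) \sum_(0 <= j < M) cs_str S n (jet_at m i j) * jet_coord n i j.

Lemma jet_sum_wide N M n (m : jet_index n -> A) : (n < N)%N -> (n < M)%N ->
  jet_sum N M m = jet_sum n.+1 n.+1 m.
Proof.
move=> nN nM; rewrite /jet_sum (big_cat_nat (n := n.+1)) //= addrC big1_seq ?add0r; last first.
  move=> i; rewrite mem_index_iota => /and3P[_ ni _]; rewrite big1 // => j _.
  by rewrite jet_at_out ?rmorph0 ?mul0r //; lia.
apply: eq_bigr => i _; rewrite (big_cat_nat (n := n.+1)) //= addrC big1_seq ?add0r //.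
move=> j; rewrite mem_index_iota => /and3P[_ nj _].
by rewrite jet_at_out ?rmorph0 ?mul0r //; lia.
Qed.

(** The morphism with eps_00 going to b eps. Since phi eps = p eps and dq eps = 0, the image of
    eps_ij = (phi / p)^i dq^j eps_00 is (phi^i dq^j b) eps. *)
Definition jet_map n (x : jet_cseq pr_p D A_complete n) : sqz (S n) unit :=
  let y : sqz A (jet_index n) := x in
  Sqz (cs_str S n (sq1 y)) (fun=> jet_sum n.+1 n.+1 (sq2 y)).

Definition dual_cseq : cseq D := @sz_cseq p pr_p A D S (dual_data pr_p S).

Lemma jet_sumD N M n (m m' : jet_index n -> A) :
  jet_sum N M (fun k => m k + m' k) = jet_sum N M m + jet_sum N M m'.
Proof.
rewrite /jet_sum -big_split; apply: eq_bigr => i _; rewrite -big_split.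
by apply: eq_bigr => j _; rewrite jet_atD rmorphD mulrDl.
Qed.

Lemma jet_sumZ N M n a (m : jet_index n -> A) :
  jet_sum N M (fun k => a * m k) = cs_str S n a * jet_sum N M m.
Proof.
rewrite /jet_sum mulr_sumr; apply: eq_bigr => i _; rewrite mulr_sumr.
by apply: eq_bigr => j _; rewrite jet_atZ rmorphM mulrA.
Qed.

Lemma jet_sum_e N M n (m : jet_index n -> A) :
  jet_sum N M (jet_e m) = ps_emb S n (jet_sum N M m).
Proof.
rewrite /jet_sum rmorph_sum; apply: eq_bigr => i _; rewrite rmorph_sum.
apply: eq_bigr => j _; rewrite jet_at_e [RHS]rmorphM -(ps_map_emb (cs_str S)).
have [ij|nij] := leqP (i + j) n; first by rewrite jet_coord_emb.
by rewrite jet_at_out // !rmorph0 !mul0r.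
Qed.

Lemma str_frob n a : cs_str S n.+1 (rfrob D a) = ps_frob S n (cs_str S n a).
Proof. exact: (ps_map_frob (cs_str S)). Qed.

Lemma str_dq n a : cs_str S n.+1 (rdq D a) = ps_dq S n (cs_str S n a).
Proof. exact: (ps_map_dq (cs_str S)). Qed.

Lemma ps_frob_sum n (I : Type) (r : seq I) (P : pred I) (F : I -> S n) :
  ps_frob S n (\sum_(i <- r | P i) F i) = \sum_(i <- r | P i) ps_frob S n (F i).
Proof. exact: (big_morph (ps_frob S n) (@ps_frobD p pr_p S n) (ps_frob0 pr_p S n)). Qed.

Lemma ps_dq_sum n (I : Type) (r : seq I) (P : pred I) (F : I -> S n) :
  ps_dq S n (\sum_(i <- r | P i) F i) = \sum_(i <- r | P i) ps_dq S n (F i).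
Proof. exact: (big_morph (ps_dq S n) (@ps_dqD p S n) (ps_dq0 S n)). Qed.

Lemma jet_sum_F N M n (m : jet_index n -> A) :
  jet_sum N.+1 M (jet_F D m) = ps_frob S n (jet_sum N M m).
Proof.
rewrite /jet_sum ps_frob_sum big_nat_recl //= big1 ?add0r; last first.
  by move=> j _; rewrite jet_at_F // rmorph0 mul0r.
apply: eq_bigr => i _; rewrite ps_frob_sum; apply: eq_bigr => j _.
by rewrite jet_at_F // ps_frobM str_frob.
Qed.

Lemma jet_sum_Q N M n (m : jet_index n -> A) : (n < M)%N ->
  jet_sum N M.+1 (jet_Q D m) = ps_dq S n (jet_sum N M m).
Proof.
move=> nM; rewrite /jet_sum ps_dq_sum; apply: eq_bigr => i _; rewrite ps_dq_sum.
rewrite (eq_bigr (fun j => cs_str S n.+1 (rdq D (jet_at m i j)) * jet_coord n.+1 i j +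
  p%:R ^+ i * cs_str S n.+1 (if j is j'.+1 then jet_at m i j' else 0) * jet_coord n.+1 i j));
  last by move=> j _; rewrite jet_at_Q // rmorphD rmorphM rmorphXn rmorph_nat mulrDl.
rewrite big_split /= big_nat_recr //= [X in _ + X]big_nat_recl //= rmorph0 mulr0 mul0r add0r.
rewrite jet_at_out; last lia.
rewrite [X in cs_str S n.+1 X](ps_dq0 (const_seq D) 0) rmorph0 mul0r addr0 -big_split.
apply: eq_bigr => j _ /=; rewrite ps_dqM -str_dq -(ps_map_emb (cs_str S)) /=.
have [ij|nij] := leqP (i + j) n; first by rewrite jet_coord_emb // jet_coord_dq //; ring.
by rewrite jet_at_out // str_dq rmorph0 ps_dq0 rmorph0; ring.
Qed.

Lemma jet_map_zmod n : zmod_morphism (@jet_map n).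
Proof.
have str0 k := pointwise_sub (fun m m' => funext (fun _ : unit => jet_sumD k k (n := n) m m')
  : (fun _ : unit => _) = _).
move=> x y; apply: sqzP => [|[]]; first exact: rmorphB.
exact: (congr1 (@^~ tt) (str0 n.+1 (sq2 x) (sq2 y))).
Qed.

Lemma jet_map_monoid n : monoid_morphism (@jet_map n).
Proof.
split=> [|x y]; apply: sqzP => [|[]]; rewrite ?rmorph1 //.
- exact: rmorph1.
- rewrite /= /jet_sum big1 // => i _; rewrite big1 // => j _.
  by rewrite /jet_at; case: insub => [k|] /=; rewrite rmorph0 mul0r.
- exact: rmorphM.
- by rewrite sq2M /= -!jet_sumZ -jet_sumD.
Qed.

HB.instance Definition _ n := GRing.isZmodMorphism.Build _ _ (@jet_map n) (@jet_map_zmod n).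
HB.instance Definition _ n := GRing.isMonoidMorphism.Build _ _ (@jet_map n) (@jet_map_monoid n).

Definition jet_hom : ps_hom (jet_cseq pr_p D A_complete) dual_cseq.
Proof.
refine (@PsHom p (jet_cseq pr_p D A_complete) dual_cseq (fun n => @jet_map n) _ _ _) => n x;
  apply: sqzP => [|[]].
- exact: (ps_map_emb (cs_str S)).
- by rewrite /= jet_sum_e jet_sum_wide.
- exact: (ps_map_dp (cs_str S)).
- rewrite /= (_ : (fun i => _) = (fun k => jet_F D (sq2 x) k + (- sq1 x ^+ p.-1) * jet_e (sq2 x) k));
    last by apply: funext => k; rewrite mulNr.
  rewrite jet_sumD jet_sumZ jet_sum_F jet_sum_e !jet_sum_wide // rmorphN rmorphXn.
  by rewrite (ps_map_emb (cs_str S) (sq1 x)) mulNr.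
- exact: (ps_map_dq (cs_str S)).
- by rewrite /= jet_sum_Q // jet_sum_wide.
Defined.

Definition dual_one_val : sqz (S 0) unit := Sqz 1 (fun=> b).
Lemma dual_oneP : `[< exists v, (dual_one_val : dual_cseq 0) * v = 1 >].
Proof.
apply/asboolP; exists (Sqz 1 (fun=> - b) : sqz (S 0) unit).
apply: sqzP => [|i]; first exact: mulr1.
by rewrite sq2M /= !mul1r addNr.
Qed.
Definition dual_one : units (dual_cseq 0) := exist _ (dual_one_val : dual_cseq 0) dual_oneP.

(** Naturality along [jet_hom], which carries 1 + eps_00 to 1 + b eps: the values mu_ij determine
    the differential of x at 1 in every direction b over every S. *)
Lemma char_dual r (x : char_mod D r) : sq2 (x dual_cseq dual_one : sqz (S r) unit) tt =
  \sum_(0 <= i < r.+1) \sum_(0 <= j < r.+1)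
    cs_str S r (mu pr_p A_complete x i j) * jet_coord r i j.
Proof.
have -> : dual_one = units_map (jet_hom 0) (jet_one pr_p D A_complete).
  apply: val_inj; apply: sqzP => [|[]] /=; first by rewrite rmorph1.
  by rewrite /jet_sum !big_nat1 jet_at_mk /= rmorph1 mul1r.
rewrite -(ch_nat x (S := jet_cseq pr_p D A_complete) (f := jet_hom)) //.
move=> n a; apply: sqzP => [|[]] //=.
rewrite /jet_sum big1 // => i _; rewrite big1 // => j _.
by rewrite /jet_at; case: insub => [k|] /=; rewrite rmorph0 mul0r.
Qed.

End JetMap.

(** * Jet polynomials *)

Lemma malgU_C (K : conomType) (A : comNzRingType) (a : A) (m : K) :
  << a *g m >> = a%:MP * << m >> :> {malg A[K]}.
Proof. by rewrite mul_malgC; apply/malgP => k; rewrite mcoeffZ !mcoeffU mulr_natr. Qed.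

Lemma malgU_M (K : conomType) (A : comNzRingType) (m m' : K) :
  << m >> * << m' >> = << mmul m m' >> :> {malg A[K]}.
Proof. by rewrite malgM_def fgmulUU mulr1. Qed.

Lemma cmonom_split (I : choiceType) (m : {cmonom I}) : mdeg m != 0%N ->
  exists i m', m = mmul m' (ucm i) /\ mdeg m = (mdeg m').+1.
Proof.
move=> md; have [i mi] : exists i, i \in finsupp m.
  by apply/fset0Pn; apply: contra md => /eqP m0; rewrite mdegE m0 big_seq_fset0.
have e : m = mmul (divcm m (ucm i)) (ucm i).
  apply/eqP/cmP => j; rewrite cmM divcmE ucmE; case: eqP => [<-|_]; last by rewrite subn0 addn0.
  by rewrite subnK // lt0n cmE_neq0.
exists i, (divcm m (ucm i)); split=> //.
by rewrite [in LHS]e mdegM mdegU addn1.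
Qed.

Lemma malg_ind (I : choiceType) (A : comNzRingType) (V : subring {malg A[{cmonom I}]}) :
  (forall a, V a%:MP) -> (forall i, V << ucm i >>) -> forall f, V f.
Proof.
move=> VC VX f; rewrite [f]monalgE; apply: sr_in_sum => m _.
rewrite malgU_C; apply: sr_inM; first exact: VC.
elim: {m}(mdeg m) {-2}m (erefl (mdeg m)) => [|d IHd] m md.
  by rewrite (mdeg_eq0I md); apply: sr_in1.
have [|i [m' [e md']]] := @cmonom_split _ m; first by rewrite md.
rewrite e -malgU_M; apply: sr_inM; last exact: VX.
by apply: IHd; apply: succn_inj; rewrite -md' md.
Qed.

Lemma malg_ev_nz (I : choiceType) (A B : comNzRingType) (g : {rmorphism A -> B}) (v : I -> B) :
  exists ev : {rmorphism {malg A[{cmonom I}]} -> B},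
    (forall a, ev a%:MP = g a) /\ (forall i, ev << ucm i >> = v i).
Proof.
pose h (m : {cmonom I}) : B := \prod_(k <- finsupp m) v k ^+ m k.
have hE (d : {fset I}) (m : {cmonom I}) : (finsupp m `<=` d)%fset -> h m = \prod_(k <- d) v k ^+ m k.
  move=> md; rewrite /h (big_fset_incl _ md) // => k _.
  by rewrite -cmE_neq0 negbK => /eqP ->.
have hM : mmorphism h.
  split=> [m m'|]; last by rewrite /h mdom1 big_seq_fset0.
  rewrite (hE (finsupp m `|` finsupp m')%fset) ?mdomD //.
  rewrite (hE (finsupp m `|` finsupp m')%fset m) ?fsubsetUl //.
  rewrite (hE (finsupp m `|` finsupp m')%fset m') ?fsubsetUr //.
  by rewrite -big_split; apply: eq_bigr => k _; rewrite cmM exprD.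
pose hh : {mmorphism {cmonom I} -> B} := HB.pack h (isMultiplicative.Build _ _ h hM).
exists (mmap g hh); split=> [a|i]; first exact: mmapC.
rewrite -[LHS]/(mmap g h << ucm i >>) mmapU [X in X * _](rmorph1 g) mul1r /= /h mdomU big_seq_fset1 cmUU.
by rewrite expr1.
Qed.

(** A ring of a prolongation sequence may be zero. That case is treated apart; otherwise B is
    repackaged together with the proof that 1 differs from 0. *)
Lemma malg_ev (I : choiceType) (A : comNzRingType) (B : comPzRingType)
    (g : {rmorphism A -> B}) (v : I -> B) :
  exists ev : {rmorphism {malg A[{cmonom I}]} -> B},
    (forall a, ev a%:MP = g a) /\ (forall i, ev << ucm i >> = v i).
Proof.
have [B0|B0] := eqVneq (1 : B) 0.
  have B00 (x y : B) : x = y by rewrite -[x]mul1r -[y]mul1r B0 !mul0r.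
  pose z (f : {malg A[{cmonom I}]}) : B := 0.
  have zD : zmod_morphism z by move=> f f'; apply: B00.
  have zM : monoid_morphism z by split=> [|f f']; apply: B00.
  pose zR : {rmorphism {malg A[{cmonom I}]} -> B} := HB.pack z
    (GRing.isZmodMorphism.Build _ _ z zD) (GRing.isMonoidMorphism.Build _ _ z zM).
  by exists zR; split=> *; apply: B00.
pose B' : comNzRingType := HB.pack B (GRing.PzSemiRing_isNonZero.Build B B0).
pose g0 : A -> B' := g.
have gD : zmod_morphism g0 by move=> x y; apply: (rmorphB g).
have gM : monoid_morphism g0 by split=> [|x y]; [apply: (rmorph1 g)|apply: (rmorphM g)].
pose g' : {rmorphism A -> B'} := HB.pack g0 (GRing.isZmodMorphism.Build _ _ g0 gD)
    (GRing.isMonoidMorphism.Build _ _ g0 gM).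
have [e [eC eX]] := @malg_ev_nz I A B' g' v.
pose e0 : {malg A[{cmonom I}]} -> B := e.
have eD : zmod_morphism e0 by move=> x y; apply: (rmorphB e).
have eM : monoid_morphism e0 by split=> [|x y]; [apply: (rmorph1 e)|apply: (rmorphM e)].
pose eR : {rmorphism {malg A[{cmonom I}]} -> B} := HB.pack e0
  (GRing.isZmodMorphism.Build _ _ e0 eD) (GRing.isMonoidMorphism.Build _ _ e0 eM).
by exists eR.
Qed.

(* The polynomial ring over A in variables X i j, the universal dp^i dq^j X, with its monomial
   basis; kept abstract because unification unfolds {malg _[_]} too eagerly. *)
Record jet_ring (A : idomainType) := JetRing {
  jr_ring :> comNzRingType;
  jrC : {rmorphism A -> jr_ring};
  jrX : nat -> nat -> jr_ring;
  jr_ind : forall V : subring jr_ring,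
    (forall a, V (jrC a)) -> (forall i j, V (jrX i j)) -> forall f, V f;
  jr_ev : forall (B : comPzRingType) (g : {rmorphism A -> B}) (v : nat -> nat -> B),
    exists ev : {rmorphism jr_ring -> B},
      (forall a, ev (jrC a) = g a) /\ (forall i j, ev (jrX i j) = v i j);
  jr_key : eqType;
  jr_key1 : jr_key;
  jr_keyX : nat -> nat -> jr_key;
  jr_keyM : jr_key -> jr_key -> jr_key;
  jr_mon : jr_key -> jr_ring;
  jr_coef : jr_key -> jr_ring -> A;
  jr_mon1 : jr_mon jr_key1 = 1;
  jr_monX : forall i j, jr_mon (jr_keyX i j) = jrX i j;
  jr_monM : forall k l, jr_mon (jr_keyM k l) = jr_mon k * jr_mon l;
  jr_coefB : forall k f g, jr_coef k (f - g) = jr_coef k f - jr_coef k g;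
  jr_coefZ : forall k a f, jr_coef k (jrC a * f) = a * jr_coef k f;
  jr_coef_mon : forall k l, jr_coef k (jr_mon l) = (k == l)%:R;
  jr_coef_inj : forall f, (forall k, jr_coef k f = 0) -> f = 0
}.

Definition jet_poly (A : idomainType) : jet_ring A.
Proof.
pose I : choiceType := (nat * nat)%type.
refine (@JetRing A {malg A[{cmonom I}]} (@malgC {cmonom I} A) (fun i j => << ucm ((i, j) : I) >>)
  _ _ {cmonom I} (@mone {cmonom I}) (fun i j => ucm ((i, j) : I)) (@mmul {cmonom I})
  (fun k => << k >>) (fun k f => f@_k) _ _ _ _ _ _ _).
- by move=> V VC VX; apply: malg_ind => // -[i j]; apply: VX.
- move=> B g v; have [ev [evC evX]] := malg_ev g (fun k : I => v k.1 k.2).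
  by exists ev; split=> [a|i j]; [apply: evC|apply: (evX (i, j))].
- by [].
- by [].
- by move=> k l; rewrite malgU_M.
- by move=> k f g; rewrite mcoeffB.
- by move=> k a f; rewrite mcoeffCM.
- by move=> k l; rewrite mcoeffU1 eq_sym.
- by move=> f f0; apply/malgP => k; rewrite f0 mcoeff0.
Qed.

(** * From a Frobenius lift to a p-derivation, in the absence of p-torsion *)

Section FrobeniusLift.

Variables (p : nat) (pr_p : prime p) (R : comPzRingType).
Hypothesis R_reg : forall x : R, p%:R * x = 0 -> x = 0.
Variables (phi : {rmorphism R -> R}) (dq : R -> R).
Hypothesis phi_lift : forall x, pmul p 1 (phi x - x ^+ p).
Hypothesis dqP : is_der idfun dq.
Hypothesis dq_phi : forall x, dq (phi x) = p%:R * phi (dq x).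

Definition lift_dp x : R := projT1 (cid (phi_lift x)).

Lemma lift_dpE x : phi x = x ^+ p + p%:R * lift_dp x.
Proof. by rewrite /lift_dp; case: cid => y /=; rewrite expr1 => <-; rewrite addrC subrK. Qed.

Lemma mulp_inj (x y : R) : p%:R * x = p%:R * y -> x = y.
Proof.
by move=> xy; apply/eqP; rewrite -subr_eq0; apply/eqP/R_reg; rewrite mulrBr xy subrr.
Qed.

Lemma lift_pder : is_pder p idfun lift_dp.
Proof.
have pdp x : p%:R * lift_dp x = phi x - x ^+ p by rewrite lift_dpE addrC addKr.
split=> [|x y|x y]; apply: mulp_inj; rewrite ?mulrDr ?pdp /=.
- by rewrite rmorph1 expr1n subrr mulr0.
- by rewrite Cp_mulp // rmorphD; ring.
- rewrite rmorphM exprMn.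
  have -> : p%:R * (x ^+ p * lift_dp y) + p%:R * (y ^+ p * lift_dp x) +
    p%:R * (p%:R * (lift_dp x * lift_dp y)) = x ^+ p * (p%:R * lift_dp y) +
    y ^+ p * (p%:R * lift_dp x) + (p%:R * lift_dp x) * (p%:R * lift_dp y) by ring.
  by rewrite !pdp; ring.
Qed.

(** Apply dq to p dp x = phi x - x^p, use dq phi = p phi dq, and cancel p. *)
Lemma lift_dpder : is_dpder p idfun idfun lift_dp lift_dp dq dq.
Proof.
split=> // x; apply: mulp_inj.
have <- : dq (p%:R * lift_dp x) = p%:R * dq (lift_dp x).
  by rewrite (proj2 dqP) (der_nat dqP) mulr0 addr0.
have -> : p%:R * lift_dp x = phi x - x ^+ p by rewrite lift_dpE addrC addKr.
by rewrite (derB dqP) (derX dqP) dq_phi (lift_dpE (dq x)) /=; ring.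
Qed.

Definition lift_dpq : dpq_ring p R := DpqRing lift_pder lift_dpder.

Lemma lift_frob x : rfrob lift_dpq x = phi x.
Proof. by rewrite lift_dpE. Qed.

End FrobeniusLift.

(** The congruence with the p-th power therefore needs to be checked on ring generators only.
    Closure under differences is the divisibility by p of X^p + Y^p - (X+Y)^p. *)
Lemma frob_lift_subring p (pr_p : prime p) (R : comPzRingType) (phi : {rmorphism R -> R}) :
  exists V : subring R, forall x, V x <-> pmul p 1 (phi x - x ^+ p).
Proof.
have Cp1 (x y : R) : pmul p 1 (x ^+ p + y ^+ p - (x + y) ^+ p).
  by rewrite -Cp_mulp //; exists (Cp p x y); rewrite expr1.
unshelve eexists (@Subring R (fun x => pmul p 1 (phi x - x ^+ p)) _ _ _) => //=.
- by rewrite rmorph1 expr1n subrr; apply: pmulz.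
- move=> x y Vx Vy.
  have := Cp1 (x - y) y; rewrite subrK rmorphB => Cxy.
  have -> : phi x - phi y - (x - y) ^+ p =
    (phi x - x ^+ p) - (phi y - y ^+ p) - ((x - y) ^+ p + y ^+ p - x ^+ p) by ring.
  by apply: pmulB => //; apply: pmulB.
- move=> x y Vx Vy; rewrite rmorphM exprMn.
  have -> : phi x * phi y - x ^+ p * y ^+ p =
    (phi x - x ^+ p) * phi y + x ^+ p * (phi y - y ^+ p) by ring.
  by apply: pmulD; [apply: pmulMr|apply: pmulMl].
Qed.

(** * The operators phi, dp and dq on jet polynomials *)

Section JetPolynomialOperators.

Variables (p : nat) (pr_p : prime p) (A : idomainType) (D : dpq_ring p A).
Hypothesis A_char0 : [pchar A] =i pred0.
Variable P : jet_ring A.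
Local Notation C := (jrC P).
Local Notation X := (jrX P).

Lemma natr_neq0 n : (0 < n)%N -> n%:R != 0 :> A.
Proof. by move=> n0; rewrite ((pcharf0P A).1 A_char0) -lt0n. Qed.

Lemma jpoly_reg n (f : P) : (0 < n)%N -> n%:R * f = 0 -> f = 0.
Proof.
move=> n0 nf; apply: jr_coef_inj => k; have := jr_coefZ k n%:R f.
rewrite rmorph_nat nf => /esym/eqP; have -> : jr_coef k (0 : P) = 0.
  by rewrite -(subrr 0) jr_coefB subrr.
by rewrite mulf_eq0 (negPf (natr_neq0 n0)) => /eqP.
Qed.

Definition jpoly_eval (B : comPzRingType) (g : {rmorphism A -> B}) (v : nat -> nat -> B) :
  {rmorphism P -> B} := projT1 (cid (@jr_ev A P B g v)).

Lemma jpoly_evalC (B : comPzRingType) (g : {rmorphism A -> B}) v a : jpoly_eval g v (C a) = g a.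
Proof. exact: (proj1 (projT2 (cid (@jr_ev A P B g v)))). Qed.

Lemma jpoly_evalX (B : comPzRingType) (g : {rmorphism A -> B}) v i j :
  jpoly_eval g v (X i j) = v i j.
Proof. exact: (proj2 (projT2 (cid (@jr_ev A P B g v)))). Qed.

Lemma jpoly_hom_ext (B : comPzRingType) (f g : {rmorphism P -> B}) :
  (forall a, f (C a) = g (C a)) -> (forall i j, f (X i j) = g (X i j)) -> f =1 g.
Proof.
move=> fgC fgX h.
unshelve eapply (@jr_ind A P (@Subring P (fun x => f x = g x) _ _ _)) => //=.
- by rewrite !rmorph1.
- by move=> x y /= fx fy; rewrite !rmorphB fx fy.
- by move=> x y /= fx fy; rewrite !rmorphM fx fy.
Qed.

Definition frobA : {rmorphism A -> A} := frob_rmorphism pr_p (rdp_pder D).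

Definition jpoly_phi : {rmorphism P -> P} :=
  jpoly_eval (C \o frobA) (fun i j => X i j ^+ p + p%:R * X i.+1 j).

Lemma jpoly_phiC a : jpoly_phi (C a) = C (rfrob D a).
Proof. exact: jpoly_evalC. Qed.

Lemma jpoly_phiX i j : jpoly_phi (X i j) = X i j ^+ p + p%:R * X i.+1 j.
Proof. exact: jpoly_evalX. Qed.

Lemma jpoly_phi_lift f : pmul p 1 (jpoly_phi f - f ^+ p).
Proof.
have [V VE] := frob_lift_subring pr_p jpoly_phi; apply/VE; apply: jr_ind => [a|i j]; apply/VE.
  by rewrite jpoly_phiC rmorphD rmorphM rmorphXn rmorph_nat /= addrC addKr;
    exists (C (rdp D a)); rewrite expr1.
by rewrite jpoly_phiX addrC addKr; exists (X i.+1 j); rewrite expr1.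
Qed.

(** The value forced on dq (X i j), where X i j stands for dp^i dq^j X: the right-hand side of the
    rule for dq dp x equals phi (dq x) - x^(p-1) dq x. Stated with phi, the recursion can precede
    the p-derivation. *)
Fixpoint jpoly_d i j : P :=
  if i is i'.+1 then jpoly_phi (jpoly_d i' j) - X i' j ^+ p.-1 * jpoly_d i' j else X 0 j.+1.

Lemma jpoly_d0 j : jpoly_d 0 j = X 0 j.+1. Proof. by []. Qed.
Lemma jpoly_dS i j : jpoly_d i.+1 j = jpoly_phi (jpoly_d i j) - X i j ^+ p.-1 * jpoly_d i j.
Proof. by []. Qed.

Definition tangent_const (a : A) : sqz P unit := Sqz (C a) (fun=> C (rdq D a)).

Lemma tangent_const_zmod : zmod_morphism tangent_const.
Proof.
have [dqP _] := rdq_dpder D.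
by move=> a b; apply: sqzP => [|i]; rewrite ?sq2B /= ?(derB dqP) rmorphB.
Qed.

Lemma tangent_const_monoid : monoid_morphism tangent_const.
Proof.
have [dqP _] := rdq_dpder D.
split=> [|a b]; apply: sqzP => [|i]; rewrite ?sq2M /= ?rmorph1 ?(der1 dqP) ?rmorph0 ?rmorphM //.
by rewrite (proj2 dqP) rmorphD !rmorphM.
Qed.

HB.instance Definition _ := GRing.isZmodMorphism.Build A (sqz P unit) tangent_const tangent_const_zmod.
HB.instance Definition _ := GRing.isMonoidMorphism.Build A (sqz P unit) tangent_const tangent_const_monoid.

(** A derivation is a ring morphism to dual numbers lifting the identity, so the universal property
    of P, which concerns ring morphisms, produces dq from its values on generators. *)
Definition jpoly_tangent : {rmorphism P -> sqz P unit} :=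
  jpoly_eval tangent_const (fun i j => Sqz (X i j) (fun=> jpoly_d i j)).

Definition jpoly_dq f : P := sq2 (jpoly_tangent f) tt.

Lemma jpoly_dqC a : jpoly_dq (C a) = C (rdq D a).
Proof. by rewrite /jpoly_dq jpoly_evalC. Qed.

Lemma jpoly_dqX i j : jpoly_dq (X i j) = jpoly_d i j.
Proof. by rewrite /jpoly_dq jpoly_evalX. Qed.

Lemma jpoly_dq_der : is_der idfun jpoly_dq.
Proof.
have sq1E f : sq1 (jpoly_tangent f) = f.
  apply: (@jpoly_hom_ext P (@sq1 P unit \o jpoly_tangent) idfun) => [a|i j] /=.
    by rewrite jpoly_evalC.
  by rewrite jpoly_evalX.
split=> f g; first by rewrite /jpoly_dq rmorphD.
by rewrite /jpoly_dq rmorphM sq2M !sq1E.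
Qed.

(** Both sides are derivations along phi, so agreement on constants and variables suffices;
    [jpoly_d] is made for the variables. *)
Lemma jpoly_dq_phi f : jpoly_dq (jpoly_phi f) = p%:R * jpoly_phi (jpoly_dq f).
Proof.
have dqP := jpoly_dq_der.
unshelve eapply (@jr_ind A P
  (@Subring P (fun f => jpoly_dq (jpoly_phi f) = p%:R * jpoly_phi (jpoly_dq f)) _ _ _)) => /=.
- by rewrite rmorph1 (der1 dqP) rmorph0 mulr0.
- by move=> x y ex ey; rewrite rmorphB !(derB dqP) ex ey rmorphB mulrBr.
- by move=> x y ex ey; rewrite rmorphM !(proj2 dqP) ex ey rmorphD !rmorphM /=; ring.
- by move=> a; rewrite jpoly_phiC !jpoly_dqC rdq_rfrob // jpoly_phiC rmorphM rmorph_nat.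
- move=> i j; rewrite jpoly_phiX (proj1 dqP) (derX dqP) (proj2 dqP) (der_nat dqP) !jpoly_dqX.
  by rewrite jpoly_dS /=; ring.
Qed.

Definition jpoly_dpq : dpq_ring p P :=
  lift_dpq pr_p (fun x => @jpoly_reg p x (prime_gt0 pr_p)) jpoly_phi_lift
    jpoly_dq_der jpoly_dq_phi.

Lemma jpoly_rfrob f : rfrob jpoly_dpq f = jpoly_phi f.
Proof. exact: lift_frob. Qed.

Lemma jpoly_dpC a : rdp jpoly_dpq (C a) = C (rdp D a).
Proof.
apply: (@mulp_inj p P (fun x => @jpoly_reg p x (prime_gt0 pr_p))).
apply: (addrI (C a ^+ p)); rewrite -[LHS]/(rfrob jpoly_dpq (C a)) jpoly_rfrob jpoly_phiC.
by rewrite rmorphD rmorphM rmorphXn rmorph_nat.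
Qed.

Lemma jpoly_dpX i j : rdp jpoly_dpq (X i j) = X i.+1 j.
Proof.
apply: (@mulp_inj p P (fun x => @jpoly_reg p x (prime_gt0 pr_p))).
by apply: (addrI (X i j ^+ p)); rewrite -[LHS]/(rfrob jpoly_dpq _) jpoly_rfrob jpoly_phiX.
Qed.

(* The subring of polynomials in the X i j with [i + j <= n]. *)
Inductive jpoly_le (n : nat) : P -> Prop :=
| JpolyC a : jpoly_le n (C a)
| JpolyX i j : (i + j <= n)%N -> jpoly_le n (X i j)
| JpolyB f g : jpoly_le n f -> jpoly_le n g -> jpoly_le n (f - g)
| JpolyM f g : jpoly_le n f -> jpoly_le n g -> jpoly_le n (f * g).

Lemma jpoly_le1 n : jpoly_le n 1.
Proof. by rewrite -(rmorph1 C); apply: JpolyC. Qed.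

Definition jpoly_sub n : subring P := Subring (jpoly_le1 n) (@JpolyB n) (@JpolyM n).

Lemma jpoly_sub_emb n f : jpoly_sub n f -> jpoly_sub n.+1 f.
Proof.
elim=> {f} [a|i j ij|f g _ Pf _ Pg|f g _ Pf _ Pg]; first exact: JpolyC.
- by apply: JpolyX; apply: leqW.
- exact: JpolyB.
- exact: JpolyM.
Qed.

Lemma sr_in_Cp (R : comPzRingType) (V : subring R) x y : V x -> V y -> V (Cp p x y).
Proof.
move=> Vx Vy; apply/sr_inN/sr_in_sum => i _.
by apply: sr_inM; [apply: sr_in_nat|apply: sr_inM; apply: sr_inX].
Qed.

Lemma jpoly_sub_dp n f : jpoly_sub n f -> jpoly_sub n.+1 (rdp jpoly_dpq f).
Proof.
have [_ dpD dpM] := rdp_pder jpoly_dpq.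
elim=> {f} [a|i j ij|f g Pf Vf Pg Vg|f g Pf Vf Pg Vg].
- by rewrite jpoly_dpC; apply: JpolyC.
- by rewrite jpoly_dpX; apply: JpolyX.
- have -> : rdp jpoly_dpq (f - g) = rdp jpoly_dpq f - rdp jpoly_dpq g - Cp p (f - g) g.
    by have := dpD (f - g) g; rewrite subrK /= => ->; ring.
  apply: sr_inB; first exact: sr_inB.
  by apply: sr_in_Cp; [apply: sr_inB|]; apply: jpoly_sub_emb.
- rewrite dpM; apply: sr_inD; first apply: sr_inD; apply: sr_inM => //.
  + exact/sr_inX/jpoly_sub_emb.
  + exact/sr_inX/jpoly_sub_emb.
  + exact: sr_in_nat.
  + exact: sr_inM.
Qed.

Lemma jpoly_sub_phi n f : jpoly_sub n f -> jpoly_sub n.+1 (jpoly_phi f).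
Proof.
move=> Pf; rewrite -jpoly_rfrob; apply: sr_inD; first exact/sr_inX/jpoly_sub_emb.
by apply: sr_inM; [apply: sr_in_nat|apply: jpoly_sub_dp].
Qed.

Lemma jpoly_sub_d i j : jpoly_sub (i + j).+1 (jpoly_d i j).
Proof.
elim: i => [|i IHi]; first by apply: JpolyX; rewrite add0n.
rewrite jpoly_dS; apply: sr_inB; first exact: jpoly_sub_phi.
apply: sr_inM; last exact: jpoly_sub_emb.
by apply: sr_inX; apply: JpolyX; rewrite addSn !leqW.
Qed.

Lemma jpoly_sub_le m n f : (m <= n)%N -> jpoly_sub m f -> jpoly_sub n f.
Proof.
by move=> /subnK <-; elim: (n - m)%N => // k IHk Pf; rewrite addSn; apply/jpoly_sub_emb/IHk.
Qed.

Lemma jpoly_sub_dq n f : jpoly_sub n f -> jpoly_sub n.+1 (rdq jpoly_dpq f).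
Proof.
have dqP := jpoly_dq_der.
rewrite [rdq _]/=; elim=> {f} [a|i j ij|f g Pf Vf Pg Vg|f g Pf Vf Pg Vg].
- by rewrite jpoly_dqC; apply: JpolyC.
- by rewrite jpoly_dqX; apply: jpoly_sub_le (jpoly_sub_d i j).
- by rewrite (derB dqP); apply: sr_inB.
- by rewrite (proj2 dqP); apply: sr_inD; apply: sr_inM => //; apply: jpoly_sub_emb.
Qed.

End JetPolynomialOperators.

(** * Power series *)

Definition pser (R : comNzRingType) := nat -> R.

Section PowerSeries.

Variable R : comNzRingType.
Local Notation T := (pser R).
Implicit Types f g h : T.

Lemma pserP f g : (forall n, f n = g n) -> f = g. Proof. exact: funext. Qed.

HB.instance Definition _ := gen_eqMixin T.
HB.instance Definition _ := gen_choiceMixin T.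

Definition ps_add f g : T := fun n => f n + g n.
Definition ps_opp f : T := fun n => - f n.
Definition ps_mono (k : nat) (a : R) : T := fun n => if n == k then a else 0.
Definition ps_mul f g : T := fun n => \sum_(i < n.+1) f i * g (n - i)%N.

Lemma ps_addA : associative ps_add.
Proof. by move=> f g h; apply: pserP => n; apply: addrA. Qed.
Lemma ps_addC : commutative ps_add.
Proof. by move=> f g; apply: pserP => n; apply: addrC. Qed.
Lemma ps_add0 : left_id (fun=> 0 : R) ps_add.
Proof. by move=> f; apply: pserP => n; apply: add0r. Qed.
Lemma ps_addN : left_inverse (fun=> 0 : R) ps_opp ps_add.
Proof. by move=> f; apply: pserP => n; apply: addNr. Qed.
HB.instance Definition _ := GRing.isZmodule.Build T ps_addA ps_addC ps_add0 ps_addN.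

(** Coefficient n of a product depends only on truncations at any N >= n. This transfers
    associativity, multiplicativity of phi and the Frobenius congruence from polynomials. *)
Definition ps_trunc N f : {poly R} := \poly_(i < N.+1) f i.

Lemma coef_trunc N f i : (i <= N)%N -> (ps_trunc N f)`_i = f i.
Proof. by move=> iN; rewrite coef_poly ltnS iN. Qed.

Lemma coefM_congr (P P' Q Q' : {poly R}) n : (forall i, (i <= n)%N -> P`_i = P'`_i) ->
  (forall i, (i <= n)%N -> Q`_i = Q'`_i) -> (P * Q)`_n = (P' * Q')`_n.
Proof.
move=> PP QQ; rewrite !coefM; apply: eq_bigr => i _.
by rewrite PP ?QQ ?leq_subr // -ltnS.
Qed.

Lemma ps_mulE f g N n : (n <= N)%N -> ps_mul f g n = (ps_trunc N f * ps_trunc N g)`_n.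
Proof.
move=> nN; rewrite coefM; apply: eq_bigr => i _; rewrite !coef_trunc //.
  exact: leq_trans (leq_subr _ _) nN.
by apply: leq_trans nN; rewrite -ltnS.
Qed.

Lemma ps_mulA : associative ps_mul.
Proof.
move=> f g h; apply: pserP => n; rewrite !(ps_mulE _ _ (leqnn n)).
have tM (f' g' : T) i : (i <= n)%N ->
    (ps_trunc n (ps_mul f' g'))`_i = (ps_trunc n f' * ps_trunc n g')`_i.
  by move=> ni; rewrite coef_trunc // (ps_mulE _ _ ni).
transitivity ((ps_trunc n f * (ps_trunc n g * ps_trunc n h))`_n).
  by apply: coefM_congr => // i ni; apply: tM.
by rewrite mulrA; apply/esym; apply: coefM_congr => // i ni; apply: tM.
Qed.

Lemma ps_mulC : commutative ps_mul.
Proof. by move=> f g; apply: pserP => n; rewrite !(ps_mulE _ _ (leqnn n)) mulrC. Qed.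

Lemma ps_monoM k a f n : ps_mul (ps_mono k a) f n = if (k <= n)%N then a * f (n - k)%N else 0.
Proof.
rewrite /ps_mul; case: leqP => [kn|nk].
  rewrite (bigD1 (Ordinal (kn : (k < n.+1)%N))) //= /ps_mono eqxx big1 ?addr0 // => i.
  by rewrite -val_eqE /= => /negPf ->; rewrite mul0r.
rewrite big1 // => i _; rewrite /ps_mono ifN ?mul0r // neq_ltn.
by rewrite (leq_trans (ltn_ord i)).
Qed.

Lemma ps_mul1 : left_id (ps_mono 0 1) ps_mul.
Proof. by move=> f; apply: pserP => n; rewrite ps_monoM subn0 mul1r. Qed.

Lemma ps_mulDl : left_distributive ps_mul ps_add.
Proof.
move=> f g h; apply: pserP => n; rewrite /ps_mul /ps_add -big_split.
by apply: eq_bigr => i _; rewrite mulrDl.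
Qed.

HB.instance Definition _ :=
  GRing.Zmodule_isComPzRing.Build T ps_mulA ps_mulC ps_mul1 ps_mulDl.

Lemma psB f g n : (f - g) n = f n - g n. Proof. by []. Qed.
Lemma psD f g n : (f + g) n = f n + g n. Proof. by []. Qed.
Lemma psM f g n : (f * g) n = \sum_(i < n.+1) f i * g (n - i)%N. Proof. by []. Qed.
Lemma psME f g N n : (n <= N)%N -> (f * g) n = (ps_trunc N f * ps_trunc N g)`_n.
Proof. exact: ps_mulE. Qed.
Lemma ps1 n : (1 : T) n = (n == 0)%:R.
Proof. by rewrite -[LHS]/(ps_mono 0 1 n) /ps_mono; case: eqP. Qed.

Lemma ps_sum (I : Type) (r : seq I) (P : pred I) (F : I -> T) n :
  (\sum_(i <- r | P i) F i) n = \sum_(i <- r | P i) F i n.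
Proof. by elim/big_rec2: _ => // i x y _ <-. Qed.

Lemma psXE f k N n : (n <= N)%N -> (f ^+ k) n = (ps_trunc N f ^+ k)`_n.
Proof.
elim: k n => [|k IHk] n nN; first by rewrite !expr0 ps1 coef1.
rewrite !exprS (psME _ _ nN); apply: coefM_congr => // i ni.
by rewrite coef_trunc ?IHk //; apply: leq_trans nN.
Qed.

Lemma ps_mono_mono k a l b : ps_mono k a * ps_mono l b = ps_mono (k + l) (a * b).
Proof.
apply: pserP => n; rewrite [LHS]ps_monoM /ps_mono.
case: leqP => [kn|nk]; last by case: eqP => // nkl; move: nk; rewrite nkl ltnNge leq_addr.
by rewrite -(eqn_add2l k) subnKC //; case: eqP => //; rewrite mulr0.
Qed.

Lemma ps_monoX k a n : ps_mono k a ^+ n = ps_mono (k * n) (a ^+ n).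
Proof.
elim: n => [|n IHn]; first by rewrite muln0 !expr0.
by rewrite !exprS IHn ps_mono_mono mulnS.
Qed.

Lemma ps_monoB k a b : ps_mono k a - ps_mono k b = ps_mono k (a - b).
Proof. by apply: pserP => n; rewrite psB /ps_mono; case: eqP; rewrite ?subrr. Qed.

Lemma ps_monoD k a b : ps_mono k a + ps_mono k b = ps_mono k (a + b).
Proof. by apply: pserP => n; rewrite psD /ps_mono; case: eqP; rewrite ?addr0. Qed.

Definition ps_const (a : R) : T := ps_mono 0 a.
Lemma ps_const_zmod : zmod_morphism ps_const.
Proof. by move=> a b; rewrite /ps_const ps_monoB. Qed.
Lemma ps_const_monoid : monoid_morphism ps_const.
Proof. by split=> // a b; rewrite /ps_const ps_mono_mono. Qed.
HB.instance Definition _ := GRing.isZmodMorphism.Build R T ps_const ps_const_zmod.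
HB.instance Definition _ := GRing.isMonoidMorphism.Build R T ps_const ps_const_monoid.

Lemma ps_natM m f n : (m%:R * f) n = m%:R * f n.
Proof. by rewrite -(rmorph_nat ps_const) [LHS]ps_monoM subn0. Qed.

Lemma ps_natXM m k f n : (m%:R ^+ k * f) n = m%:R ^+ k * f n.
Proof. by rewrite -!natrX ps_natM. Qed.

Lemma ps_mono_natM m k a : m%:R * ps_mono k a = ps_mono k (m%:R * a).
Proof. by apply: pserP => n; rewrite ps_natM /ps_mono; case: eqP; rewrite ?mulr0. Qed.

Lemma ps_pmul p k f : pmul p k f <-> forall n, pmul p k (f n).
Proof.
split=> [[g ->] n|/boolp.choice[g fg]]; first by rewrite ps_natXM; exists (g n).
by exists g; apply: pserP => n; rewrite ps_natXM.
Qed.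

Definition ps_of_poly (P : {poly R}) : T := fun n => P`_n.
Lemma ps_of_poly_zmod : zmod_morphism ps_of_poly.
Proof. by move=> P Q; apply: pserP => n; rewrite psB /ps_of_poly coefB. Qed.
Lemma ps_of_poly_monoid : monoid_morphism ps_of_poly.
Proof.
split=> [|P Q]; apply: pserP => n; first by rewrite ps1 /ps_of_poly coef1.
by rewrite psM /ps_of_poly coefM.
Qed.
HB.instance Definition _ := GRing.isZmodMorphism.Build {poly R} T ps_of_poly ps_of_poly_zmod.
HB.instance Definition _ := GRing.isMonoidMorphism.Build {poly R} T ps_of_poly ps_of_poly_monoid.

Lemma ps_geom a : (1 + ps_mono 1 a) * (fun n => (- a) ^+ n : R) = 1.
Proof.
apply: pserP => n; rewrite mulrDl mul1r psD [X in _ + X]ps_monoM ps1.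
by case: n => [|n]; rewrite ?expr0 ?addr0 //= subn1 /= exprS mulNr addNr.
Qed.

Definition ps_coef0 (f : T) : R := f 0.
Lemma ps_coef0_zmod : zmod_morphism ps_coef0. Proof. by []. Qed.
Lemma ps_coef0_monoid : monoid_morphism ps_coef0.
Proof. by split=> // f g; rewrite /ps_coef0 psM big_ord_recl big_ord0 addr0. Qed.
HB.instance Definition _ := GRing.isZmodMorphism.Build T R ps_coef0 ps_coef0_zmod.
HB.instance Definition _ := GRing.isMonoidMorphism.Build T R ps_coef0 ps_coef0_monoid.

End PowerSeries.

(** * The operators phi, dq and t d/dt on power series *)

Section PowerSeriesOperators.

Variables (p : nat) (pr_p : prime p) (R : comNzRingType).
Hypothesis R_reg : forall x : R, p%:R * x = 0 -> x = 0.
Variables (phi : {rmorphism R -> R}) (dq : R -> R).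
Hypothesis phi_lift : forall x, pmul p 1 (phi x - x ^+ p).
Hypothesis dqP : is_der idfun dq.
Hypothesis dq_phi : forall x, dq (phi x) = p%:R * phi (dq x).
Local Notation T := (pser R).

(* The extension of phi with phi t = t^p. *)
Definition ps_phi (f : T) : T := fun n => if (p %| n)%N then phi (f (n %/ p)%N) else 0.

Let Phi (P : {poly R}) : {poly R} := (map_poly phi P) \Po 'X^p.

Let PhiE (P : {poly R}) n : (Phi P)`_n = if (p %| n)%N then phi P`_(n %/ p) else 0.
Proof. by rewrite /Phi coef_comp_poly_Xn ?prime_gt0 // coef_map. Qed.

Let ps_phiE (f : T) N n : (n <= N)%N -> ps_phi f n = (Phi (ps_trunc N f))`_n.
Proof.
by move=> nN; rewrite PhiE /ps_phi coef_trunc //; apply: leq_trans nN; apply: leq_div.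
Qed.

Lemma ps_phi_zmod : zmod_morphism ps_phi.
Proof.
by move=> f g; apply: pserP => n; rewrite psB /ps_phi; case: ifP; rewrite ?subrr // rmorphB.
Qed.

Lemma ps_phi_monoid : monoid_morphism ps_phi.
Proof.
have p0 := prime_gt0 pr_p.
split=> [|f g]; apply: pserP => n.
  rewrite /ps_phi !ps1; case: ifP => [/dvdnP[k ->]|pn].
    by rewrite mulnK // muln_eq0 [(p == 0)%N]eqn0Ngt p0 orbF rmorph_nat.
  by case: n pn => //; rewrite dvdn0.
rewrite /ps_phi (psME _ _ (leqnn n)).
have -> : (ps_trunc n (ps_phi f) * ps_trunc n (ps_phi g))`_n =
    (Phi (ps_trunc n f) * Phi (ps_trunc n g))`_n.
  by apply: coefM_congr => i ni; rewrite coef_trunc // (ps_phiE _ ni).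
rewrite /Phi -comp_polyM -rmorphM -/(Phi _) PhiE.
by case: ifP => // _; rewrite (psME f g (leq_div n p)).
Qed.

HB.instance Definition _ := GRing.isZmodMorphism.Build T T ps_phi ps_phi_zmod.
HB.instance Definition _ := GRing.isMonoidMorphism.Build T T ps_phi ps_phi_monoid.

Lemma ps_phi_mono k a : ps_phi (ps_mono k a) = ps_mono (k * p) (phi a).
Proof.
have p0 := prime_gt0 pr_p.
apply: pserP => n; rewrite /ps_phi /ps_mono; case: ifP => [/dvdnP[m ->]|pn].
  by rewrite mulnK // eqn_pmul2r //; case: eqP; rewrite ?rmorph0.
by case: eqP pn => // ->; rewrite dvdn_mull.
Qed.

Lemma ps_phi_lift f : pmul p 1 (ps_phi f - f ^+ p).
Proof.
pose PhiR : {rmorphism {poly R} -> {poly R}} := comp_poly 'X^p \o map_poly phi.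
have [V VE] := frob_lift_subring pr_p PhiR.
have PhiV P : pmul p 1 (PhiR P - P ^+ p).
  apply/VE; elim/poly_ind: P => [|P c VP]; first exact: sr_in0.
  have Vc : V c%:P.
    apply/VE; rewrite /= map_polyC comp_polyC -rmorphXn -rmorphB.
    exact: (pmul_rmorph (@polyC R) (phi_lift c)).
  apply: sr_inD Vc; apply: sr_inM VP _; apply/VE.
  by rewrite /= map_polyX comp_polyX subrr; apply: pmulz.
apply/ps_pmul => n; rewrite psB (ps_phiE _ (leqnn n)) (psXE _ _ (leqnn n)) -coefB.
have [Q ->] := PhiV (ps_trunc n f); exists Q`_n.
by rewrite expr1 expr1 mulr_natl coefMn mulr_natl.
Qed.

Definition ps_dqR (f : T) : T := fun n => dq (f n).

Lemma ps_dqR_der : is_der idfun ps_dqR.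
Proof.
have [dqD dqM] := dqP.
split=> f g; apply: pserP => n; first exact: dqD.
rewrite psD !psM /ps_dqR (big_morph dq dqD (der0 dqP)).
rewrite [X in _ + X](reindex_inj rev_ord_inj) /= -big_split; apply: eq_bigr => i _ /=.
rewrite dqM; congr (_ + _ * _).
by rewrite subSS subKn // -ltnS.
Qed.

Lemma ps_dqR_phi f : ps_dqR (ps_phi f) = p%:R * ps_phi (ps_dqR f).
Proof.
apply: pserP => n; rewrite ps_natM /ps_phi /ps_dqR; case: ifP => _; first exact: dq_phi.
by rewrite (der0 dqP) mulr0.
Qed.

Lemma ps_reg m (f : T) : (forall x : R, m%:R * x = 0 -> x = 0) -> m%:R * f = 0 -> f = 0.
Proof.
by move=> mreg mf; apply: pserP => n; apply: mreg; rewrite -ps_natM mf.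
Qed.

Definition ps_dpq : dpq_ring p T :=
  lift_dpq pr_p (fun f => @ps_reg p f R_reg) ps_phi_lift ps_dqR_der ps_dqR_phi.

Lemma ps_rfrob f : rfrob ps_dpq f = ps_phi f.
Proof. exact: lift_frob. Qed.

(* t d/dt *)
Definition ps_E (f : T) : T := fun n => n%:R * f n.

Lemma ps_E_der : is_der idfun ps_E.
Proof.
split=> f g; apply: pserP => n; first by rewrite /ps_E !psD mulrDr.
rewrite psD !psM /ps_E mulr_sumr.
rewrite [X in _ + X](reindex_inj rev_ord_inj) /= -big_split; apply: eq_bigr => i _ /=.
rewrite subSS subKn -1?ltnS //.
have {1}-> : n = (i + (n - i))%N by rewrite subnKC // -ltnS.
by rewrite natrD; ring.
Qed.

(** As phi t = t^p multiplies degrees by p. This is the relation that makes g + eps E g compatible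
    with phi when phi eps = p eps. *)
Lemma ps_E_phi f : ps_E (ps_phi f) = p%:R * ps_phi (ps_E f).
Proof.
apply: pserP => n; rewrite ps_natM /ps_phi /ps_E; case: ifP => [pn|_]; last by rewrite !mulr0.
by rewrite rmorphM rmorph_nat mulrA -natrM mulnC divnK.
Qed.

Lemma ps_E_dq f : ps_E (ps_dqR f) = ps_dqR (ps_E f).
Proof.
apply: pserP => n; rewrite /ps_E /ps_dqR (proj2 dqP) (der_nat dqP) mulr0 addr0.
by [].
Qed.

End PowerSeriesOperators.

(** * Products of prolongation sequences *)

Section ProductSequence.

Variables (p : nat) (S T : pro_seq p).

Definition prod_map (R R' Q Q' : comPzRingType) (f : R -> R') (g : Q -> Q')
  (x : (R * Q)%type) : (R' * Q')%type := (f x.1, g x.2).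

Section ProdMap.
Variables (R R' Q Q' : comPzRingType) (f : {rmorphism R -> R'}) (g : {rmorphism Q -> Q'}).
Lemma prod_map_zmod : zmod_morphism (prod_map f g).
Proof. by move=> x y; rewrite /prod_map /= !rmorphB. Qed.
Lemma prod_map_monoid : monoid_morphism (prod_map f g).
Proof. by split=> [|x y]; rewrite /prod_map /= ?rmorph1 // !rmorphM. Qed.
HB.instance Definition _ :=
  GRing.isZmodMorphism.Build _ _ (prod_map f g) prod_map_zmod.
HB.instance Definition _ :=
  GRing.isMonoidMorphism.Build _ _ (prod_map f g) prod_map_monoid.
End ProdMap.

Lemma pairE (R Q : Type) (x y : R * Q) : x.1 = y.1 -> x.2 = y.2 -> x = y.
Proof. by case: x y => [a b] [c d] /= -> ->. Qed.

Let R n : comPzRingType := (S n * T n)%type.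
Definition prod_emb n : {rmorphism R n -> R n.+1} := prod_map (ps_emb S n) (ps_emb T n).
Definition prod_dp n : R n -> R n.+1 := prod_map (ps_dp S n) (ps_dp T n).
Definition prod_dq n : R n -> R n.+1 := prod_map (ps_dq S n) (ps_dq T n).

Lemma prod_pder n : is_pder p (prod_emb n) (@prod_dp n).
Proof.
have [dp1 dpD dpM] := ps_pder S n; have [dp1' dpD' dpM'] := ps_pder T n.
split=> [|x y|x y]; apply: pairE.
- exact: dp1.
- exact: dp1'.
- by rewrite -[RHS]/(fst _) !rmorphD rmorph_Cp; apply: dpD.
- by rewrite -[RHS]/(snd _) !rmorphD rmorph_Cp; apply: dpD'.
- by rewrite -[RHS]/(fst _) !(rmorphD, rmorphM, rmorphXn, rmorph_nat); apply: dpM.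
- by rewrite -[RHS]/(snd _) !(rmorphD, rmorphM, rmorphXn, rmorph_nat); apply: dpM'.
Qed.

Lemma prod_dpder n : is_dpder p (prod_emb n) (prod_emb n.+1)
  (@prod_dp n) (@prod_dp n.+1) (@prod_dq n) (@prod_dq n.+1).
Proof.
have [[dqD dqM] dqdp] := ps_dpder S n; have [[dqD' dqM'] dqdp'] := ps_dpder T n.
split=> [|x]; first split=> x y; apply: pairE.
- exact: dqD.
- exact: dqD'.
- exact: dqM.
- exact: dqM'.
- by rewrite -[RHS]/(fst _) !(rmorphB, rmorphD, rmorphM, rmorphXn, rmorph_nat); apply: dqdp.
- by rewrite -[RHS]/(snd _) !(rmorphB, rmorphD, rmorphM, rmorphXn, rmorph_nat); apply: dqdp'.
Qed.

Definition prod_seq : pro_seq p.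
Proof.
refine (@ProSeq p R prod_emb prod_dp prod_dq prod_pder prod_dpder _ _) => n x; apply: pairE.
- exact: ps_dp_emb.
- exact: ps_dp_emb.
- exact: ps_dq_emb.
- exact: ps_dq_emb.
Defined.

Definition prod_fst : ps_hom prod_seq S :=
  @PsHom p prod_seq S (fun n => @fst (S n) (T n)) (fun _ _ => erefl)
    (fun _ _ => erefl) (fun _ _ => erefl).
Definition prod_snd : ps_hom prod_seq T :=
  @PsHom p prod_seq T (fun n => @snd (S n) (T n)) (fun _ _ => erefl)
    (fun _ _ => erefl) (fun _ _ => erefl).

Variables (Q : pro_seq p) (f : ps_hom Q S) (g : ps_hom Q T).

Definition pair_map (Q0 R0 R1 : comPzRingType) (f0 : Q0 -> R0) (g0 : Q0 -> R1) x := (f0 x, g0 x).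

Section PairMap.
Variables (Q0 R0 R1 : comPzRingType) (f0 : {rmorphism Q0 -> R0}) (g0 : {rmorphism Q0 -> R1}).
Lemma pair_map_zmod : zmod_morphism (pair_map f0 g0).
Proof. by move=> x y; rewrite /pair_map !rmorphB. Qed.
Lemma pair_map_monoid : monoid_morphism (pair_map f0 g0).
Proof. by split=> [|x y]; rewrite /pair_map ?rmorph1 ?rmorphM. Qed.
HB.instance Definition _ :=
  GRing.isZmodMorphism.Build _ _ (pair_map f0 g0) pair_map_zmod.
HB.instance Definition _ :=
  GRing.isMonoidMorphism.Build _ _ (pair_map f0 g0) pair_map_monoid.
End PairMap.

Definition prod_pair : ps_hom Q prod_seq.
Proof.
refine (@PsHom p Q prod_seq (fun n => pair_map (f n) (g n)) _ _ _) => n x; apply: pairE.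
- exact: ps_map_emb.
- exact: ps_map_emb.
- exact: ps_map_dp.
- exact: ps_map_dp.
- exact: ps_map_dq.
- exact: ps_map_dq.
Defined.

End ProductSequence.

(** * Evaluation of jet polynomials at a point of a prolongation sequence *)

Section JetEvaluation.

Variables (p : nat) (pr_p : prime p) (A : idomainType) (D : dpq_ring p A).
Hypothesis A_char0 : [pchar A] =i pred0.
Variable P : jet_ring A.
Local Notation C := (jrC P).
Local Notation X := (jrX P).
Local Notation DP := (jpoly_dpq pr_p D A_char0 P).
Local Notation Pn := (@jpoly_sub A P).

Variables (S : pro_seq p) (str : ps_hom (const_seq D) S) (a : S 0).

(* dp^i dq^j a for [i + j <= n], with the same convention as [jet_coord]. *)
Fixpoint pol_coord n : nat -> nat -> S n :=
  match n with
  | 0 => fun i j => if (i == 0)%N && (j == 0)%N then a else 0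
  | n'.+1 => fun i j => match i, j with
      | i'.+1, _ => ps_dp S n' (pol_coord n' i' j)
      | 0, j'.+1 => ps_dq S n' (pol_coord n' 0 j')
      | 0, 0 => ps_emb S n' (pol_coord n' 0 0)
      end
  end.

Arguments pol_coord : simpl never.

Lemma pol_coordP n i j : pol_coord n.+1 i.+1 j = ps_dp S n (pol_coord n i j).
Proof. by []. Qed.

Lemma pol_coordQ n j : pol_coord n.+1 0 j.+1 = ps_dq S n (pol_coord n 0 j).
Proof. by []. Qed.

Lemma pol_coord_emb n i j : (i + j <= n)%N ->
  pol_coord n.+1 i j = ps_emb S n (pol_coord n i j).
Proof.
elim: n i j => [|n IHn] [|i] [|j] // ij.
- by rewrite !pol_coordQ -ps_dq_emb IHn.
- by rewrite !pol_coordP -ps_dp_emb -IHn.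
- by rewrite !pol_coordP -ps_dp_emb -IHn.
Qed.

Definition jet_ev n : {rmorphism P -> S n} := jpoly_eval P (str n) (pol_coord n).

Lemma jet_evC n c : jet_ev n (C c) = str n c. Proof. exact: jpoly_evalC. Qed.
Lemma jet_evX n i j : jet_ev n (X i j) = pol_coord n i j. Proof. exact: jpoly_evalX. Qed.

Lemma jet_ev_emb n f : Pn n f -> jet_ev n.+1 f = ps_emb S n (jet_ev n f).
Proof.
elim=> {f} [c|i j ij|f g _ Pf _ Pg|f g _ Pf _ Pg].
- by rewrite !jet_evC -ps_map_emb.
- by rewrite !jet_evX pol_coord_emb.
- by rewrite !rmorphB Pf Pg.
- by rewrite !rmorphM Pf Pg.
Qed.

(** Since S may have p-torsion, this does not follow from the compatibility with phi; the identities
    of dp are followed through the construction of f instead, and phi comes afterwards. *)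
Lemma jet_ev_dp n f : Pn n f -> jet_ev n.+1 (rdp DP f) = ps_dp S n (jet_ev n f).
Proof.
have [_ dpD dpM] := ps_pder S n; have [_ DpD DpM] := rdp_pder DP.
elim=> {f} [c|i j ij|f g Pf Vf Pg Vg|f g Pf Vf Pg Vg].
- by rewrite jpoly_dpC !jet_evC -ps_map_dp.
- by rewrite jpoly_dpX !jet_evX.
- have Pfg : Pn n (f - g) by apply: JpolyB.
  have e1 : rdp DP (f - g) = rdp DP f - rdp DP g - Cp p (f - g) g.
    by have := DpD (f - g) g; rewrite subrK /= => ->; ring.
  have e2 := dpD (jet_ev n (f - g)) (jet_ev n g).
  rewrite -rmorphD subrK in e2; move: (f - g) Pfg e1 e2 => k Pk -> e2.
  by rewrite !rmorphB rmorph_Cp Vf Vg e2 -!jet_ev_emb //; ring.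
- rewrite DpM rmorphM dpM -Vf -Vg !(rmorphD, rmorphM, rmorphXn, rmorph_nat).
  by rewrite -!jet_ev_emb.
Qed.

Lemma jet_ev_phi n f : Pn n f ->
  jet_ev n.+1 (jpoly_phi pr_p D P f) = ps_frob S n (jet_ev n f).
Proof.
move=> Pf; rewrite -(jpoly_rfrob pr_p D A_char0) /ps_frob /rfrob /frob.
by rewrite rmorphD rmorphM rmorphXn rmorph_nat jet_ev_dp // jet_ev_emb.
Qed.

Lemma jet_ev_d n i j : (i + j <= n)%N ->
  jet_ev n.+1 (jpoly_d pr_p D P i j) = ps_dq S n (pol_coord n i j).
Proof.
elim: i n => [|i IHi] n ij; first by rewrite jpoly_d0 jet_evX.
case: n ij => // n ij; have [_ ->] := ps_dpder S n.
have Pd : Pn n.+1 (jpoly_d pr_p D P i j) by apply: jpoly_sub_le (jpoly_sub_d _ D A_char0 _ i j).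
rewrite jpoly_dS rmorphB rmorphM rmorphXn jet_ev_phi // IHi // jet_evX.
rewrite !pol_coord_emb //; last exact: leqW.
by rewrite (jet_ev_emb Pd) IHi // /ps_frob /frob; ring.
Qed.

Lemma jet_ev_dq n f : Pn n f -> jet_ev n.+1 (rdq DP f) = ps_dq S n (jet_ev n f).
Proof.
have [dqP _] := ps_dpder S n; have DqP := jpoly_dq_der pr_p D P.
rewrite [rdq _]/=; elim=> {f} [c|i j ij|f g Pf Vf Pg Vg|f g Pf Vf Pg Vg].
- by rewrite jpoly_dqC !jet_evC -ps_map_dq.
- by rewrite jpoly_dqX jet_ev_d // jet_evX.
- by rewrite (derB DqP) !rmorphB (derB dqP) Vf Vg.
- rewrite (proj2 DqP) rmorphD !rmorphM (proj2 dqP) -Vf -Vg.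
  by rewrite -!jet_ev_emb.
Qed.

End JetEvaluation.

(** * Finite spans of monomials, and series graded by them *)

Section MonomialSpans.

Variables (A : idomainType) (P : jet_ring A).
Local Notation C := (jrC P).
Local Notation X := (jrX P).
Implicit Types (f g : P) (L : seq (jr_key P)).

Lemma jr_coef0 k : jr_coef k (0 : P) = 0.
Proof. by rewrite -(subrr 0) jr_coefB subrr. Qed.

Lemma jr_coefD k f g : jr_coef k (f + g) = jr_coef k f + jr_coef k g.
Proof. by rewrite -{1}[g]opprK -[- g]sub0r !jr_coefB jr_coef0; ring. Qed.

Lemma jr_coef_sum k (I : Type) (r : seq I) (Q : pred I) (F : I -> P) :
  jr_coef k (\sum_(i <- r | Q i) F i) = \sum_(i <- r | Q i) jr_coef k (F i).
Proof. exact: (big_morph _ (jr_coefD k) (jr_coef0 k)). Qed.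

Lemma jr_coef_natXM k m q f : jr_coef k (m%:R ^+ q * f) = m%:R ^+ q * jr_coef k f.
Proof. by rewrite -(rmorph_nat C) -rmorphXn jr_coefZ. Qed.

Lemma jr_coef_pmul p q k f : pmul p q f -> pmul p q (jr_coef k f).
Proof. by move=> [g ->]; rewrite jr_coef_natXM; apply: pmul_mul. Qed.

Lemma jr_sep p : padic_complete p A -> forall f, (forall k, pmul p k f) -> f = 0.
Proof.
move=> Ac f fk; apply: jr_coef_inj => k; apply: (padic_sep Ac) => q.
exact: jr_coef_pmul.
Qed.

Definition in_span L f : Prop := forall k, k \notin L -> jr_coef k f = 0.

Lemma in_spanS L L' f : {subset L <= L'} -> in_span L f -> in_span L' f.
Proof. by move=> LL fL k kL; apply: fL; apply: contra kL; apply: LL. Qed.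

Lemma in_spanB L f g : in_span L f -> in_span L g -> in_span L (f - g).
Proof. by move=> fL gL k kL; rewrite jr_coefB fL ?gL ?subrr. Qed.

Lemma in_span0 L : in_span L 0. Proof. by move=> k _; apply: jr_coef0. Qed.

Lemma in_spanZ L a f : in_span L f -> in_span L (C a * f).
Proof. by move=> fL k kL; rewrite jr_coefZ fL ?mulr0. Qed.

Lemma in_span_sum L (I : eqType) (r : seq I) (F : I -> P) :
  (forall i, i \in r -> in_span L (F i)) -> in_span L (\sum_(i <- r) F i).
Proof.
move=> FL k kL; rewrite jr_coef_sum big1_seq // => i /andP[_ ir]; exact: FL.
Qed.

Lemma in_span_mon L k : k \in L -> in_span L (jr_mon k : P).
Proof. by move=> kL l lL; rewrite jr_coef_mon; case: eqP kL lL => // <- ->. Qed.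

Lemma jr_mon_sum (L : seq (jr_key P)) (c : jr_key P -> A) l :
  jr_coef l (\sum_(k <- undup L) C (c k) * jr_mon k) = if l \in L then c l else 0.
Proof.
rewrite jr_coef_sum; under eq_bigr do rewrite jr_coefZ jr_coef_mon.
case: ifPn => [lL|lL].
  rewrite (bigD1_seq l) ?mem_undup ?undup_uniq //= eqxx mulr1 big1 ?addr0 // => k.
  by rewrite eq_sym => /negPf ->; rewrite mulr0.
rewrite big1_seq // => k; rewrite mem_undup => /andP[_ kL].
by case: eqP kL lL => [<- ->|] //; rewrite mulr0.
Qed.

Lemma in_span_expand L f : in_span L f ->
  f = \sum_(k <- undup L) C (jr_coef k f) * jr_mon k.
Proof.
move=> fL; apply/eqP; rewrite -subr_eq0; apply/eqP/jr_coef_inj => l.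
by rewrite jr_coefB jr_mon_sum; case: ifPn => [_|/fL ->]; rewrite subrr.
Qed.

Variable n : nat.

Definition jet_vars : seq (jr_key P) :=
  [seq jr_keyX P i j | i <- iota 0 n.+1, j <- iota 0 n.+1].

(** The monomials of degree at most N in [jet_vars]. As X i j has weight p^i >= 1 in t, this finite
    list contains every monomial that can accompany t^N. *)
Fixpoint jet_level N : seq (jr_key P) :=
  if N is N'.+1 then jet_level N' ++ jet_vars ++
    [seq jr_keyM k v | k <- jet_level N', v <- jet_vars]
  else [:: jr_key1 P].

Lemma jet_levelS N k : k \in jet_level N -> k \in jet_level N.+1.
Proof. by move=> kN; rewrite mem_cat kN. Qed.

Lemma jet_level_le M N : (M <= N)%N -> {subset jet_level M <= jet_level N}.
Proof.
by move=> /subnK <- k kM; elim: (N - M)%N => // d IHd; rewrite addSn; apply: jet_levelS.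
Qed.

Lemma jet_levelX N i j : (i + j <= n)%N -> (0 < N)%N -> jr_keyX P i j \in jet_level N.
Proof.
case: N => // N ij _; rewrite mem_cat [X in _ || X]mem_cat; apply/or3P; apply: Or32.
apply/allpairsPdep; exists i, j.
by split=> //; rewrite mem_iota; lia.
Qed.

Lemma in_span_var N f v : in_span (jet_level N) f -> v \in jet_vars ->
  in_span (jet_level N.+1) (f * jr_mon v).
Proof.
move=> fN vV; rewrite [f](in_span_expand fN) mulr_suml; apply: in_span_sum => k.
rewrite mem_undup => kN; rewrite -mulrA -jr_monM; apply/in_spanZ/in_span_mon.
by rewrite mem_cat [X in _ || X]mem_cat; apply/or3P; apply: Or33; apply/allpairsPdep; exists k, v.
Qed.

Lemma in_spanM M N f g : in_span (jet_level M) f -> in_span (jet_level N) g ->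
  in_span (jet_level (M + N)) (f * g).
Proof.
move=> fM gN; rewrite [g](in_span_expand gN) mulr_sumr; apply: in_span_sum => k.
rewrite mem_undup mulrCA => kN; apply: in_spanZ.
elim: N k kN {g gN} => [|N IHN] k.
  by rewrite inE addn0 => /eqP ->; rewrite jr_mon1 mulr1.
rewrite addnS mem_cat [X in _ || X]mem_cat => /or3P[kN|kV|/allpairsPdep[k' [v [kN vV ->]]]].
- by apply: in_spanS (IHN _ kN) => l; apply: jet_levelS.
- by apply: in_spanS (in_span_var fM kV); apply: jet_level_le; rewrite ltnS leq_addr.
- by rewrite jr_monM mulrA; apply: in_span_var => //; apply: IHN.
Qed.

(** Each coefficient lies in a free A-module of finite rank fixed in advance, where p-adic limits
    exist monomial by monomial. *)
Definition graded (F : pser P) : Prop := forall N, in_span (jet_level N) (F N).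

Lemma graded_mono N f : in_span (jet_level N) f -> graded (ps_mono N f).
Proof. by move=> fN M; rewrite /ps_mono; case: eqP => [->|_] //; apply: in_span0. Qed.

Lemma gradedB F G : graded F -> graded G -> graded (F - G).
Proof. by move=> FN GN N; rewrite psB; apply: in_spanB. Qed.

Lemma gradedM F G : graded F -> graded G -> graded (F * G).
Proof.
move=> FN GN N k kN; rewrite psM jr_coef_sum big1 // => i _.
have := @in_spanM i (N - i) _ _ (FN i) (GN (N - i)%N).
have iN : (i <= N)%N by rewrite -ltnS.
by rewrite subnKC //; apply.
Qed.

End MonomialSpans.

(** * The generic point as a power series in t *)

Section JetSeries.

Variables (p : nat) (pr_p : prime p) (A : idomainType) (D : dpq_ring p A).
Hypothesis A_char0 : [pchar A] =i pred0.
Hypothesis A_complete : padic_complete p A.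
Variable P : jet_ring A.
Local Notation C := (jrC P).
Local Notation X := (jrX P).
Local Notation DP := (jpoly_dpq pr_p D A_char0 P).
Local Notation Pn := (@jpoly_sub A P).
Local Notation phi := (jpoly_phi pr_p D P).
Local Notation dq := (@jpoly_dq p pr_p A D P).

Let P_reg (x : P) : p%:R * x = 0 -> x = 0 := jpoly_reg A_char0 (prime_gt0 pr_p).

Definition series_dpq : dpq_ring p (pser P) :=
  ps_dpq pr_p P_reg (jpoly_phi_lift pr_p D (P := P)) (jpoly_dq_der pr_p D P)
    (@jpoly_dq_phi p pr_p A D P).

Lemma series_rfrob F : rfrob series_dpq F = ps_phi p phi F.
Proof. exact: ps_rfrob. Qed.

Lemma series_reg (x : pser P) : p%:R * x = 0 -> x = 0.
Proof. exact: ps_reg. Qed.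

(* The generic point X = t x of the formal group, where dp t = dq t = 0. *)
Definition series : {rmorphism P -> pser P} :=
  jpoly_eval P (@ps_const P \o C) (fun i j => ps_mono (p ^ i) (X i j)).

Lemma seriesC a : series (C a) = ps_const (C a). Proof. exact: jpoly_evalC. Qed.
Lemma seriesX i j : series (X i j) = ps_mono (p ^ i) (X i j). Proof. exact: jpoly_evalX. Qed.

Lemma series_phi f : series (phi f) = ps_phi p phi (series f).
Proof.
apply: (@jpoly_hom_ext A P (pser P) (series \o phi) (ps_phi p phi \o series)) => [a|i j] /=.
  by rewrite jpoly_phiC !seriesC ps_phi_mono // mul0n jpoly_phiC.
rewrite jpoly_phiX rmorphD rmorphXn rmorphM rmorph_nat !seriesX ps_phi_mono // jpoly_phiX.
by rewrite ps_monoX ps_mono_natM -expnSr ps_monoD.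
Qed.

Lemma series_dp f : series (rdp DP f) = rdp series_dpq (series f).
Proof.
apply: (mulp_inj series_reg); apply: (addrI (series f ^+ p)).
rewrite -[RHS]/(rfrob series_dpq (series f)) series_rfrob -series_phi -(jpoly_rfrob _ _ A_char0).
by rewrite rmorphD rmorphM rmorphXn rmorph_nat.
Qed.

Lemma series_d i j : series (jpoly_d pr_p D P i j) = ps_mono (p ^ i) (jpoly_d pr_p D P i j).
Proof.
elim: i => [|i IHi]; first by rewrite jpoly_d0 seriesX.
rewrite jpoly_dS rmorphB rmorphM rmorphXn series_phi IHi seriesX ps_phi_mono //.
have e : (p ^ i * p.-1 + p ^ i = p ^ i.+1)%N by rewrite -mulnSr prednK ?prime_gt0 // expnSr.
by rewrite ps_monoX ps_mono_mono e -expnSr ps_monoB.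
Qed.

Lemma series_dq f : series (dq f) = ps_dqR dq (series f).
Proof.
have DqP := jpoly_dq_der pr_p D P; have dqP := ps_dqR_der DqP.
unshelve eapply (@jr_ind A P
  (@Subring P (fun f => series (dq f) = ps_dqR dq (series f)) _ _ _)) => /=.
- by rewrite rmorph1 (der1 DqP) rmorph0 (der1 dqP).
- by move=> x y ex ey; rewrite (derB DqP) !rmorphB (derB dqP) ex ey.
- by move=> x y ex ey; rewrite (proj2 DqP) !rmorphM rmorphD !rmorphM (proj2 dqP) ex ey.
- move=> a; rewrite jpoly_dqC !seriesC; apply: pserP => n.
  by rewrite /ps_dqR /ps_const /ps_mono; case: eqP; rewrite ?jpoly_dqC ?(der0 DqP).
- move=> i j; rewrite jpoly_dqX series_d seriesX; apply: pserP => n.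
  by rewrite /ps_dqR /ps_mono; case: eqP; rewrite ?jpoly_dqX ?(der0 DqP).
Qed.

(* At t = 1 the generic point becomes X again. *)
Lemma series_pmul k f : pmul p k (series f) -> pmul p k f.
Proof.
pose J : {rmorphism P -> {poly P}} :=
  jpoly_eval P (@polyC P \o C) (fun i j => X i j *: 'X^(p ^ i)).
have SJ g : series g = ps_of_poly (J g).
  apply: (@jpoly_hom_ext A P (pser P) series (@ps_of_poly P \o J)) => [a|i j] /=.
    rewrite seriesC jpoly_evalC; apply: pserP => n.
    by rewrite /ps_of_poly /= coefC /ps_const /ps_mono.
  rewrite seriesX jpoly_evalX; apply: pserP => n.
  by rewrite /ps_of_poly coefZ coefXn /ps_mono; case: eqP; rewrite ?mulr1 ?mulr0.
have J1 : f = (J f).[1].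
  apply: (@jpoly_hom_ext A P P idfun (horner_eval (1 : P) \o J)) => [a|i j] /=.
    by rewrite jpoly_evalC /horner_eval /= hornerC.
  by rewrite jpoly_evalX /horner_eval hornerZ hornerXn expr1n mulr1.
rewrite SJ => /ps_pmul Jk; rewrite J1 horner_coef; apply: pmul_sum => i _.
by apply: pmulMr; apply: Jk.
Qed.

Lemma series_graded n f : Pn n f -> graded n (series f).
Proof.
elim=> {f} [a|i j ij|f g _ Vf _ Vg|f g _ Vf _ Vg].
- rewrite seriesC; apply: graded_mono; rewrite -[C a]mulr1 -(jr_mon1 P).
  by apply/in_spanZ/in_span_mon; rewrite inE.
- rewrite seriesX; apply: graded_mono; rewrite -jr_monX; apply: in_span_mon.
  by apply: jet_levelX => //; rewrite expn_gt0 prime_gt0.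
- by rewrite rmorphB; apply: gradedB.
- by rewrite rmorphM; apply: gradedM.
Qed.

Definition gen_unit : P := 1 + X 0 0.

Lemma gen_unit_le n : Pn n gen_unit.
Proof. by apply: (@sr_inD _ (Pn n)); [apply: sr_in1|apply: JpolyX]. Qed.

Lemma series_gen_unit : series gen_unit = 1 + ps_mono 1 (X 0 0).
Proof. by rewrite rmorphD rmorph1 seriesX. Qed.

(** At t = 0 the generic unit is 1, and level 0 contains only the monomial 1: so the constant
    coefficient of a denominator is an element of A congruent to 1 modulo p, a unit by
    completeness. *)
Lemma series_unit0 n w : denom p Pn gen_unit n w ->
  exists c c', series w 0%N = C c /\ c * c' = 1.
Proof.
move=> [Pw [a [z wz]]]; have w0 : in_span (jet_level P n 0) (series w 0%N) by apply: series_graded.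
move/in_span_expand: w0 => w0.
rewrite /= big_seq1 jr_mon1 mulr1 in w0.
set c := jr_coef _ _ in w0; exists c.
have one : ps_coef0 (series (gen_unit ^+ a)) = 1.
  rewrite rmorphXn series_gen_unit rmorphXn rmorphD rmorph1.
  by rewrite /ps_coef0 /ps_mono /= addr0 expr1n.
have e : C c = p%:R * ps_coef0 (series z) + 1.
  rewrite -w0 -[series w 0%N]/(ps_coef0 (series w)) -[w](subrK (gen_unit ^+ a)) wz expr1.
  by rewrite 2!rmorphD 2!rmorphM 2!rmorph_nat; congr (_ + _); apply: one.
have := congr1 (jr_coef (jr_key1 P)) e.
have cE b f : jr_coef (jr_key1 P) (C b * f) = b * jr_coef (jr_key1 P) f := jr_coefZ _ _ _.
rewrite jr_coefD -(rmorph_nat C) cE -{1}[C c]mulr1 cE -(jr_mon1 P) jr_coef_mon eqxx mulr1.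
move=> ec; have [c' cc'] := unit_1p A_complete (jr_coef (jr_key1 P) (ps_coef0 (series z))).
by exists c'; split=> //; rewrite ec addrC.
Qed.

(** Modulo p^q, the equation w G = h determines the coefficients of G one after the other, because
    the constant coefficient of w is a unit of A; levels add under products, so each coefficient
    stays in its level modulo p^q. Separatedness of A removes the modulus. *)
Lemma approx_graded (n : nat) (G : pser P) :
  approx Pn gen_unit (B := const_seq series_dpq) (fun=> series) (n := n) G -> graded n G.
Proof.
move=> AG N k kN; apply: (padic_sep A_complete) => q.
have [w [h [dw Ph [z e]]]] := AG q.
have [c [c' [w0 cc']]] := series_unit0 dw; have [Pw _] := dw.
pose NW M f := exists2 g, in_span (jet_level P n M) g & pmul p q (f - g).
have NWG M : NW M (G M).
  elim/ltn_ind: M => M IHM.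
  (* Coefficient M of w G = h + p^q z, solved for the term with the constant coefficient of w; the
     remaining terms contain only earlier coefficients of G. *)
  have eM : C c * G M = series h M + p%:R ^+ q * z M -
      \sum_(i < M) series w i.+1 * G (M - i.+1)%N.
    have := congr1 (fun F : pser P => F M) e; rewrite psB psM big_ord_recl subn0 w0 ps_natXM => <-.
    by rewrite /bump /=; ring.
  have [g gM gG] : NW M (C c * G M).
    rewrite eM; have /boolp.choice[g gP] : forall i : 'I_M, exists g,
        in_span (jet_level P n M) g /\ pmul p q (series w i.+1 * G (M - i.+1)%N - g).
      move=> i; have [|g gM gG] := IHM (M - i.+1)%N; first by case: i => i /= iM; lia.
      exists (series w i.+1 * g); split; last by rewrite -mulrBr; apply: pmulMl.
      rewrite -[X in jet_level P n X](subnKC (ltn_ord i)).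
      by apply: in_spanM => //; apply: series_graded.
    exists (series h M - \sum_(i < M) g i).
      apply: in_spanB; first exact: series_graded.
      move=> l lM; rewrite jr_coef_sum big1 // => i _; exact: (proj1 (gP i)).
    have -> : series h M + p%:R ^+ q * z M - \sum_(i < M) series w i.+1 * G (M - i.+1)%N -
        (series h M - \sum_(i < M) g i) =
        p%:R ^+ q * z M - \sum_(i < M) (series w i.+1 * G (M - i.+1)%N - g i).
      by rewrite sumrB; ring.
    apply: pmulB; first exact: pmul_mul.
    by apply: pmul_sum => i _; apply: (proj2 (gP i)).
  exists (C c' * g); first exact: in_spanZ.
  have -> : G M - C c' * g = C c' * (C c * G M - g).
    by rewrite mulrBr mulrA -rmorphM [c' * c]mulrC cc' rmorph1 mul1r.
  exact: pmulMl.
have [g gN gG] := NWG N; have := jr_coef_pmul k gG.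
by rewrite jr_coefB (gN k kN) subr0.
Qed.

Lemma complete_series (S : comPzRingType) (Sc : padic_complete p S) (s : nat -> S) :
  exists l, forall m, pmul p m (l - \sum_(i < m) p%:R ^+ i * s i).
Proof.
apply: (padic_lim Sc) => m; rewrite big_ord_recr /= addrC addrK.
exact: pmul_mul.
Qed.

(** In degree N all the terms share the finite list [jet_level P n N], so the limit is assembled
    from limits in A, one for each monomial of the list. *)
Lemma approx_lim (n : nat) (s : nat -> pser P) :
  (forall i, approx Pn gen_unit (B := const_seq series_dpq) (fun=> series) (n := n) (s i)) ->
  exists l, forall m, pmul p m (l - \sum_(i < m) p%:R ^+ i * s i).
Proof.
move=> As; have /boolp.choice[l lP] : forall N, exists l, forall m,
    pmul p m (l - \sum_(i < m) p%:R ^+ i * s i N).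
  move=> N; have /boolp.choice[c cP] : forall k, exists c, forall m,
      pmul p m (c - \sum_(i < m) p%:R ^+ i * jr_coef k (s i N)).
    by move=> k; apply: (complete_series A_complete (fun i => jr_coef k (s i N))).
  have sN i : in_span (jet_level P n N) (s i N) by move=> k; apply: (@approx_graded n (s i) (As i)).
  exists (\sum_(k <- undup (jet_level P n N)) C (c k) * jr_mon k) => m.
  under [X in _ - X]eq_bigr do
    rewrite [s _ N](in_span_expand (sN _)) mulr_sumr.
  rewrite exchange_big -sumrB; apply: pmul_sum => k _.
  have -> : C (c k) * jr_mon k - \sum_(i < m) p%:R ^+ i * (C (jr_coef k (s i N)) * jr_mon k) =
      C (c k - \sum_(i < m) p%:R ^+ i * jr_coef k (s i N)) * jr_mon k.
    rewrite rmorphB mulrBl rmorph_sum mulr_suml; congr (_ - _); apply: eq_bigr => i _.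
    by rewrite rmorphM rmorphXn rmorph_nat mulrA.
  by apply: pmulMr; apply: pmul_rmorph.
exists l => m; apply/ps_pmul => N; rewrite psB ps_sum.
by under eq_bigr do rewrite ps_natXM.
Qed.

Lemma series_sep (F : pser P) : (forall k, pmul p k F) -> F = 0.
Proof.
move=> Fk; apply: pserP => n; apply: (jr_sep A_complete) => k.
by move/ps_pmul: (Fk k).
Qed.

End JetSeries.

(** * Characters are determined by their tangent maps *)

Lemma char_one p (A : comPzRingType) (D : dpq_ring p A) r (x : char_mod D r) (S : cseq D)
    (u : units (S 0)) : val u = 1 -> x S u = 0.
Proof.
move=> u1; have uu : units_mul u u = u by apply: val_inj; rewrite /= u1 mulr1.
by apply: (addrI (x S u)); rewrite -ch_hom uu addr0.
Qed.

Section Vanishing.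

Variables (p : nat) (pr_p : prime p) (A : idomainType) (D : dpq_ring p A).
Hypothesis A_char0 : [pchar A] =i pred0.
Hypothesis A_complete : padic_complete p A.
Variable P : jet_ring A.
Local Notation C := (jrC P).
Local Notation X := (jrX P).
Local Notation DP := (jpoly_dpq pr_p D A_char0 P).
Local Notation Pn := (@jpoly_sub A P).
Local Notation phi := (jpoly_phi pr_p D P).
Local Notation dq := (@jpoly_dq p pr_p A D P).
Local Notation DY := (series_dpq pr_p D A_char0 P).
Local Notation Y := (const_seq DY).
Local Notation J := (series p P).
Local Notation y0 := (gen_unit P).

Definition series_str : ps_hom (const_seq D) Y.
Proof.
refine (@PsHom p (const_seq D) Y (fun=> (J \o C)%FUN) _ _ _) => n a //=.
- by rewrite -[rdp D a]/(rdp D a) -(jpoly_dpC pr_p D A_char0 P) series_dp.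
- by rewrite -(jpoly_dqC pr_p D P) series_dq.
Defined.

Lemma Y_emb n f : Pn n f -> J f = ps_emb Y n (J f). Proof. by []. Qed.
Lemma Y_dp n f : Pn n f -> J (rdp DP f) = ps_dp Y n (J f).
Proof. by move=> _; apply: series_dp. Qed.
Lemma Y_dq n f : Pn n f -> J (rdq DP f) = ps_dq Y n (J f).
Proof. by move=> _; apply: series_dq. Qed.

(* The coordinate ring of the p-adically completed jet spaces of G_m. *)
Definition UY : subseq Y := @approx_subseq p pr_p P DP Pn (@jpoly_sub_emb A P)
  (@jpoly_sub_dp p pr_p A D A_char0 P) (@jpoly_sub_dq p pr_p A D A_char0 P) y0
  Y (fun=> J) Y_emb Y_dp Y_dq.

Lemma UY_complete n : padic_complete p (sub_seq UY n).
Proof.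
apply: approx_complete => [m f|m s]; first exact: series_sep.
exact: (@approx_lim p pr_p A D A_char0 A_complete P m s).
Qed.

Definition UY_str : ps_hom (const_seq D) (sub_seq UY).
Proof.
apply: (@sub_fact p Y UY (const_seq D) series_str) => n a.
by apply: (@approx_ev p P Pn y0 Y (fun=> J) n (C a)); apply: JpolyC.
Defined.

Definition UYc : cseq D := @CSeq p A D (sub_seq UY) UY_str UY_complete.

Definition y_inv : pser P := fun n => (- X 0 0) ^+ n.

Lemma y_invP : J y0 * y_inv = 1.
Proof. by rewrite series_gen_unit ps_geom. Qed.

Lemma y_in : UY 0 (J y0).
Proof. exact: (@approx_ev p P Pn y0 Y (fun=> J) 0 y0 (gen_unit_le P 0)). Qed.

Lemma y_inv_in : UY 0 y_inv.
Proof. exact: (@approx_inv p P Pn y0 (@gen_unit_le A P) Y (fun=> J) 0 y_inv y_invP). Qed.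

Lemma y_unitP : `[< exists v, (sub_mk y_in : UYc 0) * v = 1 >].
Proof. by apply/asboolP; exists (sub_mk y_inv_in); apply: val_inj; apply: y_invP. Qed.
Definition y_unit : units (UYc 0) := exist _ (sub_mk y_in : UYc 0) y_unitP.

(** On jet polynomials t d/dt is the A-linear derivation with X i j going to p^i X i j. *)
Lemma E_poly n h : Pn n h -> exists2 h', Pn n h' & ps_E (J h) = J h'.
Proof.
have EP := ps_E_der P.
elim=> {h} [a|i j ij|f g Pf [f' Pf' ef] Pg [g' Pg' eg]|f g Pf [f' Pf' ef] Pg [g' Pg' eg]].
- exists 0; first exact: sr_in0.
  rewrite seriesC rmorph0; apply: pserP => m; rewrite /ps_E /ps_const /ps_mono.
  by case: eqP => [->|_]; rewrite ?mul0r ?mulr0.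
- exists ((p ^ i)%:R * X i j); first by apply: sr_inM; [apply: sr_in_nat|apply: JpolyX].
  rewrite rmorphM rmorph_nat seriesX ps_mono_natM; apply: pserP => m.
  by rewrite /ps_E /ps_mono; case: eqP => [->|_]; rewrite ?mulr0.
- by exists (f' - g'); [apply: sr_inB|rewrite !rmorphB (derB EP) ef eg].
- exists (f * g' + g * f'); last by rewrite rmorphD !rmorphM (proj2 EP) ef eg.
  by apply: sr_inD; apply: sr_inM.
Qed.

Lemma E_in n g : UY n g -> UY n (ps_E g).
Proof.
move=> Ug k; have [w [h [dw Ph e]]] := Ug k; have [Pw _] := dw.
have [w' Pw' ew] := E_poly Pw; have [h' Ph' eh] := E_poly Ph.
exists (w * w), (w * h' - w' * h); split.
- exact: denomM.
- by apply: sr_inB; apply: sr_inM.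
have EP := ps_E_der P; have := der_pmul EP e.
rewrite (derB EP) (proj2 EP) ew eh rmorphB !rmorphM => Ee.
have -> : J w * J w * ps_E g - (J w * J h' - J w' * J h) =
  J w * (J w * ps_E g + g * J w' - J h') - J w' * (J w * g - J h) by ring.
by apply: pmulB; apply: pmulMl.
Qed.

Definition theta n (g : UYc n) : sqz (UYc n) unit :=
  Sqz g (fun=> sub_mk (E_in (sub_valP g)) : UYc n).

Lemma theta_zmod n : zmod_morphism (@theta n).
Proof.
move=> x y; apply: sqzP => // i; apply: val_inj.
exact: (derB (ps_E_der P) (val x) (val y)).
Qed.

Lemma theta_monoid n : monoid_morphism (@theta n).
Proof.
split=> [|x y]; apply: sqzP => // i; apply: val_inj; first exact: (der1 (ps_E_der P)).
exact: (proj2 (ps_E_der P) (val x) (val y)).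
Qed.

HB.instance Definition _ n := GRing.isZmodMorphism.Build _ _ (@theta n) (@theta_zmod n).
HB.instance Definition _ n := GRing.isMonoidMorphism.Build _ _ (@theta n) (@theta_monoid n).

(** Obtained by applying E to p dp g = phi g - g^p and cancelling p. The right-hand side is the
    fibre component of dp (g + eps E g), which makes [theta_hom] a morphism of prolongation
    sequences. *)
Lemma E_dp (g : pser P) : ps_E (rdp DY g) = rfrob DY (ps_E g) - g ^+ p.-1 * ps_E g.
Proof.
have EP := ps_E_der P; apply: (@mulp_inj p (pser P) (series_reg pr_p A_char0 (P := P))).
have <- : ps_E (p%:R * rdp DY g) = p%:R * ps_E (rdp DY g).
  by rewrite (proj2 EP) (der_nat EP) mulr0 addr0.
have -> : p%:R * rdp DY g = rfrob DY g - g ^+ p by rewrite /rfrob /frob /= addrC addKr.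
by rewrite (derB EP) (derX EP) !(series_rfrob pr_p D A_char0) ps_E_phi mulrBr.
Qed.

Local Notation dualY := (dual_cseq pr_p UYc).

Definition theta_hom : ps_hom UYc dualY.
Proof.
refine (@PsHom p UYc dualY (fun n => @theta n) _ _ _) => n x; apply: sqzP => // i; apply: val_inj.
- by [].
- rewrite -[LHS]/(ps_E (rdp DY (sub_val x))) E_dp; set m : UYc n := sq2 (theta x) tt.
  rewrite -[RHS]/(sub_val (ps_frob UYc n m - ps_emb UYc n x ^+ p.-1 * ps_emb UYc n m)).
  rewrite rmorphB rmorphM rmorphXn; congr (_ - _).
  exact: esym (ps_map_frob (sub_incl UY) m).
- exact: (ps_E_dq (jpoly_dq_der pr_p D P)).
Defined.

(** At c = 0 all jets of x vanish, so y becomes 1 and the operators are respected. The value c = 1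
    is used as a mere ring morphism, to read off a coefficient in [lam0]. *)
Definition ev_at (c : A) : {rmorphism P -> A} := jpoly_eval P idfun (fun _ _ => c).

Lemma ev_at0_phi f : ev_at 0 (phi f) = rfrob D (ev_at 0 f).
Proof.
apply: (@jpoly_hom_ext A P A (ev_at 0 \o phi) (frobA pr_p D \o ev_at 0)) => [a|i j] /=.
  by rewrite jpoly_phiC !jpoly_evalC.
rewrite jpoly_phiX rmorphD rmorphXn rmorphM rmorph_nat !jpoly_evalX mulr0 addr0.
by rewrite expr0n eqn0Ngt prime_gt0 // [RHS](rmorph0 (frobA pr_p D)).
Qed.

Lemma ev_at0_dq f : ev_at 0 (dq f) = rdq D (ev_at 0 f).
Proof.
have DqP := jpoly_dq_der pr_p D P; have [dqP _] := rdq_dpder D.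
have ev_d i j : ev_at 0 (jpoly_d pr_p D P i j) = 0.
  elim: i => [|i IHi]; first by rewrite jpoly_d0 jpoly_evalX.
  rewrite jpoly_dS rmorphB rmorphM ev_at0_phi IHi mulr0 subr0.
  exact: (rmorph0 (frobA pr_p D)).
unshelve eapply (@jr_ind A P
  (@Subring P (fun f => ev_at 0 (dq f) = rdq D (ev_at 0 f)) _ _ _)) => /=.
- by rewrite rmorph1 (der1 DqP) rmorph0 (der1 dqP).
- by move=> x y ex ey; rewrite (derB DqP) !rmorphB (derB dqP) ex ey.
- by move=> x y ex ey; rewrite (proj2 DqP) !rmorphM rmorphD !rmorphM (proj2 dqP) ex ey.
- by move=> a; rewrite jpoly_dqC !jpoly_evalC.
- by move=> i j; rewrite jpoly_dqX ev_d jpoly_evalX (der0 dqP).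
Qed.

Lemma A_reg (x : A) : p%:R * x = 0 -> x = 0.
Proof.
move/eqP; rewrite mulf_eq0 (negPf (natr_neq0 A_char0 (prime_gt0 pr_p))).
by move/eqP.
Qed.

(* t = 0 *)
Definition spec0 : ps_hom UYc (const_cseq D A_complete).
Proof.
refine (@PsHom p UYc (const_cseq D A_complete)
  (fun n => (ev_at 0 \o (@ps_coef0 P \o @sub_val _ (UY n)))%FUN) _ _ _) => n x //=.
- apply: (mulp_inj A_reg); set g := sub_val x.
  apply: (addrI (ev_at 0 (ps_coef0 g) ^+ p)).
  rewrite -[RHS]/(rfrob D _) -ev_at0_phi -(rmorph_nat (ev_at 0)) -rmorphM -rmorphXn -rmorphD.
  congr (ev_at 0 _); rewrite -(rmorph_nat (@ps_coef0 P)) -rmorphM -rmorphXn -rmorphD.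
  rewrite -[_ + _]/(rfrob DY g) series_rfrob.
  by rewrite -[LHS]/(ps_phi p phi g 0%N) /ps_phi dvdn0 div0n.
- exact: ev_at0_dq.
Defined.

Variables (r : nat) (x : char_mod D r).
Hypothesis x_mu : forall i j, (0 < i + j)%N -> mu pr_p A_complete x i j = 0.

Let f : pser P := sub_val (x UYc y_unit).
Let lam : A := mu pr_p A_complete x 0 0.
Let b : UYc 0 := (sub_mk (E_in y_in) : UYc 0) * (sub_mk y_inv_in : UYc 0).

Lemma jet_coord00 n : sub_val (jet_coord b n 0 0) = sub_val b.
Proof. by elim: n => [|n IHn] //; rewrite -IHn. Qed.

(** The morphism [theta_hom] sends y to y + eps E y = y (1 + b eps) with b = E y / y. By additivity
    the value of x there is f + eps times its differential in the direction b, in which only mu_00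
    survives. *)
Lemma E_f : ps_E f = J (C lam) * sub_val b.
Proof.
have hstr n a : theta_hom n (cs_str UYc n a) = cs_str dualY n a.
  apply: sqzP => // i; apply: val_inj; rewrite /= seriesC; apply: pserP => m.
  by rewrite /ps_E /ps_const /ps_mono; case: eqP => [->|_]; rewrite ?mul0r ?mulr0.
have cstr n a : sz_const pr_p (dual_data pr_p UYc) n (cs_str UYc n a) = cs_str dualY n a by [].
have yE : units_map (theta_hom 0) y_unit =
    units_mul (units_map (sz_const pr_p (dual_data pr_p UYc) 0) y_unit) (dual_one pr_p b).
  apply: val_inj; apply: sqzP => [|i]; first by rewrite /= mulr1.
  apply: val_inj; rewrite /= -[RHS]/(J y0 * (ps_E (J y0) * y_inv) + 1 * 0).
  by rewrite mulr0 addr0 mulrCA y_invP mulr1.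
have e := ch_nat x (f := theta_hom) hstr y_unit.
rewrite yE ch_hom -(ch_nat x (T := dualY) (f := sz_const pr_p (dual_data pr_p UYc)) cstr) in e.
apply: (etrans (congr1 (fun z : sqz (UYc r) unit => sub_val (sq2 z tt)) e)).
rewrite sq2D (char_dual pr_p A_complete) add0r big_nat_recl // [X in _ + X]big1 ?addr0; last first.
  by move=> i _; rewrite big1 // => j _; rewrite x_mu // rmorph0 mul0r.
rewrite big_nat_recl // [X in _ + X]big1 ?addr0; last first.
  by move=> j _; rewrite x_mu // rmorph0 mul0r.
by rewrite rmorphM; congr (_ * _); apply: (jet_coord00 r).
Qed.

Lemma b_coef n : sub_val b n.+1 = X 0 0 * (- X 0 0) ^+ n.
Proof.
have -> : sub_val b = ps_mono 1 (X 0 0) * y_inv.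
  rewrite -[LHS]/(ps_E (J y0) * y_inv) series_gen_unit; congr (_ * _).
  rewrite (proj1 (ps_E_der P)) (der1 (ps_E_der P)) add0r; apply: pserP => m.
  by rewrite /ps_E /ps_mono; case: eqP => [->|_]; rewrite ?mul1r ?mulr0.
by rewrite [LHS]ps_monoM /= subn1.
Qed.

Lemma f_coef n : n.+1%:R * f n.+1 = C lam * (X 0 0 * (- X 0 0) ^+ n).
Proof.
have := congr1 (fun F : pser P => F n.+1) E_f; rewrite {1}/ps_E => ->.
by rewrite seriesC [LHS]ps_monoM subn0 b_coef.
Qed.

(** Setting the variables to 1 turns [f_coef] into divisibility of lam by n + 1 in A; the cases n +
    1 = p^k suffice, A being p-adically separated. *)
Lemma lam0 : lam = 0.
Proof.
have lamE n : lam = n.+1%:R * ((-1) ^+ n * ev_at 1 (f n.+1)).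
  have := congr1 (ev_at 1) (f_coef n); rewrite !rmorphM [ev_at 1 (_ ^+ n)]rmorphXn rmorphN.
  rewrite rmorph_nat jpoly_evalC jpoly_evalX mul1r /= mulrCA => ->.
  by rewrite mulrCA -exprMn mulrNN mulr1 expr1n mulr1.
apply: (padic_sep A_complete) => k.
exists ((-1) ^+ (p ^ k).-1 * ev_at 1 (f (p ^ k)%N)).
by rewrite {1}(lamE (p ^ k).-1) prednK ?expn_gt0 ?prime_gt0 // natrX.
Qed.

Lemma f0 : f = 0.
Proof.
have fS n : f n.+1 = 0.
  by apply: (jpoly_reg A_char0 (n := n.+1)) => //; rewrite f_coef lam0 rmorph0 mul0r.
(* The constant coefficient has level 0, hence comes from A and is recovered from its image under
   [spec0], where y has become 1. *)
have f00 : f 0%N = 0.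
  have : in_span (jet_level P r 0) (f 0%N).
    move=> k; apply: (@approx_graded p pr_p A D A_char0 A_complete P r f).
    exact: (sub_valP (x UYc y_unit)).
  move/in_span_expand; rewrite /= big_seq1 jr_mon1 mulr1 => e.
  have hstr n a : spec0 n (cs_str UYc n a) = cs_str (const_cseq D A_complete) n a.
    by rewrite -[LHS]/(ev_at 0 (ps_coef0 (J (C a)))) seriesC -[ps_coef0 _]/(C a) jpoly_evalC.
  have := ch_nat x (f := spec0) hstr y_unit.
  rewrite (char_one x (u := units_map (spec0 0) y_unit)); last first.
    rewrite -[LHS]/(ev_at 0 (ps_coef0 (J y0))) series_gen_unit.
    by rewrite -[ps_coef0 _]/(1 + 0) addr0 rmorph1.
  rewrite -[LHS]/(ev_at 0 (f 0%N)) e jpoly_evalC -e /= => c0.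
  by rewrite e c0 rmorph0.
by apply: pserP => -[|n].
Qed.

Variables (S : cseq D) (u : units (S 0)).
Let B : pro_seq p := prod_seq Y S.
Local Notation evS := (@jet_ev p A D P S (cs_str S) (val u - 1)).
Let ev n : {rmorphism P -> B n} := pair_map J (evS n).

Lemma B_emb n h : Pn n h -> ev n.+1 h = ps_emb B n (ev n h).
Proof. by move=> Ph; apply: pairE; [|apply: jet_ev_emb]. Qed.
Lemma B_dp n h : Pn n h -> ev n.+1 (rdp DP h) = ps_dp B n (ev n h).
Proof. by move=> Ph; apply: pairE; [apply: series_dp|apply: jet_ev_dp]. Qed.
Lemma B_dq n h : Pn n h -> ev n.+1 (rdq DP h) = ps_dq B n (ev n h).
Proof. by move=> Ph; apply: pairE; [apply: series_dq|apply: (jet_ev_dq _ A_char0)]. Qed.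

(* The graph of the specialisation of the universal point to u. *)
Definition UB : subseq B := @approx_subseq p pr_p P DP Pn (@jpoly_sub_emb A P)
  (@jpoly_sub_dp p pr_p A D A_char0 P) (@jpoly_sub_dq p pr_p A D A_char0 P) y0
  B ev B_emb B_dp B_dq.

Lemma UB_fst n z : UB n z -> UY n z.1.
Proof.
move=> Uz k; have [w [h [dw Ph e]]] := Uz k; exists w, h; split=> //.
exact: (pmul_rmorph (@fst (Y n) (S n)) e).
Qed.

Lemma pair_pmul (R Q : comPzRingType) k (a : R) (c : Q) :
  pmul p k a -> pmul p k c -> pmul p k ((a, c) : (R * Q)%type).
Proof.
move=> [a' ->] [c' ->]; exists (a', c'); apply: pairE.
  by rewrite -[RHS]/(fst _) rmorphM rmorphXn rmorph_nat.
by rewrite -[RHS]/(snd _) rmorphM rmorphXn rmorph_nat.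
Qed.

Lemma UB_complete n : padic_complete p (sub_seq UB n).
Proof.
apply: approx_complete => [m z zk|m s As].
  apply: pairE; first by apply: (series_sep A_complete) => k; apply: (pmul_rmorph (@fst _ _) (zk k)).
  by apply: (padic_sep (cs_complete S m)) => k; apply: (pmul_rmorph (@snd _ _) (zk k)).
have [l1 l1P] := @approx_lim p pr_p A D A_char0 A_complete P m (fun i => (s i).1)
  (fun i => UB_fst (As i)).
have [l2 l2P] := complete_series (cs_complete S m) (fun i => (s i).2).
exists (l1, l2) => q; rewrite [X in pmul _ _ X]surjective_pairing; apply: pair_pmul.
  rewrite -[_.1]/(fst _) rmorphB rmorph_sum.
  by under eq_bigr do rewrite rmorphM rmorphXn rmorph_nat; apply: l1P.
rewrite -[_.2]/(snd _) rmorphB rmorph_sum.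
by under eq_bigr do rewrite rmorphM rmorphXn rmorph_nat; apply: l2P.
Qed.

Definition UB_str : ps_hom (const_seq D) (sub_seq UB).
Proof.
apply: (@sub_fact p B UB (const_seq D) (prod_pair series_str (cs_str S))) => n a.
have -> : prod_pair series_str (cs_str S) n a = ev n (C a).
  by apply: pairE => //=; rewrite jet_evC.
by apply: approx_ev; apply: JpolyC.
Defined.

Definition UBc : cseq D := @CSeq p A D (sub_seq UB) UB_str UB_complete.

Lemma ev_y : ev 0 y0 = (J y0, val u).
Proof.
apply: pairE => //=; rewrite /gen_unit rmorphD rmorph1 jet_evX.
by rewrite /= addrC subrK.
Qed.

Lemma UB_u : UB 0 (J y0, val u).
Proof. by rewrite -ev_y; apply: approx_ev; apply: gen_unit_le. Qed.

Lemma UB_uP : `[< exists v, (sub_mk UB_u : UBc 0) * v = 1 >].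
Proof.
case: (asboolP _) (svalP u) => // [[v uv]] _; apply/asboolP.
have e : ev 0 y0 * (y_inv, v) = 1 by rewrite ev_y; apply: pairE; [apply: y_invP|apply: uv].
have Ui : UB 0 (y_inv, v) := @approx_inv p P Pn y0 (@gen_unit_le A P) B ev 0 (y_inv, v) e.
exists (sub_mk Ui : UBc 0); apply: val_inj.
by rewrite -[LHS]/((J y0, val u) * (y_inv, v)) -ev_y.
Qed.

Definition u_unit : units (UBc 0) := exist _ (sub_mk UB_u : UBc 0) UB_uP.

(** Modulo p the denominator is a power of y0, which is sent to the unit u; invertibility modulo p
    is enough in a complete ring. *)
Lemma evS_unit n w : denom p Pn y0 n w -> exists v, evS n w * v = 1.
Proof.
have [v uv] : exists v, val u * v = 1 by apply/asboolP; apply: (svalP u).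
move=> [Pw [a wa]].
have eu m : exists v, evS m y0 * v = 1.
  elim: m => [|m [v' IHm]].
    exists v; rewrite /gen_unit rmorphD rmorph1 jet_evX /=.
    by rewrite [1 + _]addrC subrK.
  exists (ps_emb S m v'); rewrite jet_ev_emb; last exact: gen_unit_le.
  by rewrite -rmorphM IHm rmorph1.
have [v' uv'] := eu n.
apply: (unit_pmul (cs_complete S n) (x := evS n y0 ^+ a) (u := v' ^+ a)).
  by rewrite -exprMn uv' expr1n.
by rewrite -rmorphXn -rmorphB; apply: pmul_rmorph.
Qed.

(** If z.1 = 0, an approximating numerator h has [series h] divisible by p^k, so h itself is
    divisible by p^k by [series_pmul], and so is its value in S. The denominator being a unit in S,
    z.2 is divisible by every p^k. *)
Lemma UB_inj n (z : B n) : UB n z -> z.1 = 0 -> z.2 = 0.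
Proof.
move=> Uz z1; apply: (padic_sep (cs_complete S n)) => k.
have [w [h [dw Ph e]]] := Uz k.
have hk : pmul p k h.
  apply: (series_pmul (p := p)); have := pmul_rmorph (@fst (Y n) (S n)) e.
  rewrite -[X in pmul _ _ X]/(J w * z.1 - J h) z1 mulr0 sub0r => /pmulN.
  by rewrite opprK.
have [v wv] := evS_unit dw.
have -> : z.2 = v * ((evS n w * z.2 - evS n h) + evS n h).
  by rewrite subrK mulrA [v * _]mulrC wv mul1r.
apply: pmulMl; apply: pmulD; last exact: pmul_rmorph.
exact: (pmul_rmorph (@snd (Y n) (S n)) e).
Qed.

Definition UB_pr1 : ps_hom (sub_seq UB) (sub_seq UY) :=
  @sub_fact p Y UY (sub_seq UB) (ps_comp (prod_fst Y S) (sub_incl UB))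
    (fun n z => UB_fst (sub_valP z)).
Definition UB_pr2 : ps_hom (sub_seq UB) S := ps_comp (prod_snd Y S) (sub_incl UB).

(** The point (y, u) of the graph projects to y and to u. By naturality the value of x at (y, u) has
    first component f = 0, hence second component 0 by [UB_inj]. *)
Lemma char_vanish : x S u = 0.
Proof.
have e1 := ch_nat x (S := UBc) (T := UYc) (f := UB_pr1) _ u_unit.
have e2 := ch_nat x (S := UBc) (T := S) (f := UB_pr2) _ u_unit.
have y1 : units_map (UB_pr1 0) u_unit = y_unit by apply: val_inj; apply: val_inj.
have y2 : units_map (UB_pr2 0) u_unit = u by apply: val_inj.
rewrite y1 in e1; rewrite y2 in e2; rewrite -e2 //.
apply: (UB_inj (sub_valP (x UBc u_unit))).
rewrite -[LHS]/(sub_val (UB_pr1 r (x UBc u_unit))) e1; first exact: f0.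
by move=> n a; apply: val_inj.
Qed.

End Vanishing.

(** * The characters psi_p and psi_q *)

Lemma rinv_map (S T : comPzRingType) (f : {rmorphism S -> T}) (x y : S) :
  x * y = 1 -> f (rinv x) = rinv (f x).
Proof. by move=> xy; rewrite (rinvP xy) (@rinvP _ _ (f y)) // -rmorphM xy rmorph1. Qed.

Lemma units_inv (S : comPzRingType) (u : units S) : exists v, val u * v = 1.
Proof. by apply/asboolP; apply: (svalP u). Qed.

Section PsiQ.

Variables (p : nat) (A : idomainType) (D : dpq_ring p A).

Definition psi_q_fun (S : cseq D) (u : units (S 0)) : S 1 :=
  ps_dq S 0 (val u) * rinv (ps_emb S 0 (val u)).

Lemma emb_unit (S : pro_seq p) (u : units (S 0)) : exists v, ps_emb S 0 (val u) * v = 1.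
Proof. by have [v uv] := units_inv u; exists (ps_emb S 0 v); rewrite -rmorphM uv rmorph1. Qed.

Lemma psi_q_hom (S : cseq D) (u v : units (S 0)) :
  psi_q_fun (units_mul u v) = psi_q_fun u + psi_q_fun v.
Proof.
have [u' uu'] := emb_unit u; have [v' vv'] := emb_unit v.
rewrite /psi_q_fun /= rmorphM ps_dqM (rinvP uu') (rinvP vv') (@rinvP _ _ (u' * v')); last first.
  by rewrite mulrACA uu' vv' mulr1.
set a := ps_emb _ _ _ in uu' *; set b := ps_emb _ _ _ in vv' *.
set da := ps_dq _ _ (val u); set db := ps_dq _ _ (val v).
have -> : (a * db + b * da) * (u' * v') = (a * u') * (db * v') + (b * v') * (da * u') by ring.
by rewrite uu' vv'; ring.
Qed.

Lemma psi_q_nat (S T : cseq D) (f : ps_hom S T) (u : units (S 0)) :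
  f 1%N (psi_q_fun u) = psi_q_fun (units_map (f 0%N) u).
Proof.
have [u' uu'] := emb_unit u.
by rewrite /psi_q_fun /= rmorphM ps_map_dq (rinv_map _ uu') ps_map_emb.
Qed.

Definition psi_q : char_mod D 1 :=
  @GmChar p A D 1 psi_q_fun psi_q_hom (fun S T f _ u => psi_q_nat f u).

End PsiQ.

(** * Binomial coefficients of p^n and integral approximations of the logarithm *)

Section BinomialEstimates.

Variables (p : nat) (pr_p : prime p).
Let p_gt0 : (0 < p)%N := prime_gt0 pr_p.

Lemma part_pE k : (0 < k)%N -> (p ^ logn p k * k`_p^')%N = k.
Proof. by move=> k0; rewrite -p_part partnC. Qed.

(** With v the valuation of k, it gives k - 1 - v >= k/2 - 1 for the power of p in the k-th
    logarithm coefficient: hence the thresholds 2K + 2 below. *)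
Lemma logn_double k : (0 < k)%N -> (2 * logn p k <= k)%N.
Proof.
move=> k0; have pk : (p ^ logn p k <= k)%N by apply: dvdn_leq => //; apply: pfactor_dvdnn.
apply: leq_trans pk; elim: (logn p k) => // v IHv.
have p1 := prime_gt1 pr_p; case: v IHv => [|v] IHv; first by rewrite expn1.
rewrite expnS; apply: leq_trans (leq_mul p1 IHv); lia.
Qed.

Lemma logn_lt k : (0 < k)%N -> (logn p k < k)%N.
Proof. by move=> k0; have := logn_double k0; lia. Qed.

Lemma coprime_part k : coprime (k`_p^')%N p.
Proof. by rewrite coprime_sym prime_coprime // -p'natE // part_pnat. Qed.

(** From k C(p^n, k) = p^n C(p^n - 1, k - 1), after removing the p-part of k. *)
Lemma dvdn_bin_pX n k : (0 < k)%N -> (p ^ (n - logn p k) %| 'C(p ^ n, k))%N.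
Proof.
move=> k0; have [vn|/ltnW nv] := leqP (logn p k) n; last first.
  by move: nv; rewrite -subn_eq0 => /eqP ->; apply: dvd1n.
have := mul_bin_diag (p ^ n) k.-1; rewrite prednK // => e.
have e' : (p ^ logn p k * (k`_p^' * 'C(p ^ n, k)) =
    p ^ logn p k * (p ^ (n - logn p k) * 'C((p ^ n).-1, k.-1)))%N.
  by rewrite !mulnA part_pE // -e -expnD subnKC.
move/eqP: e'; rewrite eqn_pmul2l ?expn_gt0 ?p_gt0 // => /eqP e'.
have : (p ^ (n - logn p k) %| k`_p^' * 'C(p ^ n, k))%N by rewrite e' dvdn_mulr.
by rewrite Gauss_dvdr // coprime_sym coprimeXr // coprime_part.
Qed.

(* ((1 + p a)^(p^n) - 1) / p^(n+1) has these integer coefficients. *)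
Definition powlog_coef n k : nat := ('C(p ^ n, k) * p ^ k %/ p ^ n.+1)%N.

Lemma powlog_coefE n k : (0 < k)%N ->
  (p ^ n.+1 * powlog_coef n k = 'C(p ^ n, k) * p ^ k)%N.
Proof.
move=> k0; rewrite mulnC divnK //; have [vn|nv] := leqP (logn p k) n.
  have -> : n.+1 = (n - logn p k + (logn p k).+1)%N by lia.
  by rewrite expnD; apply: dvdn_mul; [apply: dvdn_bin_pX|apply: dvdn_exp2l; apply: logn_lt].
by apply: dvdn_mull; apply: dvdn_exp2l; have := logn_lt k0; lia.
Qed.

(** Writing k = p^v k' with k' prime to p, the logarithm coefficient is (-1)^(k-1) p^(k-1-v) / k'.
    In the form given here [powlog_coef] differs from it only by a binomial coefficient in place of
    the sign. *)
Lemma powlog_coef_part n k : (0 < k)%N ->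
  (k`_p^' * powlog_coef n k = p ^ (k.-1 - logn p k) * 'C((p ^ n).-1, k.-1))%N.
Proof.
move=> k0; have kv := logn_lt k0.
have := mul_bin_diag (p ^ n) k.-1; rewrite prednK // => e.
apply/eqP; rewrite -(@eqn_pmul2l (p ^ n.+1 * p ^ logn p k)) ?muln_gt0 ?expn_gt0 ?p_gt0 //.
apply/eqP; transitivity (k * (p ^ n.+1 * powlog_coef n k))%N.
  by rewrite -[X in _ = (X * _)%N](part_pE k0); lia.
rewrite powlog_coefE // mulnA -e.
have -> : (p ^ k = p ^ logn p k * (p * p ^ (k.-1 - logn p k)))%N.
  by rewrite -expnS -expnD; congr (_ ^ _)%N; lia.
by rewrite expnS; lia.
Qed.

(** By Pascal's rule two consecutive coefficients add up to C(p^n, j+1), which is divisible by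
    p^(n-v) for v the valuation of j+1, and v <= j. *)
Lemma bin_pX_sign (S : comPzRingType) n j :
  pmul p (n - j) (('C((p ^ n).-1, j))%:R - (-1) ^+ j : S).
Proof.
elim: j => [|j IHj]; first by rewrite bin0 expr0 subrr; apply: pmulz.
have pn : (0 < p ^ n)%N by rewrite expn_gt0 p_gt0.
have -> : ('C((p ^ n).-1, j.+1))%:R - (-1) ^+ j.+1 =
    ('C(p ^ n, j.+1))%:R - (('C((p ^ n).-1, j))%:R - (-1) ^+ j) :> S.
  by rewrite -{2}(prednK pn) binS natrD exprS; ring.
apply: pmulB; last by apply: pmulW IHj; lia.
have /dvdnP[d ->] := @dvdn_bin_pX n j.+1 isT; rewrite natrM mulrC natrX.
by apply: (@pmulW _ _ (n - logn p j.+1)); [have := @logn_lt j.+1 isT; lia|apply: pmul_mul].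
Qed.

Variable S : comPzRingType.
Implicit Types a b : S.

(** These polynomials tend to (1/p) log (1 + p a). They are additive up to p^(n+1) because p^n-th
    powers are multiplicative, which yields the functional equation of the logarithm without
    rearranging its series. *)
Definition powlog n a : S := \sum_(1 <= k < (p ^ n).+1) (powlog_coef n k)%:R * a ^+ k.

Lemma powlogE n a : 1 + p%:R ^+ n.+1 * powlog n a = (1 + p%:R * a) ^+ (p ^ n).
Proof.
rewrite exprDn.
rewrite -(big_mkord xpredT (fun i => 1 ^+ (p ^ n - i) * (p%:R * a) ^+ i *+ 'C(p ^ n, i))).
rewrite big_ltn // expr1n expr0 bin0 !mulr1 mulr_sumr; congr (1 + _).
apply: eq_big_nat => k /andP[k0 _]; rewrite expr1n mul1r -[RHS]mulr_natl exprMn !mulrA.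
by rewrite -!natrX -!natrM powlog_coefE.
Qed.

End BinomialEstimates.

Lemma powlog_map p n (S T : comPzRingType) (f : {rmorphism S -> T}) a :
  f (powlog p n a) = powlog p n (f a).
Proof.
by rewrite rmorph_sum; apply: eq_bigr => k _; rewrite rmorphM rmorphXn rmorph_nat.
Qed.

(* An identity with integer coefficients, checked in the torsion free ring Z[X, Y]. *)
Lemma powlogD p (pr_p : prime p) n (S : comPzRingType) (a b : S) :
  powlog p n (a + b + p%:R * (a * b)) =
  powlog p n a + powlog p n b + p%:R ^+ n.+1 * (powlog p n a * powlog p n b).
Proof.
pose P := jet_poly int; pose X := jrX P 0 0; pose Z := jrX P 0 1.
have int0 : [pchar int] =i pred0 by apply: Num.Theory.pchar_num.
have PXZ : powlog p n (X + Z + p%:R * (X * Z)) =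
    powlog p n X + powlog p n Z + p%:R ^+ n.+1 * (powlog p n X * powlog p n Z).
  apply/eqP; rewrite -subr_eq0; apply/eqP.
  apply: (jpoly_reg int0 (n := p ^ n.+1)); first by rewrite expn_gt0 prime_gt0.
  have eXZ := powlogE pr_p n (X + Z + p%:R * (X * Z)).
  have eX := powlogE pr_p n X; have eZ := powlogE pr_p n Z.
  have e : (1 + p%:R ^+ n.+1 * powlog p n (X + Z + p%:R * (X * Z))) =
      (1 + p%:R ^+ n.+1 * powlog p n X) * (1 + p%:R ^+ n.+1 * powlog p n Z).
    by rewrite eXZ eX eZ -exprMn; congr (_ ^+ _); ring.
  rewrite natrX mulrBr; apply/eqP; rewrite subr_eq0; apply/eqP.
  by apply: (addrI 1); rewrite e; ring.
have [ev [_ evX]] := @jr_ev int P S intr (fun _ j => if j is 0 then a else b).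
have := congr1 ev PXZ; rewrite !(rmorphD, rmorphM, rmorphXn, rmorph_nat, powlog_map) /=.
by rewrite /X /Z !evX.
Qed.

(** * The logarithm in a p-adically complete ring *)

Section Log.

Variables (p : nat) (pr_p : prime p) (S : comPzRingType) (Sc : padic_complete p S).
Implicit Types a b : S.
Let p_gt0 : (0 < p)%N := prime_gt0 pr_p.

Lemma part_unit k : exists v : S, (k`_p^')%:R * v = 1.
Proof. by apply: (unit_coprime Sc); [apply: part_gt0|apply: coprime_part]. Qed.

Lemma log_coef_pmul K k : (2 * K + 2 <= k)%N -> pmul p K (log_coef p S k).
Proof.
move=> kK; have k0 : (0 < k)%N by lia.
apply: pmulMl; apply: pmulMr; rewrite natrX; apply: (@pmulW _ _ (k.-1 - logn p k)).
  by have := logn_double pr_p k0; lia.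
by exists 1; rewrite mulr1.
Qed.

Definition log_sum a n : S := \sum_(1 <= k < n.+1) log_coef p S k * a ^+ k.

Lemma log_sum_tail a K n : (2 * K + 2 <= n)%N -> pmul p K (log_sum a n - log_sum a (2 * K + 2)).
Proof.
move=> nK; rewrite /log_sum (big_cat_nat (n := (2 * K + 2).+1)) //= addrC addrK.
rewrite big_seq; apply: pmul_sum => k; rewrite mem_index_iota => /andP[Kk _].
by apply: pmulMr; apply: log_coef_pmul; lia.
Qed.

Lemma log_ex a : exists l, padic_cvg p (log_sum a) l.
Proof.
have [K|l lP] := padic_lim Sc (s := fun K => log_sum a (2 * K + 2)).
  by apply: log_sum_tail; lia.
exists l => K; exists (2 * K + 2)%N => n nK.
rewrite -/(pmul p K _) -[_ - _](subrKA (log_sum a (2 * K + 2))).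
apply: pmulD; first exact: log_sum_tail.
by rewrite -opprB; apply: pmulN.
Qed.

(** The element (1/p) log (1 + p a). *)
Definition plog a : S := projT1 (cid (log_ex a)).
Lemma plogP a : padic_cvg p (log_sum a) (plog a).
Proof. exact: (projT2 (cid (log_ex a))). Qed.

Lemma powlog_coef_log n k : (0 < k)%N ->
  (powlog_coef p n k)%:R - log_coef p S k =
  p%:R ^+ (k.-1 - logn p k) * (rinv (k`_p^')%:R * (('C((p ^ n).-1, k.-1))%:R - (-1) ^+ k.-1)).
Proof.
move=> k0; have [v mv] := part_unit k; rewrite /log_coef (rinvP mv) natrX.
have -> : (powlog_coef p n k)%:R = v * ((k`_p^' * powlog_coef p n k)%N)%:R :> S.
  by rewrite natrM mulrA [v * _]mulrC mv mul1r.
by rewrite powlog_coef_part // natrM natrX; ring.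
Qed.

Lemma powlog_log_sum a K n : (3 * K + 2 <= n)%N -> pmul p K (powlog p n a - log_sum a (p ^ n)).
Proof.
move=> nK; rewrite /powlog /log_sum -sumrB big_seq; apply: pmul_sum => k.
rewrite mem_index_iota => /andP[k0 _]; rewrite -mulrBl; apply: pmulMr.
(* For k >= 2K + 2 the factor p^(k-1-v) is divisible by p^K. Otherwise k - 1 <= 2K, and the binomial
   coefficient agrees with its sign modulo p^(n-2K), where n >= 3K + 2. *)
rewrite powlog_coef_log //; have [kK|kK] := leqP (2 * K + 2) k.
  apply: pmulMr; apply: (@pmulW _ _ (k.-1 - logn p k)); last by exists 1; rewrite mulr1.
  by have := logn_double pr_p k0; lia.
do 2!apply: pmulMl; apply: (@pmulW _ _ (n - k.-1)); last exact: bin_pX_sign.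
by lia.
Qed.

Lemma powlog_plog a K : exists N, forall n, (N <= n)%N -> pmul p K (powlog p n a - plog a).
Proof.
have [M MP] := plogP a K; exists (maxn (3 * K + 2) M) => n nM.
rewrite -[_ - _](subrKA (log_sum a (p ^ n))); apply: pmulD; first by apply: powlog_log_sum; lia.
apply: MP; apply: leq_trans (ltnW (ltn_expl n (prime_gt1 pr_p))); lia.
Qed.

(** The argument on the left belongs to the product (1 + p a)(1 + p b); the error term of [powlogD]
    disappears in the limit. *)
Lemma plogD a b : plog (a + b + p%:R * (a * b)) = plog a + plog b.
Proof.
apply: (padic_eq Sc) => K.
have [Na aP] := powlog_plog a K; have [Nb bP] := powlog_plog b K.
have [Nc cP] := powlog_plog (a + b + p%:R * (a * b)) K.
pose n := (Na + Nb + Nc + K)%N.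
have {}aP : pmul p K (powlog p n a - plog a) by apply: aP; rewrite /n; lia.
have {}bP : pmul p K (powlog p n b - plog b) by apply: bP; rewrite /n; lia.
have {}cP := cP n; rewrite powlogD // in cP.
have {}cP := cP ltac:(rewrite /n; lia).
set c := plog (_ + _) in cP *; set pa := powlog p n a in aP cP; set pb := powlog p n b in bP cP.
have -> : c - (plog a + plog b) = (pa - plog a) + (pb - plog b) +
  p%:R ^+ n.+1 * (pa * pb) - (pa + pb + p%:R ^+ n.+1 * (pa * pb) - c) by ring.
apply: pmulB => //; apply: pmulD; first exact: pmulD.
by apply: (@pmulW _ _ n.+1); [rewrite /n; lia|apply: pmul_mul].
Qed.

End Log.

Lemma plog_map p (pr_p : prime p) (S T : comPzRingType) (Sc : padic_complete p S)
    (Tc : padic_complete p T) (f : {rmorphism S -> T}) a :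
  f (plog pr_p Sc a) = plog pr_p Tc (f a).
Proof.
apply: (padic_cvg_unique Tc (s := log_sum p (f a))); last exact: plogP.
move=> K; have [N NP] := plogP pr_p Sc a K; exists N => n /NP nP.
have -> : log_sum p (f a) n = f (log_sum p a n).
  rewrite rmorph_sum; apply: eq_bigr => k _; rewrite rmorphM rmorphXn; congr (_ * _).
  have [v mv] := part_unit pr_p Sc k.
  rewrite /log_coef rmorphM [f (_%:R * _)]rmorphM rmorph_sign rmorph_nat; congr (_ * (_ * _)).
  by rewrite -(rmorph_nat f) (rinv_map f mv).
by rewrite -rmorphB; apply: pmul_rmorph nP.
Qed.

(** * The character psi_p, and the coordinates of psi_p and psi_q *)

Section PsiP.

Variables (p : nat) (pr_p : prime p) (A : idomainType) (D : dpq_ring p A).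

(** Here 1 + p [dp_ratio u] is phi u / u^p, which is multiplicative in u. *)
Definition dp_ratio (S : pro_seq p) (u : units (S 0)) : S 1 :=
  ps_dp S 0 (val u) * rinv (ps_emb S 0 (val u) ^+ p).

Lemma embX_unit (S : pro_seq p) (u : units (S 0)) : exists v, ps_emb S 0 (val u) ^+ p * v = 1.
Proof. by have [v uv] := emb_unit u; exists (v ^+ p); rewrite -exprMn uv expr1n. Qed.

Lemma dp_ratioM (S : pro_seq p) (u v : units (S 0)) : dp_ratio (units_mul u v) =
  dp_ratio u + dp_ratio v + p%:R * (dp_ratio u * dp_ratio v).
Proof.
have [u' uu'] := embX_unit u; have [v' vv'] := embX_unit v; have [_ _ dpM] := ps_pder S 0.
rewrite /dp_ratio /= rmorphM dpM (rinvP uu') (rinvP vv') (@rinvP _ _ (u' * v')); last first.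
  by rewrite exprMn mulrACA uu' vv' mulr1.
set a := ps_emb _ _ _ ^+ p in uu' *; set b := ps_emb _ _ _ ^+ p in vv' *.
set da := ps_dp _ _ (val u); set db := ps_dp _ _ (val v).
have -> : (a * db + b * da + p%:R * (da * db)) * (u' * v') =
  (a * u') * (db * v') + (b * v') * (da * u') + p%:R * (da * u' * (db * v')) by ring.
by rewrite uu' vv'; ring.
Qed.

Definition psi_p_fun (S : cseq D) (u : units (S 0)) : S 1 :=
  plog pr_p (cs_complete S 1) (dp_ratio u).

Lemma psi_p_hom (S : cseq D) (u v : units (S 0)) :
  psi_p_fun (units_mul u v) = psi_p_fun u + psi_p_fun v.
Proof. by rewrite /psi_p_fun dp_ratioM plogD. Qed.

Lemma psi_p_nat (S T : cseq D) (f : ps_hom S T) (u : units (S 0)) :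
  f 1%N (psi_p_fun u) = psi_p_fun (units_map (f 0%N) u).
Proof.
have [v uv] := embX_unit u.
rewrite /psi_p_fun (plog_map _ _ (cs_complete T 1)); congr plog.
by rewrite /dp_ratio rmorphM ps_map_dp (rinv_map _ uv) rmorphXn ps_map_emb.
Qed.

Definition psi_p : char_mod D 1 :=
  @GmChar p A D 1 psi_p_fun psi_p_hom (fun S T f _ u => psi_p_nat f u).

Lemma psi_pP : is_psi_p psi_p.
Proof. by move=> S u; apply: plogP. Qed.

Lemma psi_qP : is_psi_q (psi_q D).
Proof. by []. Qed.

Hypothesis A_complete : padic_complete p A.
Local Notation T := (jet_cseq pr_p D A_complete).
Local Notation one := (jet_one pr_p D A_complete).

(** By the formula for dp on a square-zero extension, dp (1 + eps_00) = eps_10 - eps_00; its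
    component in A is dp 1 = 0, so dividing by u^p changes nothing. *)
Lemma jet_dp_ratio : exists m : jet_index 1 -> A,
  dp_ratio one = (Sqz 0 m : sqz A (jet_index 1)) /\
  forall i j, jet_at m i j = ((i == 1%N) && (j == 0%N))%:R - ((i == 0%N) && (j == 0%N))%:R.
Proof.
pose m0 : jet_index 0 -> A := jet_mk (fun _ _ => 1).
exists (fun k => jet_F D m0 k - jet_e m0 k); split; last first.
  move=> i j; rewrite jet_atB (jet_at_F pr_p) jet_at_e !jet_at_mk.
  by case: i => [|[|i]]; case: j => [|j]; rewrite ?jet_at_mk /= ?subr0 ?(rfrob1 D);
    rewrite ?[rfrob D 0](ps_frob0 pr_p (const_seq D) 0) ?subr0 ?sub0r.
have [v uv] := embX_unit one; rewrite /dp_ratio (rinvP uv).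
have v1 : sq1 (v : sqz A (jet_index 1)) = 1.
  by have := congr1 (fun z : sqz A (jet_index 1) => sq1 z) uv; rewrite rmorphM rmorphXn /= expr1n mul1r.
have [dp1 _ _] := rdp_pder D.
apply: sqzP => [|i]; first by rewrite -[LHS]/(rdp D 1 * sq1 v) dp1 mul0r.
rewrite sq2M /= v1 dp1 mul0r add0r expr1n !mul1r.
by [].
Qed.

Lemma mu_psi_p i j : mu pr_p A_complete psi_p i j =
  ((i == 1%N) && (j == 0%N))%:R - ((i == 0%N) && (j == 0%N))%:R.
Proof.
have [m [rE mE]] := jet_dp_ratio; rewrite -mE /mu; congr (jet_at _ i j).
have -> // : psi_p T one = (Sqz 0 m : sqz A (jet_index 1)).
apply: (padic_cvg_unique (cs_complete T 1) (psi_pP (S := T) one)).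
(* The ratio has square zero, so the logarithm reduces to its linear term, whose coefficient is
   1. *)
have rX k : (1 < k)%N -> (Sqz 0 m : T 1%N) ^+ k = 0.
  case: k => [|[|k]] // _; rewrite !exprS mulrA.
  have -> : (Sqz 0 m : T 1%N) * (Sqz 0 m : T 1%N) = 0.
    by apply: sqzP => [|l]; [apply: mul0r|rewrite sq2M /= !mul0r addr0].
  by rewrite mul0r.
move=> K; exists 1%N => -[|n] // _; rewrite /psi_p_partial -/(dp_ratio one) rE big_ltn // big1_seq.
  rewrite addr0 expr1 /log_coef /= logn1 expn0 mul1r partn1 (@rinvP _ _ 1) ?mulr1 // mul1r subrr.
  exact: pmulz.
by move=> k; rewrite mem_index_iota => /and3P[_ k2 _]; rewrite rX ?mulr0.
Qed.

Lemma mu_psi_q i j : mu pr_p A_complete (psi_q D) i j = ((i == 0%N) && (j == 1%N))%:R.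
Proof.
pose m0 : jet_index 0 -> A := jet_mk (fun _ _ => 1).
have rdqE : [/\ rdq D 0 = 0 & rdq D 1 = 0].
  by have [dqP _] := rdq_dpder D; rewrite (der0 dqP) (der1 dqP).
have [rdq0 rdq1] := rdqE.
have -> : ((i == 0) && (j == 1))%:R = jet_at (jet_Q D m0) i j :> A.
  rewrite jet_at_Q !jet_at_mk; case: i => [|i]; case: j => [|[|j]];
    rewrite ?jet_at_mk ?addSn ?add0n /= ?rdq0 ?rdq1 ?expr0 ?mul1r ?mulr0 ?addr0 ?add0r //.
rewrite /mu; congr (jet_at _ i j); apply: funext => k.
have [v uv] := emb_unit one.
rewrite -[LHS]/(sq2 (psi_q_fun one : sqz A (jet_index 1)) k) /psi_q_fun (rinvP uv).
have v1 : sq1 (v : sqz A (jet_index 1)) = 1.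
  by have := congr1 (fun z : sqz A (jet_index 1) => sq1 z) uv; rewrite rmorphM /= mul1r.
by rewrite sq2M /= v1 rdq1 mul0r add0r mul1r.
Qed.

End PsiP.

(** * Injectivity of the Frobenius lift *)

Section Ideals.

Variable A : idomainType.
Implicit Types (I J : A -> Prop) (x y : A).

Definition is_ideal I : Prop :=
  [/\ I 0, forall x y, I x -> I y -> I (x + y) & forall a x, I x -> I (a * x)].

Lemma idealN I x : is_ideal I -> I x -> I (- x).
Proof. by move=> [_ _ IM] Ix; rewrite -mulN1r; apply: IM. Qed.

Lemma idealB I x y : is_ideal I -> I x -> I y -> I (x - y).
Proof. by move=> Ii Ix Iy; have [_ ID _] := Ii; apply: ID => //; apply: idealN. Qed.

Lemma ideal_sum I (T : Type) (r : seq T) (Q : pred T) (F : T -> A) : is_ideal I ->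
  (forall i, Q i -> I (F i)) -> I (\sum_(i <- r | Q i) F i).
Proof. by move=> [I0 ID _] IF; elim/big_ind: _. Qed.

Lemma noetherian_max (F : (A -> Prop) -> Prop) : noetherian A ->
  (forall I, F I -> is_ideal I) -> (exists I, F I) ->
  exists2 I, F I & forall J, F J -> (forall x, I x -> J x) -> forall x, J x -> I x.
Proof.
move=> Anoeth Fid [I0 FI0]; apply: contrapT => nmax.
have step I : exists J, F I -> [/\ F J, forall x, I x -> J x & exists2 x, J x & ~ I x].
  have [FI|nFI] := pselect (F I); last by exists I.
  apply: contrapT => nJ; apply: nmax; exists I => // J FJ IJ x Jx.
  by apply: contrapT => nIx; apply: nJ; exists J => _; split=> //; exists x.
have [s sP] := boolp.choice step.
pose c n := iter n s I0.
have Fc n : F (c n) by elim: n => //= n IHn; have [] := sP _ IHn.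
have cS n x : c n x -> c n.+1 x by have [_ + _] := sP _ (Fc n); apply.
have cle m n x : (m <= n)%N -> c m x -> c n x.
  by move=> /subnK <- cm; elim: (n - m)%N => // k IHk; rewrite addSn; apply: cS.
have [||a x [n cn]|n [g gP]] := Anoeth (fun x => exists n, c n x).
- by exists 0%N; have [] := Fid _ FI0.
- move=> x y [m cx] [n cy]; exists (maxn m n); have [_ + _] := Fid _ (Fc (maxn m n)).
  by apply; [apply: cle cx; apply: leq_maxl|apply: cle cy; apply: leq_maxr].
- by exists n; have [_ _] := Fid _ (Fc n); apply.
have /boolp.choice[k kP] : forall i, exists k, c k (g i).
  move=> i; apply/gP; exists (fun j => (j == i)%:R).
  rewrite (bigD1 i) //= eqxx mul1r big1 ?addr0 // => j /negPf ->; exact: mul0r.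
have [_ _ [x cx ncx]] := sP _ (Fc (\max_i k i)); apply: ncx.
have /gP[d ->] : exists n, c n x by exists (\max_i k i).+1.
apply: ideal_sum => [|i _]; first exact/Fid/Fc.
have [_ _] := Fid _ (Fc (\max_i k i)); apply.
by apply: cle (kP i); apply: leq_bigmax.
Qed.

Definition prime_ideal Q : Prop :=
  [/\ is_ideal Q, ~ Q 1 & forall x y, Q (x * y) -> Q x \/ Q y].

Lemma prime_mul Q x y : prime_ideal Q -> ~ Q x -> ~ Q y -> ~ Q (x * y).
Proof. by move=> [_ _ QM] nx ny /QM[]. Qed.

Lemma prime_exp Q x n : prime_ideal Q -> ~ Q x -> ~ Q (x ^+ n).
Proof.
move=> Qp nx; elim: n => [|n IHn]; first by case: Qp.
by rewrite exprS; apply: prime_mul.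
Qed.

Lemma prime_prod Q (T : finType) (F : T -> A) : prime_ideal Q ->
  (forall i, ~ Q (F i)) -> ~ Q (\prod_i F i).
Proof.
move=> Qp nF; elim/big_ind: _ => [|x y nx ny|i _]; [by case: Qp|exact: prime_mul|exact: nF].
Qed.

(* Cramer's rule, with determinant congruent to the product of the [t i] modulo Q. *)
Lemma nakayama Q K m (x : 'I_m -> A) (t : 'I_m -> A) (c : 'I_m -> 'I_m -> A) :
  prime_ideal Q -> is_ideal K -> (forall i, ~ Q (t i)) -> (forall i j, Q (c i j)) ->
  (forall i, K (t i * x i - \sum_j c i j * x j)) ->
  exists2 d, ~ Q d & forall i, K (d * x i).
Proof.
move=> Qp Kid nt Qc Kx; have [Qid _ _] := Qp.
pose M : 'M[A]_m := \matrix_(i, j) (t i *+ (i == j) - c i j).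
pose X : 'cV[A]_m := \col_i x i.
exists (\det M) => [Qd|i].
  have [_ QD QM] := Qid; apply: (prime_prod (F := fun i => t i - c i i) Qp).
    move=> i Qtc; apply: (nt i); rewrite -[t i](subrK (c i i)); exact: QD.
  have detE : \det M = \prod_i (t i - c i i) +
      \sum_(s : 'S_m | s != 1%g) (-1) ^+ s * \prod_i M i (s i).
    rewrite /determinant (bigD1 1%g) //= odd_perm1 expr0 mul1r; congr (_ + _).
    by apply: eq_bigr => i _; rewrite mxE perm1 eqxx mulr1n.
  have -> : \prod_i (t i - c i i) =
      \det M - \sum_(s : 'S_m | s != 1%g) (-1) ^+ s * \prod_i M i (s i).
    by rewrite detE addrK.
  apply: idealB => //; apply: ideal_sum => // s s1; apply: (QM).
  have [i si] : exists i, s i != i.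
    apply/existsP; apply: contraR s1; rewrite negb_exists => /forallP sP.
    by apply/eqP/permP => i; rewrite perm1; apply/eqP; have := sP i; rewrite negbK.
  rewrite (bigD1 i) //= mulrC; apply: (QM); rewrite mxE eq_sym (negPf si) mulr0n sub0r.
  exact: idealN.
have := congr1 (fun Z : 'cV[A]_m => Z i 0) (congr1 (mulmx^~ X) (mul_adj_mx M)).
rewrite mul_scalar_mx -mulmxA !mxE => <-.
apply: ideal_sum => // j _; have [_ _ KM] := Kid; apply: KM.
rewrite mxE; have := Kx j; congr K; rewrite [RHS](eq_bigr (fun k => t j *+ (j == k) * x k - c j k * x k)).
  rewrite sumrB; congr (_ - _); rewrite (bigD1 j) //= eqxx mulr1n big1 ?addr0 // => k.
  by rewrite eq_sym => /negPf ->; rewrite mulr0n mul0r.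
by move=> k _; rewrite !mxE mulrBl.
Qed.

Inductive ideal_mul I J : A -> Prop :=
| IdealMul0 : ideal_mul I J 0
| IdealMulS a b y : I a -> J b -> ideal_mul I J y -> ideal_mul I J (a * b + y).

Lemma ideal_mul_ideal I J : is_ideal I -> is_ideal (ideal_mul I J).
Proof.
move=> [_ _ IM]; split=> [|x y Ix Iy|a x]; first exact: IdealMul0.
  by elim: Ix => {x} [|a b x Ia Jb _ IHx]; rewrite ?add0r // -addrA; apply: IdealMulS.
elim=> {x} [|b c y Ib Jc _ IHy]; first by rewrite mulr0; apply: IdealMul0.
by rewrite mulrDr mulrA; apply: IdealMulS => //; apply: IM.
Qed.

End Ideals.

(* Krull's argument: P = ker phi is contained in every prime Q minimal over p, but does not
   contain p; so the symbolic powers of P, being stationary at Q, vanish eventually. *)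
Section FrobeniusInjective.

Variables (p : nat) (A : idomainType) (phi : {rmorphism A -> A}).
Hypothesis A_noetherian : noetherian A.
Hypothesis phi_lift : forall x, pmul p 1 (phi x - x ^+ p).
Hypothesis p_neq0 : (p%:R : A) != 0.
Hypothesis p_nunit : ~ pmul p 1 (1 : A).

Let P (x : A) : Prop := phi x = 0.

Lemma ker_prime : prime_ideal P.
Proof.
split; first split.
- exact: rmorph0.
- by move=> x y Px Py; rewrite /P rmorphD Px Py addr0.
- by move=> a x Px; rewrite /P rmorphM Px mulr0.
- by rewrite /P rmorph1 => /eqP; rewrite oner_eq0.
- by move=> x y; rewrite /P rmorphM => /eqP; rewrite mulf_eq0 => /orP[]/eqP; [left|right].
Qed.

Lemma ker_p : ~ P p%:R.
Proof. by rewrite /P rmorph_nat => /eqP; rewrite (negPf p_neq0). Qed.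

Definition rad_p (x : A) : Prop := exists n, pmul p 1 (x ^+ n).

Lemma rad_p_ideal : is_ideal rad_p.
Proof.
split=> [|x y [m xm] [n yn]|a x [n xn]].
- by exists 1%N; rewrite expr1; apply: pmulz.
- exists (m + n)%N; rewrite exprDn; apply: pmul_sum => i _; rewrite -mulr_natl; apply: pmulMl.
  have [ni|ni] := leqP n i.
    by apply: pmulMl; rewrite -(subnKC ni) exprD; apply: pmulMr.
  apply: pmulMr; have -> : (m + n - i = m + (n - i))%N by lia.
  by rewrite exprD; apply: pmulMr.
- by exists n; rewrite exprMn; apply: pmulMl.
Qed.

Lemma ker_rad x : P x -> rad_p x.
Proof.
move=> Px; exists p; rewrite -[x ^+ p]opprK; apply: pmulN.
by have := phi_lift x; rewrite Px sub0r.
Qed.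

(** Q is a maximal element among the ideals (rad p : s) with s outside rad p, hence prime. The
    witness s is kept: it is invertible at Q and shows that elements of Q are nilpotent modulo p
    there. *)
Lemma minimal_prime : exists Q s, [/\ prime_ideal Q, ~ Q s,
  forall x, P x -> Q x, Q p%:R & forall x, Q x -> rad_p (s * x)].
Proof.
have Rid := rad_p_ideal; have [R0 RD RM] := Rid.
pose F I := exists2 s, ~ rad_p s & I = (fun x => rad_p (s * x)).
have [||Q [s ns ->] Qmax] := @noetherian_max A F A_noetherian.
- move=> _ [s _ ->]; split=> [|x y Rx Ry|a x Rx]; first by rewrite mulr0.
    by rewrite mulrDr; apply: RD.
  by rewrite mulrCA; apply: RM.
- exists (fun x => rad_p (1 * x)), 1 => // -[n]; rewrite expr1n; exact: p_nunit.
exists (fun x => rad_p (s * x)), s; split=> //.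
- split=> [||x y Rxy].
  + split=> [|x y Rx Ry|a x Rx]; first by rewrite mulr0.
      by rewrite mulrDr; apply: RD.
    by rewrite mulrCA; apply: RM.
  + by rewrite mulr1.
  + have [Rx|nRx] := pselect (rad_p (s * x)); [by left|right].
    apply: (Qmax (fun z => rad_p (s * x * z))); [by exists (s * x)| |by rewrite -mulrA].
    by move=> z Rz; rewrite mulrAC mulrC; apply: RM.
- by move=> [n ssn]; apply: ns; exists (n + n)%N; rewrite exprD -exprMn.
- by move=> x /ker_rad Rx; apply: RM.
- by apply: RM; exists 1%N, 1; rewrite mulr1.
Qed.

(* The n-th symbolic power of P. *)
Fixpoint ker_pow (n : nat) : A -> Prop :=
  if n is m.+1 then fun x => exists2 t, ~ P t & ideal_mul P (ker_pow m) (t * x)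
  else fun=> True.

Lemma ker_pow_ideal n : is_ideal (ker_pow n).
Proof.
have [[P0 PD PM] P1 _] := ker_prime.
case: n => [|n]; first by split.
have [I0 ID IM] := ideal_mul_ideal (ker_pow n) (And3 P0 PD PM).
split=> [|x y [t nt tx] [u nu uy]|a x [t nt tx]].
- by exists 1 => //; rewrite mulr0.
- exists (t * u); first exact: prime_mul ker_prime _ _.
  have -> : t * u * (x + y) = u * (t * x) + t * (u * y) by ring.
  by apply: ID; apply: IM.
- by exists t => //; rewrite mulrCA; apply: IM.
Qed.

Lemma ker_pow_sat n t x : ~ P t -> ker_pow n (t * x) -> ker_pow n x.
Proof.
case: n => [|n] //= nt [u nu utx].
by exists (u * t); [apply: prime_mul ker_prime _ _|rewrite -mulrA].
Qed.

Lemma ker_pow_dec m n x : (m <= n)%N -> ker_pow n x -> ker_pow m x.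
Proof.
move=> /subnK <-; elim: (n - m)%N x => // k IHk x [t nt tx]; apply: IHk.
apply: (ker_pow_sat nt); have [K0 KD KM] := ker_pow_ideal (k + m).
by elim: tx => // a b y _ Kb _ Ky; apply: KD => //; apply: KM.
Qed.

Lemma ker_pow_exp n x : P x -> ker_pow n (x ^+ n).
Proof.
move=> Px; elim: n => // n IHn; exists 1; first by case: ker_prime.
by rewrite mul1r exprS -[_ * _]addr0; apply: IdealMulS => //; apply: IdealMul0.
Qed.

Section MinimalPrime.

Variables (Q : A -> Prop) (s : A).
Hypotheses (Q_prime : prime_ideal Q) (ns : ~ Q s) (PQ : forall x, P x -> Q x).
Hypotheses (Qp : Q p%:R) (Q_rad : forall x, Q x -> rad_p (s * x)).

(* The images of the [ker_pow n] in the localization of A/J at Q are stationary. *)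
Definition stationary (J : A -> Prop) : Prop := exists N, forall n x,
  (N <= n)%N -> ker_pow n x -> exists t k j,
    [/\ ~ Q t, ker_pow n.+1 k, J j & t * x = k + j].

(** Noetherian induction stands in for the finite length of (A/J)_Q. In a maximal counterexample J,
    adjoining a socle element z makes the chain stationary, and stationarity is then brought back to
    J. *)
Lemma ideal_stationary J : is_ideal J -> J p%:R -> stationary J.
Proof.
move=> Jid Jp; apply: contrapT => nJ.
pose F I := [/\ is_ideal I, I p%:R & ~ stationary I].
have [||{}J [{}Jid {}Jp {}nJ] Jmax] := @noetherian_max A F A_noetherian.
- by move=> I [].
- by exists J.
have [J0 JD JM] := Jid; have [Qid nQ1 _] := Q_prime.
(* The saturation of J at Q is a counterexample too, so it is J by maximality. *)
have Jsat t x : ~ Q t -> J (t * x) -> J x.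
  move=> nt Jtx; apply: (Jmax (fun y => exists2 t, ~ Q t & J (t * y))); last by exists t.
    split; first split.
    - by exists 1 => //; rewrite mulr0.
    - move=> y z [u nu uy] [v nv vz]; exists (u * v); first exact: prime_mul Q_prime _ _.
      have -> : u * v * (y + z) = v * (u * y) + u * (v * z) by ring.
      by apply: (JD); apply: (JM).
    - by move=> a y [u nu uy]; exists u => //; rewrite mulrCA; apply: (JM).
    - by exists 1 => //; rewrite mul1r.
    - case=> N HN; apply: nJ; exists N => n y Nn /(HN n y Nn)[u [k [j [nu Kk [v nv vj] E]]]].
      exists (v * u), (v * k), (v * j); split=> //; first exact: prime_mul Q_prime _ _.
        by have [_ _ KM] := ker_pow_ideal n.+1; apply: (KM).
      by rewrite -mulrA E mulrDr.
  by move=> y Jy; exists 1 => //; rewrite mul1r.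
have J1 : ~ J 1.
  move=> J1; apply: nJ; exists 0%N => n x _ _; exists 1, 0, x; split=> //.
  - by have [K0 _ _] := ker_pow_ideal n.+1.
  - by rewrite -[x]mulr1; apply: (JM).
  - by rewrite mul1r add0r.
have Jrad q : Q q -> exists n, J (q ^+ n).
  move=> /Q_rad[n [y sqn]]; exists n; apply: (Jsat (s ^+ n)); first exact: prime_exp Q_prime _.
  by rewrite -exprMn sqn expr1 mulrC; apply: (JM).
(* z spans a line of (A/J)_Q killed by Q, so enlarging J by z changes little. *)
have [z nz Qz] : exists2 z, ~ J z & forall q, Q q -> J (q * z).
  pose F' I := exists2 z, ~ J z & I = (fun a => J (a * z)).
  have [||I [z nz ->] zmax] := @noetherian_max A F' A_noetherian.
  - move=> _ [w _ ->]; split=> [|x y Jx Jy|a x Jx]; first by rewrite mul0r.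
      by rewrite mulrDl; apply: (JD).
    by rewrite -mulrA; apply: (JM).
  - by exists (fun a => J (a * 1)), 1.
  exists z => // q /Jrad[n Jqn]; apply: contrapT => nqz.
  have nqk k : ~ J (q ^+ k * z).
    elim: k => [|k IHk]; first by rewrite expr0 mul1r.
    rewrite exprS -mulrA => Jq; apply: nqz.
    apply: (zmax (fun a => J (a * (q ^+ k * z)))) => //; first by exists (q ^+ k * z).
    by move=> a Ja; rewrite mulrCA; apply: (JM).
  by apply: (nqk n); rewrite mulrC; apply: (JM).
have [N HN] : stationary (fun x => exists j a, J j /\ x = j + a * z).
  apply: contrapT => nst; apply: nz.
  apply: (Jmax (fun x => exists j a, J j /\ x = j + a * z)); last by exists 0, 1; rewrite mul1r add0r.
    split=> //; last by exists p%:R, 0; rewrite mul0r addr0.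
    split.
    - by exists 0, 0; rewrite mul0r addr0.
    - move=> _ _ [i [a [Ji ->]]] [j [b [Jj ->]]]; exists (i + j), (a + b).
      by split; [apply: (JD)|ring].
    - move=> b _ [i [a [Ji ->]]]; exists (b * i), (b * a).
      by split; [apply: (JM)|ring].
  by move=> x Jx; exists x, 0; rewrite mul0r addr0.
apply: nJ.
(* Either z belongs to every [ker_pow n] + J up to a factor outside Q, and the term a z is absorbed
   there, or this fails at some n0, which forces a into Q, so that a z lies in J. *)
have [zK|/existsNP[n0 zK]] := pselect (forall n, exists t k j,
    [/\ ~ Q t, ker_pow n k, J j & t * z = k + j]).
  exists N => n x Nn /(HN n x Nn)[t [k [_ [nt Kk [j [a [Jj ->]]] E]]]].
  have [u [k' [j' [nu Kk' Jj' E']]]] := zK n.+1.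
  have [_ KD KM] := ker_pow_ideal n.+1.
  exists (u * t), (u * k + a * k'), (u * j + a * j'); split.
  - exact: prime_mul Q_prime _ _.
  - by apply: (KD); apply: (KM).
  - by apply: (JD); apply: (JM).
  - by rewrite -mulrA E !mulrDr mulrCA E' mulrDr; ring.
exists (maxn N n0) => n x; rewrite geq_max => /andP[Nn n0n] Kx.
have [t [k [_ [nt Kk [j [a [Jj ->]]] E]]]] := HN n x Nn Kx.
exists t, k, (j + a * z); split=> //; apply: (JD) => //; apply: Qz.
apply: contrapT => nQa; apply: zK; exists a, (t * x - k), (- j); split=> //.
- have Kid := ker_pow_ideal n0; have [_ _ KM] := Kid; apply: idealB => //.
    by apply: (KM); apply: ker_pow_dec Kx.
  by apply: ker_pow_dec Kk; apply: leqW.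
- exact: idealN.
- by rewrite E; ring.
Qed.

End MinimalPrime.

(** Let K_n be [ker_pow n]. Nakayama at Q upgrades stationarity modulo p to K_N = K_(N+1); Nakayama
    at P then gives K_N = 0, while x^N lies in K_N. *)
Lemma phi_inj x : phi x = 0 -> x = 0.
Proof.
move=> Px; have [Q [s [Q_prime ns PQ Qp Q_rad]]] := minimal_prime.
have [||N HN] := @ideal_stationary Q s Q_prime ns Q_rad (pmul p 1).
- split; [exact: pmulz|exact: pmulD|by move=> a y; apply: pmulMl].
- by exists 1; rewrite mulr1.
have Kid := ker_pow_ideal N; have [K0 KD KM] := Kid.
have [m [g gP]] := A_noetherian K0 KD KM.
have Kg i : ker_pow N (g i).
  apply/gP; exists (fun j => (j == i)%:R).
  rewrite (bigD1 i) //= eqxx mul1r big1 ?addr0 // => j /negPf ->; exact: mul0r.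
(* As p is outside P and K_N is saturated, p y in K_N implies y in K_N. So, locally at Q, K_N is
   contained in K_(N+1) + p K_N, with p in Q. *)
have KSg i : ker_pow N.+1 (g i).
  have /boolp.choice[t tP] : forall i, exists t, ~ Q t /\ exists c : 'I_m -> A,
      ker_pow N.+1 (t * g i - \sum_j p%:R * c j * g j).
    move=> {}i; have [t [k [_ [nt Kk [y ->] E]]]] := HN N (g i) (leqnn N) (Kg i).
    exists t; split=> //; have /gP[c yE] : ker_pow N y.
      apply: (ker_pow_sat ker_p); have -> : p%:R * y = t * g i - k by rewrite E expr1; ring.
      by apply: idealB => //; [apply: (KM)|apply: ker_pow_dec Kk].
    exists c; under eq_bigr do rewrite -mulrA.
    by rewrite -mulr_sumr -yE E expr1 addrK.
  have /boolp.choice[c cP] : forall i, exists c : 'I_m -> A,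
    ker_pow N.+1 (t i * g i - \sum_j p%:R * c j * g j) by move=> {}i; have [_] := tP i.
  have [|i'|i' j|i'|d nd dg] :=
    @nakayama A Q (ker_pow N.+1) m g t (fun i j => p%:R * c i j) Q_prime.
  - exact: ker_pow_ideal.
  - by have [] := tP i'.
  - by have [[_ _ QM] _ _] := Q_prime; rewrite mulrC; apply: (QM).
  - exact: cP.
  by apply: (@ker_pow_sat N.+1 d); [move=> /PQ|apply: dg].
(* Locally at P, K_N = K_(N+1) is P K_N; Nakayama provides d outside P killing K_N, and A is a
   domain. *)
have g0 i : g i = 0.
  have /boolp.choice[t tP] : forall i, exists t, ~ P t /\ exists c : 'I_m -> A,
      (forall j, P (c j)) /\ t * g i = \sum_j c j * g j.
    move=> {}i; have [t nt tg] := KSg i; exists t; split=> //.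
    elim: tg => [|a _ y Pa /gP[d ->] _ [c [Pc ->]]].
      by exists (fun=> 0); split=> [j|]; [rewrite /P rmorph0|rewrite big1 // => j _; rewrite mul0r].
    exists (fun j => a * d j + c j); split=> [j|].
      by have := Pc j; rewrite /P rmorphD rmorphM Pa mul0r add0r.
    by rewrite mulr_sumr -big_split; apply: eq_bigr => j _; rewrite mulrDl mulrA.
  have /boolp.choice[c cP] : forall i, exists c : 'I_m -> A,
    (forall j, P (c j)) /\ t i * g i = \sum_j c j * g j by move=> {}i; have [_] := tP i.
  have [|i'|i' j|i'|d nd dg] := @nakayama A P (fun y => y = 0) m g t c ker_prime.
  - by split=> [|u v -> ->|u v ->] //; rewrite ?addr0 ?mulr0.
  - by have [] := tP i'.
  - by have [] := cP i'.
  - by have [_ ->] := cP i'; rewrite subrr.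
  have /eqP := dg i; rewrite mulf_eq0 => /orP[]/eqP // d0.
  by case: nd; rewrite d0 /P rmorph0.
have /gP[c xN] := ker_pow_exp N Px.
have : x ^+ N = 0 by rewrite xN big1 // => i _; rewrite g0 mulr0.
by move/eqP; rewrite expf_eq0 => /andP[_ /eqP].
Qed.

End FrobeniusInjective.

Lemma rfrob_inj (p : nat) (A : idomainType) (D : dpq_ring p A) : prime p ->
  padic_complete p A -> noetherian A -> [pchar A] =i pred0 ->
  forall x, rfrob D x = 0 -> x = 0.
Proof.
move=> pr_p A_complete A_noetherian A_char0.
pose f := frob_rmorphism pr_p (rdp_pder D).
apply: (@phi_inj p A f A_noetherian).
- by move=> x; exists (rdp D x); rewrite expr1 -[f x]/(_ ^+ p + _) /= addrC addKr.
- apply: natr_neq0 => //; exact: prime_gt0.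
- move=> p1; have [sep _] := A_complete.
  have /sep/eqP : forall k, pmul p k (1 : A).
    elim=> [|k IHk]; first exact: pmul0.
    by rewrite -[1]mulr1 -addn1; apply: pmulM.
  by rewrite oner_eq0.
Qed.

(** * Extension to the fraction field *)

Lemma quotient_ruleD (K : fieldType) (a b c d a' b' c' d' : K) : b != 0 -> d != 0 ->
  ((a * d' + d * a' + (c * b' + b * c')) * (b * d) - (a * d + c * b) * (b * d' + d * b'))
    / (b * d) ^+ 2 = (a' * b - a * b') / b ^+ 2 + (c' * d - c * d') / d ^+ 2.
Proof. by move=> b0 d0; field; rewrite b0 d0. Qed.

Lemma quotient_ruleM (K : fieldType) (a b c d a' b' c' d' : K) : b != 0 -> d != 0 ->
  ((a * c' + c * a') * (b * d) - a * c * (b * d' + d * b')) / (b * d) ^+ 2 =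
  a / b * ((c' * d - c * d') / d ^+ 2) + c / d * ((a' * b - a * b') / b ^+ 2).
Proof. by move=> b0 d0; field; rewrite b0 d0. Qed.

Section FractionExtension.

Variables (p : nat) (pr_p : prime p) (A : idomainType) (D : dpq_ring p A).
Hypothesis rfrob_inj : forall x, rfrob D x = 0 -> x = 0.
Local Notation L := {fraction A}.
Local Notation "x %:F" := (@FracField.tofrac _ x).

Lemma fractionP (x : L) : exists ab : A * A, ab.2 != 0 /\ x = ab.1%:F / ab.2%:F.
Proof.
elim/quotW: x => r; exists (\n_r, \d_r); split; first exact: denom_ratioP.
apply: (canRL (mulfK _)); first by rewrite tofrac_eq0 denom_ratioP.
rewrite -[LHS]/(FracField.mul _ _) !piE; apply/eqmodP => /=.
rewrite FracField.equivfE !numden_Ratio ?oner_eq0 ?mulr1 ?denom_ratioP //.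
by rewrite mulrC.
Qed.

Definition fnum (x : L) : A := (sval (cid (fractionP x))).1.
Definition fden (x : L) : A := (sval (cid (fractionP x))).2.

Lemma fden_neq0 x : fden x != 0.
Proof. by rewrite /fden; case: (cid _) => ab []. Qed.

Lemma fnum_fden x : x = (fnum x)%:F / (fden x)%:F.
Proof. by rewrite {1}(svalP (cid (fractionP x))).2. Qed.

Let f : {rmorphism A -> A} := frob_rmorphism pr_p (rdp_pder D).
Let q : A -> A := rdq D.

Let qD a b : q (a + b) = q a + q b. Proof. exact: rdqD. Qed.
Let qM a b : q (a * b) = a * q b + b * q a. Proof. exact: rdqM. Qed.

Let f_neq0 a : a != 0 -> (f a)%:F != 0 :> L.
Proof. by rewrite tofrac_eq0; apply: contraNneq => /rfrob_inj ->. Qed.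

Lemma frac_cross (a b c d : A) : b != 0 -> d != 0 ->
  a%:F / b%:F = c%:F / d%:F :> L -> a * d = c * b.
Proof.
move=> b0 d0 /eqP; rewrite eqr_div ?tofrac_eq0 // -!tofracM tofrac_eq => /eqP //.
Qed.

Definition frac_frob (x : L) : L := (f (fnum x))%:F / (f (fden x))%:F.

Lemma frac_frobE a b : b != 0 -> frac_frob (a%:F / b%:F) = (f a)%:F / (f b)%:F.
Proof.
move=> b0; apply/eqP; rewrite /frac_frob eqr_div ?f_neq0 ?fden_neq0 //.
rewrite -!tofracM -!rmorphM; apply/eqP; congr (_ (f _)).
by apply: (frac_cross (fden_neq0 _) b0); rewrite -fnum_fden.
Qed.

Definition frac_dq (x : L) : L :=
  (q (fnum x) * fden x - fnum x * q (fden x))%:F / (fden x ^+ 2)%:F.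

Lemma frac_dqE a b : b != 0 ->
  frac_dq (a%:F / b%:F) = (q a * b - a * q b)%:F / (b ^+ 2)%:F.
Proof.
move=> b0; rewrite /frac_dq; set x : L := a%:F / b%:F; have d0 := fden_neq0 x.
apply/eqP; rewrite eqr_div ?tofrac_eq0 ?expf_neq0 // -!tofracM tofrac_eq.
have h : a * fden x = fnum x * b by apply: frac_cross => //; rewrite -fnum_fden.
(* The derivative of the cross relation h; the two together make the quotient rule independent of
   the chosen fraction. *)
have h' : a * q (fden x) + fden x * q a = fnum x * q b + b * q (fnum x) by rewrite -!qM h.
set c := fnum x in h h' *; set d := fden x in h h' *.
have -> : (q c * d - c * q d) * b ^+ 2 =
  b * d * (c * q b + b * q c) - d * (c * b) * q b - b * (c * b) * q d by ring.
by rewrite -h' -h; apply/eqP; ring.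
Qed.

Lemma fraction_ind (Q : L -> Prop) :
  (forall a b, b != 0 -> Q (a%:F / b%:F)) -> forall x, Q x.
Proof. by move=> Qab x; rewrite (fnum_fden x); apply/Qab/fden_neq0. Qed.

Lemma frac_frob_zmod : zmod_morphism frac_frob.
Proof.
elim/fraction_ind=> a b b0; elim/fraction_ind=> c d d0.
rewrite -mulNr addf_div ?tofrac_eq0 // mulNr -!tofracM -tofracB.
rewrite !frac_frobE ?mulf_neq0 // -[in RHS]mulNr addf_div ?f_neq0 //.
by rewrite rmorphB !rmorphM /= tofracB !tofracM mulNr.
Qed.

Lemma frac_frob_monoid : monoid_morphism frac_frob.
Proof.
split=> [|]; first by rewrite -[1]divr1 -tofrac1 frac_frobE ?oner_eq0 // rmorph1.
elim/fraction_ind=> a b b0; elim/fraction_ind=> c d d0.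
by rewrite mulf_div -!tofracM !frac_frobE ?mulf_neq0 // mulf_div -!tofracM -!rmorphM.
Qed.

Definition frac_frob_rmorphism : {rmorphism L -> L} :=
  HB.pack frac_frob (GRing.isZmodMorphism.Build L L frac_frob frac_frob_zmod)
    (GRing.isMonoidMorphism.Build L L frac_frob frac_frob_monoid).

Lemma frac_dq_der : is_der idfun frac_dq.
Proof.
split; elim/fraction_ind=> a b b0; elim/fraction_ind=> c d d0 /=;
  have bF : b%:F != 0 :> L by rewrite tofrac_eq0.
all: have dF : d%:F != 0 :> L by rewrite tofrac_eq0.
- rewrite addf_div // -!tofracM -tofracD !frac_dqE ?mulf_neq0 // qD !qM.
  by rewrite !(tofracXn, tofracB, tofracM, tofracD) -quotient_ruleD.
- rewrite mulf_div -!tofracM !frac_dqE ?mulf_neq0 // !qM.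
  by rewrite !(tofracXn, tofracB, tofracM, tofracD) quotient_ruleM.
Qed.

Lemma frac_extension : inhabited (frac_ext D).
Proof.
have toF a : a%:F = a%:F / 1%:F :> L by rewrite tofrac1 divr1.
split; apply: (@FracExt p A D frac_frob_rmorphism frac_dq) => [a||a].
- by rewrite toF [LHS]frac_frobE ?oner_eq0 // rmorph1 tofrac1 divr1.
- exact: frac_dq_der.
- by rewrite toF frac_dqE ?oner_eq0 // /q rdq1 mulr0 subr0 mulr1 expr1n tofrac1 divr1.
Qed.

End FractionExtension.

(** * The basis *)

Section FamilyCoefficients.

Variables (p : nat) (R : comPzRingType) (r : nat).

(* The eps_kl-coordinate of the member of index x of the family. *)
Definition family_coef (x : 'I_r + pq_index r) (k l : nat) : R :=
  match x with
  | inl i => p%:R ^+ i * (((k == i.+1) && (l == 0%N))%:R - ((k == i) && (l == 0%N))%:R)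
  | inr ij => p%:R ^+ (val ij).1 * ((k == (val ij).1) && (l == (val ij).2.+1))%:R
  end.

Variable c : 'I_r + pq_index r -> R.

Lemma family_coef_sum_q (ij : pq_index r) :
  \sum_x c x * family_coef x (val ij).1 (val ij).2.+1 = p%:R ^+ (val ij).1 * c (inr ij).
Proof.
rewrite (bigD1 (inr ij)) //= !eqxx mulr1 mulrC big1 ?addr0 // => -[i|kl] /= nij.
  by rewrite !andbF subrr !mulr0.
case: eqP => [e1|]; case: eqP => [[e2]|]; rewrite ?mulr0 //.
case/eqP: nij; congr inr; apply: val_inj.
by rewrite [LHS]surjective_pairing [RHS]surjective_pairing (val_inj e1) (val_inj e2).
Qed.

Lemma family_coef_sum_out k l : (r <= k + l)%N -> \sum_x c x * family_coef x k l.+1 = 0.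
Proof.
move=> rkl; apply: big1 => -[i|[kl lt_kl]] _ /=; first by rewrite !andbF subrr !mulr0.
case: eqP => [e1|]; case: eqP => [[e2]|]; rewrite ?mulr0 //.
by have := lt_kl; rewrite -e1 -e2 ltnNge rkl.
Qed.

(** This is p^k c_k, extended by zero for k >= r. Since phi^i psi_p contributes p^i (eps_(i+1, 0) -
    eps_(i, 0)), the (k+1, 0)-coordinate of a combination is a difference of two consecutive
    values. *)
Definition family_tail (k : nat) : R := \sum_(i < r | i == k :> nat) p%:R ^+ i * c (inl i).

Lemma family_tail_lt (i : 'I_r) : family_tail i = p%:R ^+ i * c (inl i).
Proof. by rewrite /family_tail (big_pred1 i) // => j; rewrite -val_eqE. Qed.

Lemma family_tail_ge k : (r <= k)%N -> family_tail k = 0.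
Proof. by move=> rk; apply: big_pred0 => i; apply: ltn_eqF; apply: leq_trans rk. Qed.

Lemma family_coef_sum_p k :
  \sum_x c x * family_coef x k.+1 0 = family_tail k - family_tail k.+1.
Proof.
rewrite big_sumType /= [X in _ + X]big1 ?addr0; last by move=> i _; rewrite andbF !mulr0.
rewrite /family_tail [X in _ = X - _]big_mkcond [X in _ = _ - X]big_mkcond -sumrB; apply: eq_bigr => i _.
rewrite !andbT eqSS [k == _]eq_sym [k.+1 == _]eq_sym mulrA [c _ * _]mulrC mulrBr.
by congr (_ - _); case: ifP; rewrite ?mulr1 ?mulr0.
Qed.

End FamilyCoefficients.

Section Basis.

Variables (p : nat) (pr_p : prime p) (A : idomainType) (D : dpq_ring p A).
Hypothesis A_complete : padic_complete p A.
Hypothesis A_char0 : [pchar A] =i pred0.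
Local Notation L := {fraction A}.
Local Notation "x %:F" := (@FracField.tofrac _ x).
Local Notation mu := (mu pr_p A_complete).
Local Notation psi_p := (psi_p pr_p D).
Local Notation psi_q := (psi_q D).

Lemma mu_zero r i j : mu (lm_zero : char_mod D r) i j = 0.
Proof. by rewrite -(lm_scale0 lm_zero) mu_scale mul0r. Qed.

Lemma mu_iter_emb k r (x : char_mod D r) i j : mu (iter_emb k x) i j = mu x i j.
Proof. by elim: k => //= k IHk; rewrite mu_emb. Qed.

Lemma mu_cast r s (e : r = s) (x : char_mod D r) i j : mu (char_cast e x) i j = mu x i j.
Proof. by case: s / e. Qed.

Lemma mu_incl r s (le_sr : (s <= r)%N) (x : char_mod D s) i j :
  mu (char_incl le_sr x) i j = mu x i j.
Proof. by rewrite mu_cast mu_iter_emb. Qed.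

Let f : {rmorphism A -> A} := frob_rmorphism pr_p (rdp_pder D).

Lemma mu_iter_psi_p i k l : mu (iter_frob pr_p i psi_p) k l =
  p%:R ^+ i * (((k == i.+1) && (l == 0%N))%:R - ((k == i) && (l == 0%N))%:R).
Proof.
elim: i k => [|i IHi] k; first by rewrite mu_psi_p mul1r.
rewrite mu_frob; case: k => [|k] /=; first by rewrite subrr !mulr0.
rewrite IHi -[rfrob D _]/(f _) rmorphM rmorphB rmorphXn !rmorph_nat exprS.
by rewrite mulrA.
Qed.

Lemma mu_iter_dq_psi_q j k l :
  mu (iter_dq j psi_q) k l = ((k == 0%N) && (l == j.+1))%:R.
Proof.
have [dqP _] := rdq_dpder D.
elim: j k l => [|j IHj] k l; first by rewrite mu_psi_q.
rewrite mu_dq IHj (der_nat dqP) add0r; case: l => [|l]; first by rewrite mulr0 andbF.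
rewrite IHj eqSS; case: eqP => [->|_] /=; last by rewrite mulr0.
by rewrite mul1r.
Qed.

Lemma mu_iter_psi_q i j k l : mu (iter_frob pr_p i (iter_dq j psi_q)) k l =
  p%:R ^+ i * ((k == i) && (l == j.+1))%:R.
Proof.
elim: i k => [|i IHi] k; first by rewrite mu_iter_dq_psi_q mul1r.
rewrite mu_frob; case: k => [|k] /=; first by rewrite !mulr0.
by rewrite IHi -[rfrob D _]/(f _) rmorphM rmorphXn !rmorph_nat exprS mulrA.
Qed.

Definition family r (x : 'I_r + pq_index r) : char_mod D r :=
  match x with
  | inl i => char_incl (ord_add1 i) (iter_frob pr_p i psi_p)
  | inr ij => char_incl (pq_index_add1 ij)
      (iter_frob pr_p (val ij).1 (iter_dq (val ij).2 psi_q))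
  end.

Lemma mu_family r (x : 'I_r + pq_index r) k l : mu (family x) k l = family_coef p A x k l.
Proof. by case: x => [i|ij]; rewrite mu_incl ?mu_iter_psi_p ?mu_iter_psi_q. Qed.

Lemma mu_family_sum r (c : 'I_r + pq_index r -> A) k l :
  mu (\sum_(x : 'I_r + pq_index r) c x *: family x)%LM k l =
  \sum_x c x * family_coef p A x k l.
Proof.
rewrite (big_morph (fun x => mu x k l) (fun x y => mu_add _ _ x y k l) (mu_zero r k l)).
by apply: eq_bigr => x _; rewrite mu_scale mu_family.
Qed.

Lemma family_span r (psi : char_mod D r) : exists c : 'I_r + pq_index r -> A,
  (p%:R ^+ r *: psi)%LM = (\sum_(x : 'I_r + pq_index r) c x *: family x)%LM.
Proof.
(* The solution of s k - s (k+1) = mu_(k+1, 0) with s r = 0, inverting [family_coef_sum_p]. The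
   factors p^(r-i) in [c] complete the p^i of each member to p^r. *)
pose s k := \sum_(k.+1 <= l < r.+1) mu psi l 0.
pose c (x : 'I_r + pq_index r) := match x with
  | inl i => p%:R ^+ (r - i) * s i
  | inr ij => p%:R ^+ (r - (val ij).1) * mu psi (val ij).1 (val ij).2.+1 end.
exists c; set y := (X in _ = X).
have tailE k : family_tail p c k = p%:R ^+ r * s k.
  have [rk|kr] := leqP r k; first by rewrite family_tail_ge // /s big_geq ?mulr0.
  by rewrite (family_tail_lt p c (Ordinal kr)) /= mulrA -exprD subnKC // ltnW.
pose z : char_mod D r := (p%:R ^+ r *: psi + -1 *: y)%LM.
have z_mu i j : (0 < i + j)%N -> mu z i j = 0.
  rewrite /z mu_add !mu_scale /y mu_family_sum mulN1r; case: j => [|j].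
    case: i => // i _; rewrite family_coef_sum_p !tailE -mulrBr -mulrBr /s.
    have [ri|ir] := ltnP r i.+1; first by rewrite !big_geq ?mu_out ?subrr ?mulr0 //; lia.
    by rewrite big_ltn // addrK subrr mulr0.
  move=> _; have [rij|ijr] := leqP r (i + j).
    by rewrite family_coef_sum_out // mu_out ?mulr0 ?subr0 // addnS ltnS.
  have ir : (i < r)%N by lia.
  have jr : (j < r)%N by lia.
  pose ij : pq_index r := exist _ (Ordinal ir, Ordinal jr) ijr.
  by rewrite (family_coef_sum_q p c ij) /= mulrA -exprD subnKC ?subrr // ltnW.
apply: gm_charP => S u; apply/eqP; rewrite -subr_eq0; apply/eqP.
have := char_vanish A_char0 (jet_poly A) z_mu u.
by rewrite -[z S u]/(_ + cs_str S r (-1) * y S u) rmorphN rmorph1 mulN1r.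
Qed.

End Basis.

(** * Generation over the skew ring *)

Definition self_lmodule (R : comPzRingType) : lmodule R :=
  @LModule R R 0 +%R -%R *%R (@addrA R) (@addrC R) (@add0r R) (@addNr R)
    (@mulrA R) (@mul1r R) (@mulrDr R) (fun x a b => mulrDl a b x).

Section Combinations.

Variables (R : pzRingType) (M : lmodule R).

Lemma lm_addACA (a b c d : M) : (a + b + (c + d) = a + c + (b + d))%LM.
Proof.
rewrite -!lm_addA; congr (_ + _)%LM.
by rewrite !lm_addA; congr (_ + _)%LM; rewrite lm_addC.
Qed.

Lemma lm_scale_sum (I : finType) a (F : I -> M) :
  (a *: \sum_(i : I) F i)%LM = (\sum_(i : I) a *: F i)%LM.
Proof. exact: (big_morph (lm_scale a) (lm_scaleDr a) (lm_scaler0 M a)). Qed.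

Definition lin_span (I : finType) (e : I -> M) (v : M) : Prop :=
  exists c : I -> R, v = (\sum_(i : I) c i *: e i)%LM.

Lemma lin_span0 (I : finType) (e : I -> M) : lin_span e lm_zero.
Proof. by exists (fun=> 0); rewrite big1 // => i _; rewrite lm_scale0. Qed.

Lemma lin_spanD (I : finType) (e : I -> M) u v :
  lin_span e u -> lin_span e v -> lin_span e (u + v)%LM.
Proof.
move=> [c ->] [d ->]; exists (fun i => c i + d i); rewrite -big_split.
by apply: eq_bigr => i _; rewrite lm_scaleDl.
Qed.

Lemma lin_spanZ (I : finType) (e : I -> M) a v : lin_span e v -> lin_span e (a *: v)%LM.
Proof.
move=> [c ->]; exists (fun i => a * c i); rewrite lm_scale_sum.
by apply: eq_bigr => i _; rewrite lm_scaleA.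
Qed.

End Combinations.

(** * Induction and linear forms on a base change *)

Section BaseChangeTheory.

Variables (A B : comPzRingType) (f : {rmorphism A -> B}) (M : lmodule A).

Lemma base_change_ind (P : base_change f M -> Prop) :
  P lm_zero -> (forall u v, P u -> P v -> P (u + v)%LM) ->
  (forall b v, P v -> P (b *: v)%LM) -> (forall x, P (tens f x)) -> forall v, P v.
Proof.
move=> P0 PD PZ Pt; elim/pres_ind; elim=> [|[b x] s IHs] //.
by rewrite pres_cons; apply: PD => //; apply: PZ; apply: Pt.
Qed.

Lemma tens0 : tens f (lm_zero : M) = lm_zero.
Proof. by rewrite -(lm_scale0 lm_zero) tensZ rmorph0 lm_scale0. Qed.

Lemma tens_sum (I : finType) (F : I -> M) :
  tens f (\sum_(i : I) F i)%LM = (\sum_(i : I) tens f (F i))%LM.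
Proof. exact: (@big_morph _ _ (tens f (M := M)) lm_zero lm_add lm_zero lm_add (@tensD _ _ f M) tens0). Qed.

Variable m : M -> A.
Hypothesis mD : forall x y, m (x + y)%LM = m x + m y.
Hypothesis mZ : forall a x, m (a *: x)%LM = a * m x.

(** Extends the A-linear coordinates [mu] to the base change, so that they can test relations with
    coefficients in L. *)
Definition base_change_form : base_change f M -> self_lmodule B :=
  pres_lift (fun b x => b * f (m x) : self_lmodule B).

Let formD a b x : ((a + b) * f (m x) : self_lmodule B) = a * f (m x) + b * f (m x).
Proof. exact: mulrDl. Qed.

Let formR b s t : tens_rel f s t ->
  flift (fun b x => b * f (m x) : self_lmodule B) (fscale b s) =
  flift (fun b x => b * f (m x) : self_lmodule B) (fscale b t).
Proof.
case=> [x y|a x]; rewrite !(fscale_cons, fscale_nil, flift_cons, flift_nil) !lm_addr0 !mulr1.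
- by rewrite mD rmorphD mulrDr.
- by rewrite mZ rmorphM mulrA.
Qed.

Lemma base_change_formD u v :
  base_change_form (u + v)%LM = base_change_form u + base_change_form v.
Proof. exact: pres_liftD formD formR _ _. Qed.

Lemma base_change_formE b x : base_change_form (b *: tens f x)%LM = b * f (m x).
Proof. exact: pres_lift_gen formD formR _ _. Qed.

Lemma base_change_form0 : base_change_form lm_zero = 0.
Proof.
by apply: (addrI (base_change_form lm_zero)); rewrite -base_change_formD lm_add0 addr0.
Qed.

Lemma base_change_form_sum (I : finType) (c : I -> B) (F : I -> M) :
  base_change_form (\sum_(i : I) c i *: tens f (F i))%LM = \sum_i c i * f (m (F i)).
Proof.
rewrite (big_morph base_change_form base_change_formD base_change_form0).
by apply: eq_bigr => i _; rewrite base_change_formE.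
Qed.

End BaseChangeTheory.

Lemma skew_mod_scale (B : comPzRingType) (p : nat) (phi del : B -> B) (M : lmodule B)
    (F Q : M -> M) (FD : forall x y, F (x + y)%LM = (F x + F y)%LM)
    (FZ : forall b x, F (b *: x)%LM = (phi b *: F x)%LM)
    (QD : forall x y, Q (x + y)%LM = (Q x + Q y)%LM)
    (QZ : forall b x, Q (b *: x)%LM = (b *: Q x + del b *: x)%LM)
    (QF : forall x, Q (F x) = (p%:R *: F (Q x))%LM) s x :
  lm_scale (M := skew_mod FD FZ QD QZ QF) (sk_class p phi del s) x = sk_eval F Q s x.
Proof. exact: sk_actE. Qed.

Section CharacterModule.

Variables (p : nat) (pr_p : prime p) (A : idomainType) (D : dpq_ring p A).
Hypothesis A_complete : padic_complete p A.
Hypothesis A_char0 : [pchar A] =i pred0.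
Local Notation L := {fraction A}.
Local Notation tofrac := (@FracField.tofrac A).
Local Notation mu := (mu pr_p A_complete).
Local Notation psi_p := (psi_p pr_p D).
Local Notation psi_q := (psi_q D).

Lemma frac_natX_neq0 n : (p%:R : L) ^+ n != 0.
Proof.
by rewrite expf_neq0 // -(rmorph_nat tofrac) tofrac_eq0 (natr_neq0 A_char0) ?prime_gt0.
Qed.

Lemma char_familyE r (x : 'I_r + pq_index r) :
  char_family pr_p psi_p psi_q x = tens tofrac (family pr_p D x).
Proof. by case: x. Qed.

Lemma tens_family_span r (x : char_mod D r) :
  lin_span (char_family pr_p psi_p psi_q (r := r)) (tens tofrac x).
Proof.
have [c cE] := family_span pr_p A_complete A_char0 x.
have -> : tens tofrac x = ((p%:R ^+ r)^-1 *: tens tofrac (p%:R ^+ r *: x)%LM)%LM.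
  by rewrite tensZ lm_scaleA rmorphXn rmorph_nat mulVf ?frac_natX_neq0 ?lm_scale1.
apply: lin_spanZ; exists (fun i => tofrac (c i)); rewrite cE tens_sum.
by apply: eq_bigr => i _; rewrite tensZ char_familyE.
Qed.

Lemma char_family_basis r : is_basis (char_family pr_p psi_p psi_q (r := r)).
Proof.
split=> [|c c0].
  apply: base_change_ind; [exact: lin_span0|exact: lin_spanD|exact: lin_spanZ|].
  exact: tens_family_span.
have coef0 k l : \sum_x c x * family_coef p L x k l = 0.
  pose m (x : char_mod D r) := mu x k l.
  have mD x y : m (x + y)%LM = m x + m y by apply: mu_add.
  have mZ a x : m (a *: x)%LM = a * m x by apply: mu_scale.
  have := congr1 (base_change_form (f := tofrac) m) c0.
  under [in LHS]eq_bigr do rewrite char_familyE.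
  rewrite base_change_form_sum // base_change_form0 // => cm0; rewrite -[RHS]cm0; apply: eq_bigr => x _.
  rewrite /m mu_family; case: x => [i|ij] /=.
    by rewrite rmorphM rmorphB rmorphXn !rmorph_nat.
  by rewrite rmorphM rmorphXn !rmorph_nat.
(* The vanishing (k+1, 0)-coordinates make the tails independent of k, and they are zero for k >=
   r. *)
have tail0 k : family_tail p c k = 0.
  have tailS n : family_tail p c k = family_tail p c (k + n).
    elim: n => [|n ->]; first by rewrite addn0.
    by apply/eqP; rewrite addnS -subr_eq0 -family_coef_sum_p coef0.
  by rewrite (tailS r) family_tail_ge // leq_addl.
move=> [i|ij]; apply/eqP.
  by have /eqP := tail0 i; rewrite family_tail_lt mulf_eq0 (negPf (frac_natX_neq0 i)).
have /eqP := coef0 (val ij).1 (val ij).2.+1.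
by rewrite family_coef_sum_q mulf_eq0 (negPf (frac_natX_neq0 _)).
Qed.

Section Generation.

Variable E : frac_ext D.
Local Notation tc x := (tens tofrac (to_colim x) : colimL D).

Definition generated (v : colimL_skew pr_p E) : Prop :=
  exists P Q, v = (P *: colimL_gen pr_p E psi_p + Q *: colimL_gen pr_p E psi_q)%LM.

Lemma generatedD u v : generated u -> generated v -> generated (u + v)%LM.
Proof.
move=> [P [Q ->]] [P' [Q' ->]]; exists (P + P'), (Q + Q').
by rewrite lm_addACA !lm_scaleDl.
Qed.

Lemma generated_act P v : generated v -> generated (P *: v)%LM.
Proof.
by move=> [Q [R ->]]; exists (P * Q), (P * R); rewrite lm_scaleDr !lm_scaleA.
Qed.

Lemma generated0 : generated lm_zero.
Proof. by exists 0, 0; rewrite !lm_scale0 lm_add0. Qed.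

Lemma sk_C_act b (v : colimL_skew pr_p E) :
  (sk_class p (fe_frob E) (fe_dq E) (SkC b) *: v)%LM = lm_scale (M := colimL D) b v.
Proof. exact: skew_mod_scale. Qed.

Lemma sk_Phi_act r (x : char_mod D r) :
  (sk_class p (fe_frob E) (fe_dq E) (SkPhi L) *: (tc x : colimL_skew pr_p E))%LM =
  tc (char_frob pr_p x).
Proof.
rewrite [LHS]skew_mod_scale /= -[tens _ _]lm_scale1.
rewrite (tens_F_E (fe_frobE E) (colim_frobD pr_p) (colim_frobZ pr_p)).
rewrite rmorph1 lm_scale1.
by rewrite -[to_colim x]lm_scale1 colim_frob_E rfrob1 lm_scale1.
Qed.

Lemma sk_Del_act r (x : char_mod D r) :
  (sk_class p (fe_frob E) (fe_dq E) (SkDel L) *: (tc x : colimL_skew pr_p E))%LM =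
  tc (char_dq x).
Proof.
rewrite [LHS]skew_mod_scale /= -[tens _ (to_colim x)]lm_scale1.
rewrite (tens_Q_E (fe_dq_der E) (fe_dqE E) (@colim_dqD p A D) (@colim_dqZ p A D)).
rewrite (der1 (fe_dq_der E)) lm_scale0 lm_addr0 lm_scale1.
by rewrite -[to_colim x]lm_scale1 colim_dq_E rdq1 lm_scale0 lm_addr0 lm_scale1.
Qed.

Lemma generated_gen_p : generated (tc psi_p).
Proof. by exists 1, 0; rewrite lm_scale1 lm_scale0 lm_addr0. Qed.

Lemma generated_gen_q : generated (tc psi_q).
Proof. by exists 0, 1; rewrite lm_scale1 lm_scale0 lm_add0. Qed.

Lemma generated_iter_frob i r (x : char_mod D r) :
  generated (tc x) -> generated (tc (iter_frob pr_p i x)).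
Proof.
by move=> gx; elim: i => // i IHi; rewrite /= -sk_Phi_act; apply: generated_act.
Qed.

Lemma generated_iter_dq j r (x : char_mod D r) :
  generated (tc x) -> generated (tc (iter_dq j x)).
Proof.
by move=> gx; elim: j => // j IHj; rewrite /= -sk_Del_act; apply: generated_act.
Qed.

Lemma to_colim_incl r s (le_sr : (s <= r)%N) (x : char_mod D s) :
  to_colim (char_incl le_sr x) = to_colim x.
Proof.
have castE a b (e : a = b) (y : char_mod D a) : to_colim (char_cast e y) = to_colim y.
  by case: b / e.
by rewrite castE; elim: (r - s)%N => //= k IHk; rewrite to_colim_emb.
Qed.

Lemma generated_family r (x : 'I_r + pq_index r) : generated (tc (family pr_p D x)).
Proof.
case: x => [i|ij]; rewrite to_colim_incl; apply: generated_iter_frob.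
  exact: generated_gen_p.
exact/generated_iter_dq/generated_gen_q.
Qed.

(** A scalar of L acts as a constant of the skew ring, so the generated submodule is an L-subspace
    and absorbs the division by p^r in [generated_char]. *)
Lemma generatedZ b (v : colimL D) :
  generated v -> generated (lm_scale (M := colimL D) b v).
Proof. by rewrite -sk_C_act; apply: generated_act. Qed.

Lemma generated_char r (x : char_mod D r) : generated (tc x).
Proof.
have [c cE] := family_span pr_p A_complete A_char0 x.
have -> : tc x = lm_scale (M := colimL D) ((p%:R ^+ r)^-1) (tc (p%:R ^+ r *: x)%LM).
  by rewrite to_colimZ tensZ lm_scaleA rmorphXn rmorph_nat mulVf ?frac_natX_neq0 ?lm_scale1.
apply: generatedZ; rewrite cE.
elim/big_ind: _ => [|u v gu gv|i _].
- by rewrite -(lm_scale0 lm_zero) to_colimZ lm_scale0 tens0; apply: generated0.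
- by rewrite to_colimD tensD; apply: generatedD.
- by rewrite to_colimZ tensZ; apply/generatedZ/generated_family.
Qed.

Lemma generated_all v : generated v.
Proof.
move: v; apply: base_change_ind; [exact: generated0|exact: generatedD|exact: generatedZ|].
elim/pres_ind; elim=> [|[b [r x]] s IHs]; first by rewrite tens0; apply: generated0.
by rewrite pres_cons tensD tensZ; apply: generatedD => //; apply/generatedZ/generated_char.
Qed.

End Generation.

End CharacterModule.

Theorem proposition7p2 (p : nat) (pr_p : prime p) (p_neq2 : p <> 2%N)
    (A : idomainType) (D : dpq_ring p A)
    (A_complete : padic_complete p A)
    (A_noetherian : noetherian A)
    (A_char0 : [pchar A] =i pred0) :
  exists psi_p psi_q : char_mod D 1,
    [/\ is_psi_p psi_p,
        is_psi_q psi_q,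
        forall r : nat, (1 <= r)%N ->
          is_basis (char_family pr_p psi_p psi_q (r := r))
      & exists E : frac_ext D, forall v : colimL_skew pr_p E,
          exists P Q : skew_ring p (fe_frob E) (fe_dq E),
            v = (P *: colimL_gen pr_p E psi_p +
                 Q *: colimL_gen pr_p E psi_q)%LM].
Proof.
exists (psi_p pr_p D), (psi_q D); split.
- exact: psi_pP.
- exact: psi_qP.
- by move=> r _; apply: char_family_basis.
- have [E] := frac_extension pr_p (rfrob_inj (D := D) pr_p A_complete A_noetherian A_char0).
  by exists E => v; apply: (generated_all A_complete A_char0).
Qed.
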